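(* Let $n\in\mathbb{N}$, let $\Gamma$ be a group of type $\mathrm{FP}_{n+1}$, and let $\Lambda\subset\Gamma$ be a subgroup of finite index. Let $Z$ be $\mathbb{Z}$ or a finite field. (i) If $\alpha\colon\Gamma\curvearrowright(X,\mu)$ is a standard $\Gamma$-action, then $$\mathrm{medim}^Z_n(\alpha|_\Lambda)\le[\Gamma:\Lambda]\cdot\mathrm{medim}^Z_n(\alpha),\qquad\mathrm{mevol}_n(\alpha|_\Lambda)\le[\Gamma:\Lambda]\cdot\mathrm{mevol}_n(\alpha).$$ (ii) If $\beta\colon\Lambda\curvearrowright(Y,\nu)$ is a standard $\Lambda$-action, then $$\mathrm{medim}^Z_n(\mathrm{Ind}_\Lambda^\Gamma\beta)=\frac1{[\Gamma:\Lambda]}\cdot\mathrm{medim}^Z_n(\beta),\qquad\mathrm{mevol}_n(\mathrm{Ind}_\Lambda^\Gamma\beta)=\frac1{[\Gamma:\Lambda]}\cdot\mathrm{mevol}_n(\beta).$$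
   Context: $\alpha|_\Lambda$ is the restricted standard action $\Lambda\curvearrowright(X,\mu)$. $\mathrm{Ind}_\Lambda^\Gamma\beta$ is the standard $\Gamma$-action by left translation on $\Gamma\times_\Lambda Y=(\Gamma\times Y)/\big((\gamma\lambda,y)\sim(\gamma,\lambda y)\big)$ with the induced measure rescaled to a probability measure (each of the $[\Gamma:\Lambda]$ copies of $Y$ carries $\nu/[\Gamma:\Lambda]$). $\mathbb{N}$ contains $0$. $Z$ denotes $\mathbb{Z}$ with the usual absolute value or a finite field with the trivial norm ($|0|=0$, $|x|=1$ for $x\neq 0$). A group $\Gamma$ is of type $\mathrm{FP}_m$ if the trivial $\mathbb{Z}\Gamma$-module $\mathbb{Z}$ has a projective resolution that is finitely generated in degrees $\le m$. Standard actions. A standard $\Gamma$-action $\alpha\colon\Gamma\curvearrowright(X,\mu)$ is an essentially free, probability measure preserving action of a countable group on a standard Borel probability space. $L^\infty(\alpha,Z)=L^\infty(X,\mu,Z)$ is the ring of essentially bounded measurable functions $X\to Z$ modulo a.e. equality, with $(\gamma\cdot\lambda)(x)=\lambda(\gamma^{-1}x)$. The crossed product ring $R=L^\infty(\alpha,Z)*\Gamma$ is the free $L^\infty(\alpha,Z)$-module with basis $\Gamma$ (elements are finite sums of terms $(\lambda,\gamma)$) with multiplication $(\lambda,\gamma)(\lambda',\gamma')=(\lambda\cdot(\gamma\cdot\lambda'),\gamma\gamma')$. It contains $Z\Gamma$ via $\gamma\mapsto(1,\gamma)$ and acts on $L^\infty(\alpha,Z)$ by $(\lambda,\gamma)\cdot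 f=\lambda\cdot(\gamma\cdot f)$. Marked modules. For measurable $A\subset X$ put $\langle A\rangle=R\cdot(\chi_A,1)$. A marked projective $R$-module is an $R$-module $M$ with a finite family $(A_i)_{i\in I}$ of measurable subsets of $X$ and an isomorphism $M\cong\bigoplus_{i\in I}\langle A_i\rangle$ (suppressed from notation); $\dim_R(M)=\sum_i\mu(A_i)$. On $R$ let $|\sum_\gamma(\lambda_\gamma,\gamma)|_1=\sum_\gamma\int_X|\lambda_\gamma|\,d\mu$; elements of $M\subset\bigoplus_I R$ have norm $\|\sum_i\lambda_ie_i\|_1=\sum_i|\lambda_i|_1$. For an $R$-homomorphism $f\colon M\to N$ of marked projective modules, $\|f\|$ is the least $c$ with $\|f(z)\|_1\le c\|z\|_1$ for all $z$ (always finite). A marked direct summand of $\bigoplus_j\langle B_j\rangle$ is a submodule $\bigoplus_j\langle B_j'\rangle$ with $B_j'\subset B_j$ measurable. A finite marked decomposition of $M=\bigoplus_i\langle A_i\rangle$ is a finite family $(M_k)_k$ with $M_k=\bigoplus_i\langle A_{i,k}\rangle$ for measurable partitions $A_i=\bigsqcup_kA_{i,k}$. Logarithmic norm. $\log_+(t)=\max\{\log t,0\}$ (and $\log_+0=0$). $\mathrm{rk}(f)=\inf\{\dim N'\mid N'\subset N\text{ marked direct summand with }f(M)\subset N'\}$; $\mathrm{lognorm}'(f)=\min\{\dim(M)\log_+\|f\|,\ \mathrm{rk}(f)\log_+\|f\|\}$; $\mathrm{lognorm}(f)=\inf\sum_k\mathrm{lognorm}'(f|_{M_k}\colon M_k\to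 N)$, the infimum over all finite marked decompositions $(M_k)_k$ of $M$. Measured embeddings. A marked projective augmented $R$-chain complex $D_*\twoheadrightarrow L^\infty(\alpha,Z)$ is a chain complex $(D_k)_{k\ge0}$ of marked projective $R$-modules with a surjective $R$-homomorphism $\eta\colon D_0\to L^\infty(\alpha,Z)$, $\eta\circ\partial_1=0$. Fix a free $Z\Gamma$-resolution $C_*\twoheadrightarrow Z$ (the following is independent of the choice). An $\alpha$-embedding (up to degree $n$) is such a complex together with a $Z\Gamma$-chain map $C_*\to D_*$ up to degree $n+1$ extending the inclusion $Z\to L^\infty(\alpha,Z)$ as constant functions. $A_n(\alpha)$ is the class of all augmented complexes $D_*$ arising in this way. For $\Gamma$ of type $\mathrm{FP}_{n+1}$: $\mathrm{medim}^Z_n(\alpha)=\inf_{D_*\in A_n(\alpha)}\dim_R(D_n)$, and (for $Z=\mathbb{Z}$) $\mathrm{mevol}_n(\alpha)=\inf_{D_*\in A_n(\alpha)}\mathrm{lognorm}(\partial^D_{n+1})$. *)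

(* Defs.v *)
From HB Require Import structures.
From mathcomp Require Import all_boot all_order all_algebra finmap.
From mathcomp Require Import all_classical all_reals all_analysis.
Import Order.TTheory GRing.Theory Num.Theory numFieldNormedType.Exports.

Set Implicit Arguments.
Unset Strict Implicit.
Unset Printing Implicit Defensive.

Local Open Scope classical_set_scope.
Local Open Scope ring_scope.

(* The coefficient rings: the integers with the usual absolute value, or a
   finite field with the trivial norm. *)
Inductive coeff : Type := CoeffInt | CoeffField of finFieldType.

Definition coeff_ring (Z : coeff) : countComNzRingType :=
  match Z with CoeffInt => int | CoeffField F => F end.
Coercion coeff_ring : coeff >-> CountRing.ComNzRing.type.

Definition coeff_norm (R : realType) (Z : coeff) : Z -> R :=
  match Z with
  | CoeffInt => fun x : int => `|x|%:~R
  | CoeffField F => fun x : F => (x != 0)%:R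
  end.

(* An action of G on the ring A by ring automorphisms; automorphism rather than
   endomorphism by [ract1] and [ractM]. *)
Record ring_action (G : groupType) (A : comNzRingType) := RingAction {
  ract :> G -> {rmorphism A -> A};
  ract1 : forall a, ract 1%g a = a;
  ractM : forall g h a, ract (g * h)%g a = ract g (ract h a)
}.

Section CrossedProduct.
Variables (G : groupType) (A : comNzRingType).

Definition finite_support : {pred G -> A} :=
  fun f => `[< finite_set [set g | f g != 0] >].

Lemma finite_support_zmod_closed : zmod_closed finite_support.
Proof.
split=> [|f g]; rewrite !unfold_in; first apply/asboolP.
  rewrite (_ : [set _ | _] = set0)//; apply/seteqP; split=> x //=.
  by rewrite eqxx.
move=> /asboolP ff /asboolP fg; apply/asboolP.
apply: (@sub_finite_set _ _ ([set x | f x != 0] `|` [set x | g x != 0])).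
  move=> x /=; have [fx0|] := eqVneq (f x) 0; last by left.
  have [gx0|] := eqVneq (g x) 0; last by right.
  by rewrite addrfctE opprfctE fx0 gx0 subrr eqxx.
by rewrite finite_setU.
Qed.
HB.instance Definition _ :=
  GRing.isZmodClosed.Build (G -> A) finite_support finite_support_zmod_closed.

(* Underlying module of the crossed product A * G, an element
   \sum_g (a_g, g) being the finitely supported function g |-> a_g. *)
Record cprod (r : ring_action G A) :=
  Cprod { cprod_val :> G -> A; _ : cprod_val \in finite_support }.

Section Zmod.
Variable r : ring_action G A.
HB.instance Definition _ := [isSub for @cprod_val r].
HB.instance Definition _ := [Choice of cprod r by <:].
HB.instance Definition _ := [SubChoice_isSubZmodule of cprod r by <:].

Implicit Types (f g : cprod r) (a : A) (x : G).

Definition csupp f : {fset G} := fset_set [set x | f x != 0].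

Lemma in_csupp f x : (x \in csupp f) = (f x != 0).
Proof.
case: f => f fP; rewrite in_fset_set/=; last first.
  by move: fP; rewrite unfold_in => /asboolP.
by apply/idP/idP => [/set_mem//|?]; apply/mem_set.
Qed.

Lemma cprodP f g : (forall x, f x = g x) -> f = g.
Proof. by move=> fg; apply/val_inj/funext. Qed.

Lemma cprodD f g x : (f + g) x = f x + g x. Proof. by []. Qed.
Lemma cprod0 x : (0 : cprod r) x = 0. Proof. by []. Qed.

Lemma cprod_sumE I (s : seq I) (P : pred I) (F : I -> cprod r) x :
  (\sum_(i <- s | P i) F i) x = \sum_(i <- s | P i) F i x.
Proof. by elim/big_rec2: _ => [|i y z _ <-]; rewrite ?cprod0 ?cprodD. Qed.

Lemma cmono_subproof a x :
  (fun y => if y == x then a else 0) \in finite_support.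
Proof.
rewrite unfold_in; apply/asboolP; apply: (@sub_finite_set _ _ [set x]) => //.
by move=> y /=; case: (y =P x); rewrite ?eqxx.
Qed.

(* The term (a, x). *)
Definition cmono a x : cprod r := Cprod r (cmono_subproof a x).

Lemma cmonoD x : {morph (fun a => cmono a x) : a b / a + b}.
Proof.
by move=> a b; apply: cprodP => y; rewrite cprodD /=; case: eqP; rewrite ?addr0.
Qed.

Definition cprod_sum (V : nmodType) (F : G -> A -> V) f : V :=
  \sum_(x <- csupp f) F x (f x).

Section Sum.
Variables (V : zmodType) (F : G -> A -> V).
Hypothesis FD : forall x, {morph F x : a b / a + b}.

Let F0 x : F x 0 = 0.
Proof. by apply: (addrI (F x 0)); rewrite -FD !addr0. Qed.

Lemma cprod_sum_mono a x : cprod_sum F (cmono a x) = F x a.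
Proof.
rewrite /cprod_sum; transitivity (\sum_(y <- [fset x]%fset) F y (cmono a x y)).
  apply: big_fset_incl => [|y _]; last by rewrite in_csupp negbK => /eqP ->.
  apply/fsubsetP => y; rewrite in_csupp inE/=.
  by have [|_] := eqVneq y x; rewrite ?eqxx.
by rewrite big_seq_fset1/= eqxx.
Qed.

Lemma cprod_sumD : {morph cprod_sum F : f g / f + g}.
Proof.
move=> f g; pose D := (csupp f `|` csupp g)%fset.
have wid (h : cprod r) : (forall x, x \notin D -> h x = 0) ->
    cprod_sum F h = \sum_(x <- D) F x (h x).
  move=> hD; rewrite /cprod_sum; apply: big_fset_incl.
    apply/fsubsetP => x; rewrite in_csupp; apply: contraNT => /hD ->//.
  by move=> y _; rewrite in_csupp negbK => /eqP ->.
rewrite !wid.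
- by rewrite -big_split; apply: eq_bigr => x _; exact: FD.
- by move=> x; rewrite inE !in_csupp negb_or !negbK => /andP[_ /eqP].
- by move=> x; rewrite inE !in_csupp negb_or !negbK => /andP[/eqP].
- move=> x; rewrite inE !in_csupp negb_or !negbK => /andP[/eqP fx /eqP gx].
  by rewrite cprodD fx gx addr0.
Qed.
End Sum.

Lemma cprod_sum_cmono f : cprod_sum (fun x a => cmono a x) f = f.
Proof.
apply: cprodP => x; rewrite cprod_sumE.
have [xf|xf] := boolP (x \in csupp f).
  rewrite (big_fsetD1 x)//= eqxx big_seq big1 ?addr0// => y.
  by rewrite !inE eq_sym; case: eqP.
rewrite big_seq big1 => [|y yf].
  by move: xf; rewrite in_csupp negbK => /eqP.
by rewrite /=; case: eqP => // xy; rewrite xy yf in xf.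
Qed.

Lemma cprod_ind (P : cprod r -> Prop) :
  P 0 -> (forall f g, P f -> P g -> P (f + g)) -> (forall a x, P (cmono a x)) ->
  forall f, P f.
Proof. by move=> P0 PD Pm f; rewrite -(cprod_sum_cmono f); apply: big_ind. Qed.

End Zmod.
End CrossedProduct.

Arguments cmono {G A} r a x.
Arguments cprod_sum {G A r V} F f.

(* A as a module over A * G, through (a, x) . m = a * x.m. *)
Definition base_module (G : groupType) (A : comNzRingType)
  (_ : ring_action G A) : Type := A.

Section CrossedProductRing.
Variables (G : groupType) (A : comNzRingType) (r : ring_action G A).
Implicit Types (f g h : cprod r) (a b : A) (x y : G).

Definition cone : cprod r := cmono r 1 1%g.

(* The bilinear extension of (a, x) (b, y) = (a * x.b, xy). *)
Definition cmul f g : cprod r :=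
  cprod_sum
    (fun x a => cprod_sum (fun y b => cmono r (a * r x b) (x * y)%g) g) f.

Let cmulr_add (x : G) a : forall y,
  {morph (fun b => cmono r (a * r x b) (x * y)%g) : b c / b + c}.
Proof. by move=> y b c; rewrite rmorphD/= mulrDr cmonoD. Qed.

Let cmull_add g : forall x,
  {morph (fun a => cprod_sum (fun y b => cmono r (a * r x b) (x * y)%g) g) :
    a c / a + c}.
Proof.
move=> x a c; rewrite /cprod_sum -big_split/=; apply: eq_bigr => y _.
by rewrite mulrDl cmonoD.
Qed.

Let cmulDl : left_distributive cmul +%R.
Proof. by move=> f g h; rewrite /cmul cprod_sumD. Qed.

Let cmulDr : right_distributive cmul +%R.
Proof.
move=> f g h; rewrite /cmul {1 3 5}/cprod_sum -big_split/=.
apply: eq_bigr => x _.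
by rewrite cprod_sumD.
Qed.

Lemma cmul_mono a x b y :
  cmul (cmono r a x) (cmono r b y) = cmono r (a * r x b) (x * y)%g.
Proof. by rewrite /cmul cprod_sum_mono// cprod_sum_mono. Qed.

Let cmul0l f : cmul 0 f = 0.
Proof. by apply: (addrI (cmul 0 f)); rewrite -cmulDl !addr0. Qed.
Let cmul0r f : cmul f 0 = 0.
Proof. by apply: (addrI (cmul f 0)); rewrite -cmulDr !addr0. Qed.

Let cmulA : associative cmul.
Proof.
move=> f g h; elim/cprod_ind: f => [|f f' IH IH'|a x]; rewrite ?cmul0l//.
  by rewrite !cmulDl IH IH'.
elim/cprod_ind: g => [|f f' IH IH'|b y]; rewrite ?(cmul0l, cmul0r)//.
  by rewrite !(cmulDl, cmulDr) IH IH'.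
elim/cprod_ind: h => [|f f' IH IH'|c z]; rewrite ?(cmul0l, cmul0r)//.
  by rewrite !cmulDr IH IH'.
by rewrite !cmul_mono rmorphM/= ractM mulrA mulgA.
Qed.

Let cmul1l : left_id cone cmul.
Proof.
move=> f; elim/cprod_ind: f => [|f f' IH IH'|a x]; rewrite ?cmul0r//.
  by rewrite cmulDr IH IH'.
by rewrite cmul_mono ract1 mul1r mul1g.
Qed.

Let cmul1r : right_id cone cmul.
Proof.
move=> f; elim/cprod_ind: f => [|f f' IH IH'|a x]; rewrite ?cmul0l//.
  by rewrite cmulDl IH IH'.
by rewrite cmul_mono rmorph1 mulr1 mulg1.
Qed.

Let cone_neq0 : cone != 0.
Proof.
apply/eqP => /(congr1 (fun f : cprod r => f 1%g)) /=; rewrite eqxx => /eqP.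
by rewrite oner_eq0.
Qed.

HB.instance Definition _ := GRing.Zmodule_isNzRing.Build (cprod r)
  cmulA cmul1l cmul1r cmulDl cmulDr cone_neq0.

Local Notation base_module := (base_module r).
HB.instance Definition _ := GRing.Zmodule.on base_module.

Definition base_scale f (m : base_module) : base_module :=
  cprod_sum (fun x a => a * r x m) f.

Let base_add m : forall x, {morph (fun a => a * r x m) : a b / a + b}.
Proof. by move=> x a b; rewrite mulrDl. Qed.

Let base_scaleDl m : {morph base_scale^~ m : f g / f + g}.
Proof. by move=> f g; rewrite /base_scale cprod_sumD. Qed.

Let base_scaleDr : right_distributive base_scale +%R.
Proof.
move=> f m n; rewrite /base_scale /cprod_sum -big_split/=.
apply: eq_bigr => x _.
by rewrite rmorphD mulrDr.
Qed.

Lemma base_scale_mono a x m : base_scale (cmono r a x) m = a * r x m.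
Proof. by rewrite /base_scale cprod_sum_mono. Qed.

Let base_scale0 m : base_scale 0 m = 0.
Proof. by apply: (addrI (base_scale 0 m)); rewrite -base_scaleDl !addr0. Qed.
Let base_scale0r f : base_scale f 0 = 0.
Proof. by apply: (addrI (base_scale f 0)); rewrite -base_scaleDr !addr0. Qed.

Let base_scaleA f g m : base_scale f (base_scale g m) = base_scale (f * g) m.
Proof.
elim/cprod_ind: f => [|f f' IH IH'|a x].
- by rewrite mul0r !base_scale0.
- by rewrite mulrDl !base_scaleDl IH IH'.
elim/cprod_ind: g => [|g g' IH IH'|b y].
- by rewrite mulr0 !base_scale0 base_scale0r.
- by rewrite mulrDr !base_scaleDl base_scaleDr IH IH'.
rewrite [_ * _]cmul_mono !base_scale_mono.
by rewrite rmorphM/= ractM mulrA.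
Qed.

Let base_scale1 : left_id 1 base_scale.
Proof. by move=> m; rewrite -[1]/cone base_scale_mono ract1 mul1r. Qed.

HB.instance Definition _ := GRing.Zmodule_isLmodule.Build (cprod r) base_module
  base_scaleA base_scale1 base_scaleDr (fun m => @base_scaleDl m).
End CrossedProductRing.

Section CrossedProductMap.
Variables (G : groupType) (A B : comNzRingType).
Variables (r : ring_action G A) (s : ring_action G B).
Variable phi : {rmorphism A -> B}.
Hypothesis phi_equiv : forall g a, phi (r g a) = s g (phi a).

Definition cprod_map (f : cprod r) : cprod s :=
  cprod_sum (fun x a => cmono s (phi a) x) f.

Let cprod_map_add : forall x,
  {morph (fun a => cmono s (phi a) x) : a b / a + b}.
Proof. by move=> x a b; rewrite rmorphD cmonoD. Qed.

Lemma cprod_mapD : {morph cprod_map : f g / f + g}.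
Proof. by move=> f g; rewrite /cprod_map cprod_sumD. Qed.

Lemma cprod_map_mono a x : cprod_map (cmono r a x) = cmono s (phi a) x.
Proof. by rewrite /cprod_map cprod_sum_mono. Qed.

Lemma cprod_map0 : cprod_map 0 = 0.
Proof. by apply: (addrI (cprod_map 0)); rewrite -cprod_mapD !addr0. Qed.

Lemma cprod_map_nmod_morphism : nmod_morphism cprod_map.
Proof. by split; [exact: cprod_map0|exact: cprod_mapD]. Qed.

Lemma cprod_map_monoid_morphism : monoid_morphism cprod_map.
Proof.
split; first by rewrite -[X in cprod_map X]/(cone r) cprod_map_mono rmorph1.
move=> f g; elim/cprod_ind: f => [|f f' IH IH'|a x].
- by rewrite !(mul0r, cprod_map0).
- by rewrite mulrDl !cprod_mapD mulrDl IH IH'.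
elim/cprod_ind: g => [|g g' IH IH'|b y].
- by rewrite !(mulr0, cprod_map0).
- by rewrite mulrDr !cprod_mapD mulrDr IH IH'.
rewrite [_ * _]cmul_mono !cprod_map_mono [RHS]cmul_mono.
by rewrite rmorphM phi_equiv.
Qed.
End CrossedProductMap.

Section GroupRing.
Variables (Z : coeff) (G : groupType).

Definition trivial_action : ring_action G Z :=
  @RingAction G Z (fun=> idfun) (fun=> erefl) (fun _ _ _ => erefl).

(* ZG is the crossed product for the trivial action, and the base module is then
   Z with trivial G-action. *)
Definition group_ring : nzRingType := cprod trivial_action.

Definition trivial_module : lmodType group_ring := base_module trivial_action.
End GroupRing.

Section HomologicalAlgebra.
Variable R : nzRingType.

Definition free_module (M : lmodType R) : Prop :=
  exists (B : choiceType) (b : B -> M), forall m : M,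
    exists! c : {fsfun B -> R with 0}, m = \sum_(i <- finsupp c) c i *: b i.

Definition projective_module (P : lmodType R) : Prop :=
  forall (M N : lmodType R) (p : {linear M -> N}) (f : {linear P -> N}),
    (forall y, exists x, p x = y) ->
    exists g : {linear P -> M}, forall x, p (g x) = f x.

Definition finitely_generated (M : lmodType R) : Prop :=
  exists (k : nat) (v : 'I_k -> M), forall m : M,
    exists c : 'I_k -> R, m = \sum_i c i *: v i.

Record resolution (M : lmodType R) := Resolution {
  res_mod :> nat -> lmodType R;
  res_bd : forall k, {linear res_mod k.+1 -> res_mod k};
  res_aug : {linear res_mod 0%N -> M};
  res_aug_surj : forall m, exists x, res_aug x = m;
  res_exact0 : forall x, res_aug x = 0 <-> exists y, res_bd 0%N y = x;
  res_exact : forall k x, res_bd k x = 0 <-> exists y, res_bd k.+1 y = x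
}.
End HomologicalAlgebra.

Definition type_FP (G : groupType) (m : nat) : Prop :=
  exists P : resolution (trivial_module CoeffInt G),
    (forall k, projective_module (P k)) /\
    (forall k, (k <= m)%N -> finitely_generated (P k)).

Record free_resolution (Z : coeff) (G : groupType) := FreeResolution {
  free_res :> resolution (trivial_module Z G);
  free_resP : forall k, free_module (free_res k)
}.

(* The measurable sets of X correspond to the Borel sets of a Polish space.
   Points of a completePseudoMetricType are separated only under
   [hausdorff_space]. *)
Definition standard_borel (R : realType) d (X : measurableType d) : Prop :=
  exists P : completePseudoMetricType R,
    [/\ hausdorff_space P, @second_countable P &
      exists2 f : X -> P, bijective f &
        forall A : set X, measurable A <-> <<s @open P >> (f @` A)].

Record pmp_action (R : realType) (G : groupType) d (X : measurableType d)
    (mu : probability X R) := PmpAction {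
  pmp_act :> G -> X -> X;
  pmp_act1 : forall x, pmp_act 1%g x = x;
  pmp_actM : forall g h x, pmp_act (g * h)%g x = pmp_act g (pmp_act h x);
  pmp_measurable : forall g, measurable_fun setT (pmp_act g);
  pmp_preserving : forall g A, measurable A -> mu (pmp_act g @^-1` A) = mu A
}.
Arguments pmp_action {R} G {d X} mu.

Definition essentially_free (R : realType) (G : groupType) d
    (X : measurableType d) (mu : probability X R) (alpha : pmp_action G mu) :=
  {ae mu, forall x, forall g, alpha g x = x -> g = 1%g}.

Definition standard_action (R : realType) (G : groupType) d
    (X : measurableType d) (mu : probability X R) (alpha : pmp_action G mu) :=
  [/\ countable [set: G], standard_borel R X & essentially_free alpha].

Section CoeffNorm.
Variables (R : realType) (Z : coeff).
Local Notation norm := (@coeff_norm R Z).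

Lemma coeff_norm_ge0 x : 0 <= norm x.
Proof. by case: Z x => [|F] x; rewrite /coeff_norm ?ler0z. Qed.

Lemma coeff_norm0 : norm 0 = 0.
Proof. by case: Z => [|F]; rewrite /coeff_norm ?eqxx// normr0. Qed.

Lemma coeff_norm1 : norm 1 = 1.
Proof. by case: Z => [|F]; rewrite /coeff_norm ?oner_neq0// normr1. Qed.

Lemma coeff_normB x y : norm (x - y) <= norm x + norm y.
Proof.
case: Z x y => [|F] x y; rewrite /coeff_norm.
  by rewrite -intrD ler_int ler_normB.
have [->|x0] := eqVneq x 0; first by rewrite sub0r oppr_eq0 add0r.
by rewrite (@le_trans _ _ 1) ?lerDl//; case: eqP.
Qed.

Lemma coeff_normM x y : norm (x * y) <= norm x * norm y.
Proof.
case: Z x y => [|F] x y; rewrite /coeff_norm.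
  by rewrite -intrM ler_int normrM.
by rewrite mulf_eq0 negb_or; do 2 case: eqP; rewrite ?(mulr0,mul0r,mulr1).
Qed.
End CoeffNorm.

Section Linfty.
Variables (R : realType) (d : measure_display) (X : measurableType d).
Variables (mu : probability X R) (Z : coeff).

(* Z is countable and discrete, so all its subsets are measurable. *)
Definition bounded_measurable : {pred X -> Z} := fun f =>
  `[< (forall B : set Z, measurable (f @^-1` B)) /\
      exists M : R, {ae mu, forall x, coeff_norm R (f x) <= M} >].

Lemma measurable_op2 (op : Z -> Z -> Z) (f g : X -> Z) :
  (forall B : set Z, measurable (f @^-1` B)) ->
  (forall B : set Z, measurable (g @^-1` B)) ->
  forall B : set Z, measurable ((fun x => op (f x) (g x)) @^-1` B).
Proof.
move=> mf mg B.
rewrite (_ : _ @^-1` B = \bigcup_(p : Z * Z)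
  if `[< B (op p.1 p.2) >] then f @^-1` [set p.1] `&` g @^-1` [set p.2]
  else set0); last first.
  apply/seteqP; split=> [x /= Bx|x [[a b] _] /=].
    by exists (f x, g x) => //=; rewrite asboolT.
  by case: asboolP => // Bab [/= -> ->].
apply: countable_bigcupT_measurable => [|p]; first exact: countableP.
by case: ifP => // _; apply: measurableI.
Qed.

Lemma bounded_measurable_subring_closed : subring_closed bounded_measurable.
Proof.
split=> [|f g|f g]; rewrite !unfold_in.
- apply/asboolP; split=> [B|].
    have [B1|B1] := pselect (B 1).
      by rewrite (_ : _ @^-1` B = setT)//; apply/seteqP; split.
    by rewrite (_ : _ @^-1` B = set0)//; apply/seteqP; split.
  by exists 1; apply/aeW => x; rewrite coeff_norm1.
- move=> /asboolP[mf [M fM]] /asboolP[mg [N gN]]; apply/asboolP; split.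
    exact: (measurable_op2 (fun a b => a - b) mf mg).
  exists (M + N); apply: filterS2 fM gN => x fM gN.
  by rewrite (le_trans (coeff_normB _ _ _))// lerD.
- move=> /asboolP[mf [M fM]] /asboolP[mg [N gN]]; apply/asboolP; split.
    exact: (measurable_op2 *%R mf mg).
  exists (M * N); apply: filterS2 fM gN => x fM gN.
  by rewrite (le_trans (coeff_normM _ _ _))// ler_pM ?coeff_norm_ge0.
Qed.
HB.instance Definition _ := GRing.isSubringClosed.Build (X -> Z)
  bounded_measurable bounded_measurable_subring_closed.

Record bounded_fun :=
  BoundedFun { bfun :> X -> Z; _ : bfun \in bounded_measurable }.
HB.instance Definition _ := [isSub for bfun].
HB.instance Definition _ := [Choice of bounded_fun by <:].
HB.instance Definition _ := [SubChoice_isSubComNzRing of bounded_fun by <:].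

Definition null_fun : {pred bounded_fun} :=
  fun f => `[< {ae mu, forall x, f x = 0} >].

Lemma null_fun_idealr_closed : idealr_closed null_fun.
Proof.
split=> [||a f g]; rewrite !unfold_in.
- by apply/asboolP/aeW.
- apply/asboolP => h; have : {ae mu, forall x : X, False}.
    apply: filterS h => x /eqP; rewrite (_ : (1 : bounded_fun) x = 1)//.
    by rewrite oner_eq0.
  move=> [A [mA muA sA]]; have AT : A = setT.
    by apply/seteqP; split=> // x _; apply: sA.
  by move: muA; rewrite AT probability_setT => /eqP; rewrite onee_eq0.
- move=> /asboolP hf /asboolP hg; apply/asboolP.
  apply: filterS2 hf hg => x fx gx.
  by rewrite (_ : (a * f + g) x = a x * f x + g x)// fx gx mulr0 addr0.
Qed.
HB.instance Definition _ :=
  isIdealr.Build bounded_fun null_fun null_fun_idealr_closed.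

Definition Linfty : comNzRingType := {ideal_quot null_fun}.

Definition Linfty_class (f : bounded_fun) : Linfty :=
  (\pi_{ideal_quot null_fun} f)%qT.
Definition Linfty_repr (u : Linfty) : bounded_fun :=
  repr (u : {ideal_quot null_fun}).

End Linfty.
Arguments bounded_measurable {R d X} mu Z.
Arguments null_fun {R d X} mu Z.

Section CrossedProductOfAction.
Variables (R : realType) (G : groupType) (d : measure_display).
Variables (X : measurableType d) (mu : probability X R).
Variables (alpha : pmp_action G mu) (Z : coeff).

Lemma pmp_ae (g : G) (P : X -> Prop) :
  {ae mu, forall x, P x} -> {ae mu, forall x, P (alpha g x)}.
Proof.
move=> [A [mA A0 sA]]; exists (alpha g @^-1` A); split.
- by rewrite -[X in measurable X]setTI; apply: pmp_measurable.
- by rewrite pmp_preserving.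
- by move=> x /= Px; apply: sA.
Qed.

Lemma translate_subproof (g : G) (f : bounded_fun mu Z) :
  (fun x => f (alpha g^-1%g x)) \in bounded_measurable mu Z.
Proof.
have := valP f; rewrite !unfold_in => /asboolP[mf [M fM]]; apply/asboolP; split.
  move=> B; rewrite -[X in measurable X]setTI.
  exact: (pmp_measurable alpha g^-1%g measurableT (mf B)).
by exists M; apply: (@pmp_ae g^-1%g (fun x => coeff_norm R (f x) <= M)).
Qed.

Definition translate (g : G) (f : bounded_fun mu Z) : bounded_fun mu Z :=
  BoundedFun (translate_subproof g f).

(* (g . u)(x) = u (g^-1 x), on classes modulo a.e. equality. *)
Definition Linfty_translate (g : G) (u : Linfty mu Z) : Linfty mu Z :=
  Linfty_class (translate g (Linfty_repr u)).

Lemma Linfty_classP (f f' : bounded_fun mu Z) :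
  Linfty_class f = Linfty_class f' <-> {ae mu, forall x, f x = f' x}.
Proof.
rewrite /Linfty_class; split=> [/eqP|h].
  rewrite -Quotient.idealrBE unfold_in => /asboolP; apply: filterS => x /eqP.
  by rewrite (_ : (f - f') x = f x - f' x)// subr_eq0 => /eqP.
apply/eqP; rewrite -Quotient.idealrBE unfold_in; apply/asboolP.
apply: filterS h => x fx.
by rewrite (_ : (f - f') x = f x - f' x)// fx subrr.
Qed.

Lemma Linfty_reprK (u : Linfty mu Z) : Linfty_class (Linfty_repr u) = u.
Proof. exact: reprK. Qed.

Lemma Linfty_class_repr (f : bounded_fun mu Z) :
  {ae mu, forall x, Linfty_repr (Linfty_class f) x = f x}.
Proof. by apply/Linfty_classP; rewrite Linfty_reprK. Qed.

Lemma Linfty_translate_class g f :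
  Linfty_translate g (Linfty_class f) = Linfty_class (translate g f).
Proof.
apply/Linfty_classP.
exact: (@pmp_ae g^-1%g (fun x => Linfty_repr (Linfty_class f) x = f x)
  (Linfty_class_repr f)).
Qed.

Lemma Linfty_classD f f' :
  Linfty_class (f + f') = Linfty_class f + Linfty_class f' :> Linfty mu Z.
Proof. exact: (rmorphD (\pi_{ideal_quot null_fun mu Z})%qT). Qed.
Lemma Linfty_classM f f' :
  Linfty_class (f * f') = Linfty_class f * Linfty_class f' :> Linfty mu Z.
Proof. exact: (rmorphM (\pi_{ideal_quot null_fun mu Z})%qT). Qed.
Lemma Linfty_class1 : Linfty_class 1 = 1 :> Linfty mu Z.
Proof. exact: (rmorph1 (\pi_{ideal_quot null_fun mu Z})%qT). Qed.
Lemma Linfty_class0 : Linfty_class 0 = 0 :> Linfty mu Z.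
Proof. exact: (rmorph0 (\pi_{ideal_quot null_fun mu Z})%qT). Qed.

Lemma Linfty_translate_nmod_morphism g : nmod_morphism (Linfty_translate g).
Proof.
split=> [|u v].
  rewrite -Linfty_class0 Linfty_translate_class; congr Linfty_class.
  exact/val_inj.
rewrite -(Linfty_reprK u) -(Linfty_reprK v) -Linfty_classD.
rewrite !Linfty_translate_class -Linfty_classD.
by congr Linfty_class; apply/val_inj.
Qed.

Lemma Linfty_translate_monoid_morphism g : monoid_morphism (Linfty_translate g).
Proof.
split=> [|u v].
  rewrite -Linfty_class1 Linfty_translate_class; congr Linfty_class.
  exact/val_inj.
rewrite -(Linfty_reprK u) -(Linfty_reprK v) -Linfty_classM.
rewrite !Linfty_translate_class -Linfty_classM.
by congr Linfty_class; apply/val_inj.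
Qed.
HB.instance Definition _ g := GRing.isNmodMorphism.Build _ _
  (Linfty_translate g) (Linfty_translate_nmod_morphism g).
HB.instance Definition _ g := GRing.isMonoidMorphism.Build _ _
  (Linfty_translate g) (Linfty_translate_monoid_morphism g).

Lemma Linfty_translate1 u : Linfty_translate 1%g u = u.
Proof.
rewrite -(Linfty_reprK u) Linfty_translate_class; congr Linfty_class.
by apply/val_inj/funext => x /=; rewrite invg1 pmp_act1.
Qed.

Lemma Linfty_translateM g h u :
  Linfty_translate (g * h)%g u = Linfty_translate g (Linfty_translate h u).
Proof.
rewrite -(Linfty_reprK u) !Linfty_translate_class; congr Linfty_class.
by apply/val_inj/funext => x /=; rewrite invgM pmp_actM.
Qed.

Definition Linfty_action : ring_action G (Linfty mu Z) :=
  @RingAction G (Linfty mu Z) (fun g => Linfty_translate g)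
    Linfty_translate1 Linfty_translateM.

Definition crossed : nzRingType := cprod Linfty_action.

Definition Linfty_module : lmodType crossed := base_module Linfty_action.

Lemma const_fun_subproof (c : Z) : (fun=> c) \in bounded_measurable mu Z.
Proof.
rewrite unfold_in; apply/asboolP; split=> [B|]; last first.
  by exists (coeff_norm R c); apply: aeW.
have [Bc|Bc] := pselect (B c).
  by rewrite (_ : _ @^-1` B = setT)//; apply/seteqP; split.
by rewrite (_ : _ @^-1` B = set0)//; apply/seteqP; split.
Qed.

Definition Linfty_const (c : Z) : Linfty mu Z :=
  Linfty_class (BoundedFun (const_fun_subproof c)).

Lemma Linfty_const_nmod_morphism : nmod_morphism Linfty_const.
Proof.
split=> [|c e]; rewrite /Linfty_const -?Linfty_class0 -?Linfty_classD;
by congr Linfty_class; apply/val_inj.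
Qed.

Lemma Linfty_const_monoid_morphism : monoid_morphism Linfty_const.
Proof.
split=> [|c e]; rewrite /Linfty_const -?Linfty_class1 -?Linfty_classM;
by congr Linfty_class; apply/val_inj.
Qed.
HB.instance Definition _ := GRing.isNmodMorphism.Build Z (Linfty mu Z)
  Linfty_const Linfty_const_nmod_morphism.
HB.instance Definition _ := GRing.isMonoidMorphism.Build Z (Linfty mu Z)
  Linfty_const Linfty_const_monoid_morphism.

Lemma Linfty_const_equiv g (c : Z) :
  Linfty_const (trivial_action Z G g c) = Linfty_action g (Linfty_const c).
Proof.
rewrite [RHS]Linfty_translate_class; congr Linfty_class; exact/val_inj.
Qed.

Definition group_ring_incl : group_ring Z G -> crossed :=
  cprod_map (r := trivial_action Z G) Linfty_action Linfty_const.

HB.instance Definition _ := GRing.isNmodMorphism.Build (group_ring Z G) crossed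
  group_ring_incl
  (@cprod_map_nmod_morphism G Z _ (trivial_action Z G) Linfty_action
    Linfty_const).
HB.instance Definition _ := GRing.isMonoidMorphism.Build (group_ring Z G)
  crossed group_ring_incl (cprod_map_monoid_morphism Linfty_const_equiv).

(* The class of the indicator of A; [insubd] falls back to 0 for a nonmeasurable
   A, which never occurs below. *)
Definition chi (A : set X) : Linfty mu Z :=
  Linfty_class (insubd 0 (\1_A : X -> Z)).

Lemma indic_bounded_measurable (A : set X) :
  measurable A -> (\1_A : X -> Z) \in bounded_measurable mu Z.
Proof.
move=> mA; rewrite unfold_in; apply/asboolP; split=> [B|].
  by rewrite preimage_indic; do 2 case: ifP => _ //; exact: measurableC.
exists 1; apply: aeW => x; rewrite indicE.
by case: (x \in A); rewrite ?coeff_norm1 ?coeff_norm0.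
Qed.

Lemma chiM (A B : set X) : measurable A -> measurable B -> B `<=` A ->
  chi B * chi A = chi B.
Proof.
move=> mA mB BA; rewrite /chi -Linfty_classM; congr Linfty_class.
apply/val_inj/funext => x; rewrite (_ : val (_ * _) = fun x =>
  insubd (0 : bounded_fun mu Z) (\1_B : X -> Z) x *
  insubd (0 : bounded_fun mu Z) (\1_A : X -> Z) x)//.
rewrite !insubdK ?indic_bounded_measurable// !indicE.
have [xB|] := boolP (x \in B); last by rewrite mul0r.
by rewrite mem_set ?mulr1//; apply/BA/set_mem.
Qed.

Definition chi1 (A : set X) : crossed := cmono Linfty_action (chi A) 1%g.

(* <A>, the left ideal of the crossed product generated by (chi_A, 1). *)
Definition principal (A : set X) : set crossed :=
  [set z * chi1 A | z in [set: crossed]].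

Lemma principalS (A B : set X) : measurable A -> measurable B -> B `<=` A ->
  principal B `<=` principal A.
Proof.
move=> mA mB BA _ [z _ <-]; exists (z * chi1 B) => //.
rewrite -mulrA; congr (z * _).
by rewrite [LHS]cmul_mono ract1 mulg1 chiM.
Qed.

Lemma principal_submod A (a z w : crossed) :
  principal A z -> principal A w -> principal A (a * z + w).
Proof.
move=> [z' _ <-] [w' _ <-]; exists (a * z' + w') => //.
by rewrite mulrDl mulrA.
Qed.

Definition Linfty_norm1 (u : Linfty mu Z) : R :=
  \int[mu]_x coeff_norm R (Linfty_repr u x).

Definition crossed_norm1 (z : crossed) : R :=
  \sum_(g <- csupp z) Linfty_norm1 (z g).

(* The isomorphism of M with the direct sum of the <A_i> is given as an
   injective linear map into crossed^I whose image is
   { z | forall i, z_i in <A_i> }. *)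
Record marked_module := MarkedModule {
  mm_mod :> lmodType crossed;
  mm_idx : finType;
  mm_set : mm_idx -> set X;
  mm_measurable : forall i, measurable (mm_set i);
  mm_iso : {linear mm_mod -> {ffun mm_idx -> crossed^o}};
  mm_inj : injective mm_iso;
  mm_img : forall z : {ffun mm_idx -> crossed^o},
    (exists m, mm_iso m = z) <-> (forall i, principal (mm_set i) (z i))
}.

Definition mm_dim (M : marked_module) : R :=
  \sum_(i : mm_idx M) fine (mu (mm_set i)).

Definition mm_norm1 (M : marked_module) (m : M) : R :=
  \sum_i crossed_norm1 (mm_iso M m i).

(* The least admissible constant; this set has a minimum since f is bounded.
   Requiring 0 <= c only matters for M = 0. *)
Definition opnorm (M N : marked_module) (f : {linear M -> N}) : R :=
  inf [set c : R | 0 <= c /\ forall m, mm_norm1 (f m) <= c * mm_norm1 m].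

Record marked_summand (M : marked_module) := MarkedSummand {
  ms_set :> mm_idx M -> set X;
  ms_measurable : forall i, measurable (ms_set i);
  ms_sub : forall i, ms_set i `<=` mm_set i
}.

Section Summand.
Variables (M : marked_module) (B : marked_summand M).

Definition in_summand : {pred M} :=
  fun m => `[< forall i, principal (B i) (mm_iso M m i) >].

Lemma in_summand_submod_closed : submod_closed in_summand.
Proof.
split=> [|a m n]; rewrite !unfold_in.
  by apply/asboolP => i; exists 0; rewrite // linear0 ffunE mul0r.
move=> /asboolP hm /asboolP hn; apply/asboolP => i.
by rewrite linearP !ffunE; apply: principal_submod.
Qed.
HB.instance Definition _ := GRing.isSubmodClosed.Build crossed M in_summand
  in_summand_submod_closed.

Record summand_mod :=
  SummandMod { summand_val :> M; _ : summand_val \in in_summand }.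
HB.instance Definition _ := [isSub for summand_val].
HB.instance Definition _ := [Choice of summand_mod by <:].
HB.instance Definition _ := [SubChoice_isSubLmodule of summand_mod by <:].

Definition summand_iso : {linear summand_mod -> {ffun mm_idx M -> crossed^o}} :=
  mm_iso M \o (val : summand_mod -> M).

Lemma summand_inj : injective summand_iso.
Proof. by move=> m n /mm_inj /val_inj. Qed.

Lemma summand_img (z : {ffun mm_idx M -> crossed^o}) :
  (exists m, summand_iso m = z) <-> (forall i, principal (B i) (z i)).
Proof.
split=> [[m <-] i|h].
  by have := valP m; rewrite unfold_in => /asboolP; exact.
have [|m mz] := (mm_img z).2.
  by move=> i; apply: (principalS _ _ (@ms_sub _ B i)) (h i);
    [exact: mm_measurable|exact: ms_measurable].
have mB : m \in in_summand by rewrite unfold_in; apply/asboolP => i; rewrite mz.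
by exists (SummandMod mB).
Qed.

Definition summand_module : marked_module :=
  MarkedModule (fun i => @ms_measurable _ B i) summand_inj summand_img.

Definition restrict_summand (N : marked_module) (f : {linear M -> N}) :
  {linear summand_module -> N} := f \o (val : summand_mod -> M).
End Summand.

Definition rk (M N : marked_module) (f : {linear M -> N}) : R :=
  inf [set mm_dim (summand_module N') |
        N' in [set N' : marked_summand N | forall m, f m \in in_summand N']].

(* [ln 0 = 0] in the library, so log_plus 0 = 0. *)
Definition log_plus (t : R) : R := Num.max (ln t) 0.

Definition lognorm' (M N : marked_module) (f : {linear M -> N}) : R :=
  Num.min (mm_dim M * log_plus (opnorm f)) (rk f * log_plus (opnorm f)).

Definition marked_decomposition (M : marked_module) (p : nat)
    (M_ : 'I_p -> marked_summand M) : Prop :=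
  forall i : mm_idx M,
    \bigcup_k M_ k i = mm_set i /\ trivIset setT (fun k => M_ k i).

Definition lognorm (M N : marked_module) (f : {linear M -> N}) : R :=
  inf [set s | exists (p : nat) (M_ : 'I_p -> marked_summand M),
    marked_decomposition M_ /\ s = \sum_k lognorm' (restrict_summand (M_ k) f)].

Record augmented_complex := AugmentedComplex {
  ac_mod :> nat -> marked_module;
  ac_bd : forall k, {linear ac_mod k.+1 -> ac_mod k};
  ac_bdK : forall k x, ac_bd k (ac_bd k.+1 x) = 0;
  ac_aug : {linear ac_mod 0%N -> Linfty_module};
  ac_aug_surj : forall u, exists x, ac_aug x = u;
  ac_aug_bd : forall x, ac_aug (ac_bd 0%N x) = 0
}.

(* D belongs to A_n(alpha). Only f_0, ..., f_(n+1) are constrained; higher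
   components may be taken to be 0. *)
Definition embeddable (C : free_resolution Z G) (n : nat)
    (D : augmented_complex) : Prop :=
  exists f : forall k, {linear C k -> D k | group_ring_incl \; *:%R},
    (forall c, ac_aug D (f 0%N c) = Linfty_const (res_aug C c)) /\
    (forall k, (k <= n)%N -> forall c,
        ac_bd D k (f k.+1 c) = f k (res_bd C k c)).

(* The infimum is taken in \bar R, so that it is +oo if no embedding exists.
   The resolution C is a parameter. *)
Definition medim (C : free_resolution Z G) (n : nat) : \bar R :=
  ereal_inf [set x | exists D : augmented_complex,
    embeddable C n D /\ x = (mm_dim (D n))%:E].

End CrossedProductOfAction.

Definition mevol (R : realType) (G : groupType) d (X : measurableType d)
    (mu : probability X R) (alpha : pmp_action G mu)
    (C : free_resolution CoeffInt G) (n : nat) : \bar R :=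
  ereal_inf [set x | exists D : augmented_complex alpha CoeffInt,
    embeddable C n D /\ x = (lognorm (ac_bd D n))%:E].

Section Subgroup.
Variables (G : groupType) (S : pred G) (L : subGroupType S).

(* A subgroup of G is a type L with an injective morphism val : L -> G of
   image S. *)
Definition left_coset (g : G) : set G := [set (g * val l)%g | l in [set: L]].
Definition left_cosets : set (set G) := range left_coset.
Definition finite_index : Prop := finite_set left_cosets.
Definition subgroup_index : nat := #|` fset_set left_cosets|%fset.
Definition coset_reps : seq G := [seq xget 1%g C | C <- fset_set left_cosets].

Lemma left_cosetP g h :
  left_coset g = left_coset h <-> exists l : L, g = (h * val l)%g.
Proof.
split=> [gh|[l ->]].
  have : left_coset g g by exists 1%g => //; rewrite val1 mulg1.
  by rewrite gh => -[l _ <-]; exists l.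
apply/seteqP; split=> x [k _ <-].
  by exists (l * k)%g; rewrite // valM mulgA.
by exists (l^-1 * k)%g; rewrite // valM mulgA -(mulgA h) -valM mulgV val1 mulg1.
Qed.

Lemma left_coset_rep g : left_coset (xget 1%g (left_coset g)) = left_coset g.
Proof.
have [l _ <-] : left_coset g (xget 1%g (left_coset g)).
  by apply: xgetPex; exists g; exists 1%g; rewrite // val1 mulg1.
by apply/left_cosetP; exists l.
Qed.

Lemma mem_left_cosets (hfin : finite_index) g :
  left_coset g \in fset_set left_cosets.
Proof. by rewrite in_fset_set// inE; exists g. Qed.

Lemma subgroup_index_gt0 : finite_index -> (0 < subgroup_index)%N.
Proof.
move=> hfin; rewrite /subgroup_index cardfs_gt0; apply/fset0Pn.
by exists (left_coset 1%g); exact: mem_left_cosets.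
Qed.
End Subgroup.

Section Restriction.
Variables (R : realType) (G : groupType) (S : pred G) (L : subGroupType S).
Variables (d : measure_display) (X : measurableType d) (mu : probability X R).
Variable alpha : pmp_action G mu.

Lemma restrict_act1 x : alpha (val (1%g : L)) x = x.
Proof. by rewrite val1 pmp_act1. Qed.

Lemma restrict_actM (g h : L) x :
  alpha (val (g * h)%g) x = alpha (val g) (alpha (val h) x).
Proof. by rewrite valM pmp_actM. Qed.

Definition restrict_action : pmp_action L mu :=
  @PmpAction R L d X mu (fun l => alpha (val l)) restrict_act1 restrict_actM
    (fun l => pmp_measurable alpha (val l))
    (fun l => @pmp_preserving _ _ _ _ _ alpha (val l)).
End Restriction.
Arguments restrict_action {R G S} L {d X mu} alpha.

Section Induction.
Variables (R : realType) (G : groupType) (S : pred G) (L : subGroupType S).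
Variables (d : measure_display) (Y : measurableType d) (nu : probability Y R).
Variable beta : pmp_action L nu.

(* (g l, y) ~ (g, l y) *)
Definition ind_rel : rel (G * Y) := fun p q =>
  `[< exists l : L, p.1 = (q.1 * val l)%g /\ q.2 = beta l p.2 >].

Lemma ind_rel_refl : reflexive ind_rel.
Proof. by move=> p; apply/asboolP; exists 1%g; rewrite val1 mulg1 pmp_act1. Qed.

Lemma ind_rel_symW p q : ind_rel p q -> ind_rel q p.
Proof.
move=> /asboolP[l [pq1 pq2]]; apply/asboolP; exists l^-1%g.
rewrite pq1 pq2 -mulgA -valM mulgV val1 mulg1; split=> //.
by rewrite -pmp_actM mulVg pmp_act1.
Qed.

Lemma ind_rel_sym : symmetric ind_rel.
Proof. by move=> p q; apply/idP/idP; exact: ind_rel_symW. Qed.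

Lemma ind_rel_trans : transitive ind_rel.
Proof.
move=> q p t /asboolP[l [pq1 pq2]] /asboolP[k [qt1 qt2]]; apply/asboolP.
by exists (k * l)%g; rewrite valM mulgA -qt1 pmp_actM -pq2.
Qed.

Canonical ind_equiv := EquivRel ind_rel ind_rel_refl ind_rel_sym ind_rel_trans.

Definition ind_space : Type := {eq_quot ind_rel}%qT.
HB.instance Definition _ := Choice.on ind_space.
HB.instance Definition _ := EqQuotient.on ind_space.

Definition ind_class (g : G) (y : Y) : ind_space := (\pi_ind_space (g, y))%qT.

Lemma ind_classP g y h z :
  ind_class g y = ind_class h z <-> ind_rel (g, y) (h, z).
Proof. by split=> [/eqP|h']; [rewrite piE|apply/eqP; rewrite piE]. Qed.

Lemma ind_class_repr (q : ind_space) : ind_class (repr q).1 (repr q).2 = q.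
Proof. by rewrite /ind_class -surjective_pairing reprK. Qed.

Lemma ind_class_act g (l : L) y :
  ind_class (g * val l)%g y = ind_class g (beta l y).
Proof. by apply/ind_classP/asboolP; exists l. Qed.

HB.instance Definition _ := isPointed.Build ind_space (ind_class 1%g point).

(* The quotient sigma-algebra of the product G * Y with G discrete. *)
Definition ind_measurable : set (set ind_space) :=
  [set A | forall g, measurable (ind_class g @^-1` A)].

Lemma ind_measurable0 : ind_measurable set0.
Proof. by move=> g; rewrite preimage_set0. Qed.

Lemma ind_measurableC A : ind_measurable A -> ind_measurable (~` A).
Proof.
by move=> mA g; rewrite preimage_setC; apply: measurableC; exact: mA.
Qed.

Lemma ind_measurable_bigcup (F : (set ind_space)^nat) :
  (forall i, ind_measurable (F i)) -> ind_measurable (\bigcup_i F i).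
Proof.
move=> mF g; rewrite preimage_bigcup; apply: bigcup_measurable => i _.
exact: mF.
Qed.

HB.instance Definition _ := isMeasurable.Build d ind_space
  ind_measurable0 ind_measurableC ind_measurable_bigcup.

Lemma measurable_ind_class g : measurable_fun setT (ind_class g).
Proof. by move=> _ A mA; rewrite setTI; apply: mA. Qed.

(* The copy { [g, y] | y : Y } of Y attached to each left coset gL carries
   nu / [G : L]; see [ind_class_measure] for the independence of the
   representative g. *)
Definition ind_measure (A : set ind_space) : \bar R :=
  ((subgroup_index L)%:R^-1%:E *
    \sum_(g <- coset_reps L) nu (ind_class g @^-1` A))%E.


Lemma ind_measure_ex :
  exists m : {measure set ind_space -> \bar R}, ind_measure = m.
Proof.
have push g : {m : {measure set ind_space -> \bar R} |
    forall A, m A = nu (ind_class g @^-1` A)}.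
  unshelve eexists.
    by refine (pushforward nu (ind_class g) : {measure set _ -> \bar R});
      exact: measurable_ind_class.
  by [].
pose m k := sval (push (nth 1%g (coset_reps L) k)).
exists (mscale ((subgroup_index L)%:R^-1)%:nng (msum m (size (coset_reps L)))).
apply/funext => A; rewrite /ind_measure /= /mscale /msum /=.
congr (_ * _)%E; rewrite (big_nth 1%g) big_mkord; apply: eq_bigr => k _.
by rewrite /m; case: (push _).
Qed.

Lemma ind_measure0 : ind_measure set0 = 0%E.
Proof. by have [m ->] := ind_measure_ex; exact: measure0. Qed.

Lemma ind_measure_ge0 A : (0 <= ind_measure A)%E.
Proof. by have [m ->] := ind_measure_ex; exact: measure_ge0. Qed.

Lemma ind_measure_sigma_additive : semi_sigma_additive ind_measure.
Proof.
by have [m ->] := ind_measure_ex; exact: measure_semi_sigma_additive.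
Qed.

HB.instance Definition _ := isMeasure.Build d ind_space R ind_measure
  ind_measure0 ind_measure_ge0 ind_measure_sigma_additive.

Lemma ind_measureT : finite_index L -> ind_measure setT = 1%E.
Proof.
move=> hfin; rewrite /ind_measure (eq_bigr (fun=> 1%:E)); last first.
  by move=> g _; rewrite preimage_setT probability_setT.
rewrite sumEFin big_const_seq count_predT iter_addr addr0 size_map -EFinM.
by rewrite mulVf// pnatr_eq0 -lt0n subgroup_index_gt0.
Qed.

Definition ind_probability (hfin : finite_index L) : probability ind_space R :=
  HB.pack_for (probability ind_space R) ind_measure
    (Measure_isProbability.Build _ _ _ ind_measure (ind_measureT hfin)).

Definition ind_act (g : G) (q : ind_space) : ind_space :=
  ind_class (g * (repr q).1)%g (repr q).2.

Lemma ind_act_class g h y : ind_act g (ind_class h y) = ind_class (g * h)%g y.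
Proof.
rewrite /ind_act.
have := ind_class_repr (ind_class h y); move: (repr _) => [k z] /=.
move=> /ind_classP/asboolP[l /= [-> ->]].
by rewrite mulgA ind_class_act.
Qed.

Lemma ind_act1 q : ind_act 1%g q = q.
Proof. by rewrite -(ind_class_repr q) ind_act_class mul1g. Qed.

Lemma ind_actM g h q : ind_act (g * h)%g q = ind_act g (ind_act h q).
Proof. by rewrite -(ind_class_repr q) !ind_act_class mulgA. Qed.

Lemma ind_act_preimage g h A :
  ind_class h @^-1` (ind_act g @^-1` A) = ind_class (g * h)%g @^-1` A.
Proof. by apply/seteqP; split=> y /=; rewrite ind_act_class. Qed.

Lemma ind_act_measurable g : measurable_fun setT (ind_act g).
Proof.
move=> _ A mA; rewrite setTI; suff : ind_measurable (ind_act g @^-1` A) by [].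
by move=> h; rewrite ind_act_preimage; exact: mA.
Qed.

Lemma ind_class_measure g l A : measurable A ->
  nu (ind_class (g * val (l : L))%g @^-1` A) = nu (ind_class g @^-1` A).
Proof.
move=> mA; rewrite -(pmp_preserving beta l (mA g)); congr (nu _).
by apply/seteqP; split=> y /=; rewrite ind_class_act.
Qed.

Lemma ind_act_preserving (hfin : finite_index L) g A : measurable A ->
  ind_measure (ind_act g @^-1` A) = ind_measure A.
Proof.
move=> mA; rewrite /ind_measure; congr (_ * _)%E.
pose F h := nu (ind_class h @^-1` A).
have FE h k : left_coset L h = left_coset L k -> F h = F k.
  by move=> /left_cosetP[l ->]; apply: ind_class_measure.
pose shift h (C : set G) := left_coset L (h * xget 1%g C)%g.
have shiftE h k : shift h (left_coset L k) = left_coset L (h * k)%g.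
  have [l E] := (left_cosetP _ _ _).1 (left_coset_rep L k).
  by apply/left_cosetP; exists l; rewrite -mulgA -E.
have shiftK h : {in fset_set (left_cosets L), cancel (shift h) (shift h^-1%g)}.
  by move=> C; rewrite in_fset_set// inE => -[k _ <-]; rewrite !shiftE mulKg.
have shift_mem h C : shift h C \in fset_set (left_cosets L).
  exact: mem_left_cosets.
transitivity (\sum_(C <- fset_set (left_cosets L)) F (xget 1%g (shift g C)))%E.
  rewrite big_map big_seq [RHS]big_seq; apply: eq_bigr => C.
  rewrite in_fset_set// inE => -[k _ <-].
  by rewrite ind_act_preimage; apply: FE; rewrite [RHS]left_coset_rep.
rewrite [RHS]big_map -(big_map (shift g) xpredT (fun C => F (xget 1%g C))).
apply: perm_big; apply: uniq_perm; rewrite ?fset_uniq//.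
  rewrite map_inj_in_uniq ?fset_uniq// => C D Cm Dm CD.
  by rewrite -(shiftK g C Cm) CD (shiftK g D Dm).
move=> C; apply/mapP/idP => [[D Dm ->]|Cm]; first exact: shift_mem.
exists (shift g^-1%g C); first exact: shift_mem.
by have := shiftK g^-1%g C Cm; rewrite invgK.
Qed.

Definition ind_action (hfin : finite_index L) :
    pmp_action G (ind_probability hfin) :=
  @PmpAction R G d ind_space (ind_probability hfin) ind_act ind_act1 ind_actM
    ind_act_measurable (ind_act_preserving hfin).

End Induction.

(* Main.v *)
(* Both parts rest on the same device. Let Y be an L-invariant subspace of the
   G-space X, with indicator e. Restriction and extension by 0 embed
   L^oo(Y) * L as a non-unital subring of R = L^oo(X) * G with unit e, so an
   R-complex D yields the (L^oo(Y) * L)-complex e D. For representatives h of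
   the left cosets of L, e <A> is the direct sum of the modules <h^-1 A n Y>,
   with the 1-norm rescaled by a constant, so that operator norms do not increase
   while dimensions and ranks are controlled by the factor [G : L]. Taking Y = X
   gives (i), and taking for Y its copy in G x_L Y gives one inequality in (ii).

   For the converse, D is replaced by the coinduced complex of all F : G -> D
   with F (g l) = l^-1 F g, which carries <A> to <A> and divides dimensions by
   [G : L]. Chain maps are transported along comparison maps between the free
   resolution of L and the restriction of the free resolution of G; a chain map
   f from the latter to D extends to c |-> (g |-> f (g^-1 c)). *)
Require Import Defs.
From HB Require Import structures.
From mathcomp Require Import all_boot all_order all_algebra finmap.
From mathcomp Require Import all_classical all_reals all_analysis.
From mathcomp Require Import measurable_realfun.
Import Order.TTheory GRing.Theory Num.Theory.

Set Implicit Arguments.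
Unset Strict Implicit.
Unset Printing Implicit Defensive.

Local Open Scope classical_set_scope.
Local Open Scope ring_scope.

(** When the translates of Y partition X, the idempotent e is full and e R e is L^oo(Y) * L. The
    coinduced complex is then a concrete form of the Morita inverse of D |-> e D, that is of
    tensoring with R e over e R e; functions on G avoid the tensor product. For Y = X and L a proper
    subgroup, e R e = R is larger than L^oo(X) * L and no such inverse is at hand, so (i) stays an
    inequality. The logarithmic norm is not homogeneous in the operator norm, so operator norms have
    to be compared with constant exactly 1. This works because the 1-norm is rescaled by the same
    factor in source and target, so that an admissible constant for a map remains admissible for the
    transported map. The factor that dimension and rank have in common then comes out of the minimum
    in [lognorm']. [opnorm], [rk] and [lognorm] are real infima, and the real [inf] of an empty set
    is 0. Comparing two of them thus requires a competitor to exist, and for [opnorm] this is the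
    boundedness of all homomorphisms of marked modules. *)

Section CrossedProductCoefficients.
Variables (G : groupType) (A : comNzRingType) (r : ring_action G A).
Implicit Types (w : cprod r) (a : A) (x y : G).

Lemma cmono_coef a x y : cmono r a x y = if y == x then a else 0.
Proof. by []. Qed.

Lemma cmonoM a x b y :
  cmono r a x * cmono r b y = cmono r (a * r x b) (x * y)%g.
Proof. exact: cmul_mono. Qed.

Lemma cprod1E : 1 = cmono r 1 1%g. Proof. by []. Qed.

Lemma cmono_mulE a x w y : (cmono r a x * w) y = a * r x (w (x^-1 * y)%g).
Proof.
elim/cprod_ind: w => [|f g IHf IHg|b z].
- by rewrite mulr0 !cprod0 rmorph0 mulr0.
- by rewrite mulrDr !cprodD IHf IHg rmorphD mulrDr.
rewrite cmonoM !cmono_coef.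
rewrite -(inj_eq (mulgI x^-1%g)) mulgA mulVg mul1g.
by case: ifP => _ //; rewrite rmorph0 mulr0.
Qed.

Lemma mul_cmonoE w a x y :
  (w * cmono r a x) y = w (y * x^-1)%g * r (y * x^-1)%g a.
Proof.
elim/cprod_ind: w => [|f g IHf IHg|b z].
- by rewrite mul0r !cprod0 mul0r.
- by rewrite mulrDl !cprodD IHf IHg mulrDl.
rewrite cmonoM !cmono_coef -[y == _](inj_eq (mulIg x^-1%g)) -mulgA mulgV mulg1.
by case: ifP => [/eqP ->|_]; rewrite ?mul0r.
Qed.

Lemma ractVK x : cancel (r x) (r x^-1%g).
Proof. by move=> a; rewrite -ractM mulVg ract1. Qed.

Lemma ractKV x : cancel (r x^-1%g) (r x).
Proof. by move=> a; rewrite -ractM mulgV ract1. Qed.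

Lemma cprod_neg0_finite w : finite_set [set x | w x != 0].
Proof. by have := valP w; rewrite unfold_in => /asboolP. Qed.

Lemma csupp_notin w x : x \notin csupp w -> w x = 0.
Proof. by rewrite in_csupp negbK => /eqP. Qed.

Lemma csuppU_notin w (v : cprod r) x : x \notin (csupp w `|` csupp v)%fset ->
  w x = 0 /\ v x = 0.
Proof. by rewrite inE negb_or => /andP[/csupp_notin ? /csupp_notin]. Qed.

End CrossedProductCoefficients.

(** * Finite sums and left cosets *)

Section FiniteSums.
Variables (T : choiceType) (V : nmodType).

(** Without their zero terms both lists are permutations of each other. This frees sums from the
    list by which a support is enumerated. *)
Lemma eq_sum_support (F : T -> V) (s t : seq T) : uniq s -> uniq t ->
  (forall x, x \notin s -> F x = 0) -> (forall x, x \notin t -> F x = 0) ->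
  \sum_(x <- s) F x = \sum_(x <- t) F x.
Proof.
move=> us ut s0 t0.
have E u : \sum_(x <- u) F x = \sum_(x <- u | F x != 0) F x.
  rewrite [RHS]big_mkcond; apply: eq_bigr => x _.
  by case: eqP.
rewrite E [RHS]E -!(big_filter _ (fun x => F x != 0)).
apply: perm_big; apply: uniq_perm; rewrite ?filter_uniq// => x.
rewrite !mem_filter; have [//|Fx/=] := eqVneq (F x) 0.
have -> : x \in s by apply: contraNT Fx => /s0/eqP.
by symmetry; apply: contraNT Fx => /t0/eqP.
Qed.
End FiniteSums.

Section Cosets.
Variables (G : groupType) (S : pred G) (L : subGroupType S).

Lemma valVg (l : L) : val (l^-1)%g = (val l)^-1%g.
Proof. by apply: (mulgI (val l)); rewrite -valM !mulgV val1. Qed.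

Hypothesis hfin : finite_index L.

(** The same choice by [xget] as in [coset_reps], so that the values are the members of that
    list. *)
Definition coset_rep (g : G) : G := xget 1%g (left_coset L g).

Lemma coset_repP g : exists l : L, g = (coset_rep g * val l)%g.
Proof. by apply/left_cosetP; rewrite left_coset_rep. Qed.

Definition coset_part (g : G) : L := sval (cid (coset_repP g)).

Lemma coset_decomp g : g = (coset_rep g * val (coset_part g))%g.
Proof. by rewrite /coset_part; case: cid. Qed.

Lemma coset_repM g (l : L) : coset_rep (g * val l)%g = coset_rep g.
Proof.
by rewrite /coset_rep; congr xget; apply/left_cosetP; exists l.
Qed.

Lemma coset_rep_mem g : coset_rep g \in coset_reps L.
Proof. by apply/mapP; exists (left_coset L g) => //; exact: mem_left_cosets. Qed.

Lemma coset_reps_id h : h \in coset_reps L -> coset_rep h = h.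
Proof.
case/mapP => C; rewrite in_fset_set// inE => -[g _ <-] ->.
by rewrite /coset_rep left_coset_rep.
Qed.

Lemma coset_reps_uniq : uniq (coset_reps L).
Proof.
rewrite map_inj_in_uniq ?fset_uniq// => C D.
rewrite !in_fset_set// !inE => -[g _ <-] [h _ <-] E.
by rewrite -left_coset_rep E left_coset_rep.
Qed.

Lemma size_coset_reps : size (coset_reps L) = subgroup_index L.
Proof. by rewrite size_map. Qed.

Lemma coset_decomp_inj h k (l m : L) : h \in coset_reps L ->
  k \in coset_reps L -> (h * val l = k * val m)%g -> h = k /\ l = m.
Proof.
move=> hr kr E.
have hk : h = k.
  by rewrite -(coset_reps_id hr) -(coset_reps_id kr) -(coset_repM h l) E
    coset_repM.
by split=> //; move: E; rewrite hk => /mulgI/val_inj.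
Qed.

Lemma coset_partM g (l : L) : coset_part (g * val l)%g = (coset_part g * l)%g.
Proof.
apply: (fun e => (coset_decomp_inj (coset_rep_mem g) (coset_rep_mem g) e).2).
by rewrite -{1}(coset_repM g l) -coset_decomp valM mulgA -coset_decomp.
Qed.

End Cosets.

Section Sums.
Variables (G : groupType) (S : pred G) (L : subGroupType S) (V : nmodType).
Hypothesis hfin : finite_index L.
(** By uniqueness of x = h l the sum is regrouped along the cosets h L. The list [t h] may be
    anything that contains the support on its coset; in the applications it is the support of an
    element of the smaller crossed product. *)
Lemma sum_cosets (F : G -> V) (s : seq G) (t : G -> seq L) :
  uniq s -> (forall x, x \notin s -> F x = 0) -> (forall h, uniq (t h)) ->
  (forall h l, h \in coset_reps L -> l \notin t h -> F (h * val l)%g = 0) ->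
  \sum_(x <- s) F x =
  \sum_(h <- coset_reps L) \sum_(l <- t h) F (h * val l)%g.
Proof.
move=> us Fs ut t0; rewrite -(big_allpairs_dep (h := fun h l => h * val l)%g).
apply: eq_sum_support => //.
  apply: allpairs_uniq_dep => //; first exact: coset_reps_uniq.
  move=> [h l] [k m] /allpairsPdep[h' [l' [h'r _ [-> ->]]]].
  move=> /allpairsPdep[k' [m' [k'r _ [-> ->]]]] /= E.
  by have [-> ->] := coset_decomp_inj hfin h'r k'r E.
move=> x xn; rewrite (coset_decomp L x); apply: t0; first exact: coset_rep_mem.
apply: contra xn => xt; apply/allpairsPdep.
exists (coset_rep L x), (coset_part L x); split=> //; first exact: coset_rep_mem.
exact: coset_decomp.
Qed.

(** Inversion turns left cosets into the right cosets L h^-1, along which left multiplication by L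
    acts. *)
Lemma sum_cosetsV (F : G -> V) (s : seq G) (t : G -> seq L) :
  uniq s -> (forall x, x \notin s -> F x = 0) -> (forall h, uniq (t h)) ->
  (forall h l, h \in coset_reps L -> l \notin t h -> F (val l * h^-1)%g = 0) ->
  \sum_(x <- s) F x =
  \sum_(h <- coset_reps L) \sum_(l <- t h) F (val l * h^-1)%g.
Proof.
move=> us Fs ut t0.
transitivity (\sum_(x <- [seq y^-1%g | y <- s]) F x^-1%g).
  by rewrite big_map; apply: eq_bigr => x _; rewrite invgK.
rewrite (@sum_cosets (fun x => F x^-1%g) _
  (fun h => [seq l^-1%g | l <- t h])).
- apply: eq_bigr => h _; rewrite big_map; apply: eq_bigr => l _.
  by rewrite valVg invgM invgK.
- by rewrite map_inj_uniq//; exact: invg_inj.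
- move=> x xn; apply: Fs; apply: contra xn => xs; apply/mapP; exists x^-1%g => //.
  by rewrite invgK.
- by move=> h; rewrite map_inj_uniq//; exact: invg_inj.
move=> h l hr ln; rewrite invgM -valVg; apply: t0 => //.
by apply: contra ln => lt; apply/mapP; exists l^-1%g; rewrite ?invgK.
Qed.
End Sums.

(** * Compressions and corner modules *)

(* The model is an L-invariant subspace Y of a G-space X, with A and B the
   functions on X and Y: [cres] restricts a function to Y and [cext] extends it
   by 0. The case Y = X is allowed. *)
Record compression (G : groupType) (S : pred G) (L : subGroupType S)
    (A B : comNzRingType) (r : ring_action G A) (s : ring_action L B) :=
  Compression {
  cres : {rmorphism A -> B};
  cext : {additive B -> A};
  cextK : forall b, cres (cext b) = b;
  cext_resM : forall a b, cext (cres a * b) = a * cext b;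
  cres_act : forall (l : L) a, cres (r (val l) a) = s l (cres a);
  cext_act : forall (l : L) b, cext (s l b) = r (val l) (cext b)
}.

Section Compression.
Variables (G : groupType) (S : pred G) (L : subGroupType S).
Variables (A B : comNzRingType) (r : ring_action G A) (s : ring_action L B).
Variable c : compression r s.

Lemma cextM b b' : cext c (b * b') = cext c b * cext c b'.
Proof. by rewrite -cext_resM cextK. Qed.

Lemma cext_res a : cext c (cres c a) = a * cext c 1.
Proof. by rewrite -cext_resM mulr1. Qed.

Let cemb_term_add : forall l : L,
  {morph (fun b => cmono r (cext c b) (val l)) : b b' / b + b'}.
Proof. by move=> l b b'; rewrite raddfD cmonoD. Qed.

(* The embedding B * L -> A * G, multiplicative but unital only if cext 1 = 1. *)
Definition cemb (f : cprod s) : cprod r :=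
  cprod_sum (fun (l : L) b => cmono r (cext c b) (val l)) f.

Lemma cembD : {morph cemb : f g / f + g}.
Proof. by move=> f g; rewrite /cemb cprod_sumD. Qed.

Lemma cemb_mono b l : cemb (cmono s b l) = cmono r (cext c b) (val l).
Proof. by rewrite /cemb cprod_sum_mono. Qed.

Lemma cemb0 : cemb 0 = 0.
Proof. by apply: (addrI (cemb 0)); rewrite -cembD !addr0. Qed.

Lemma cembM : {morph cemb : f g / f * g}.
Proof.
move=> f g; elim/cprod_ind: f => [|f f' IH IH'|a x].
- by rewrite !(mul0r, cemb0).
- by rewrite mulrDl !cembD mulrDl IH IH'.
elim/cprod_ind: g => [|g g' IH IH'|b y].
- by rewrite !(mulr0, cemb0).
- by rewrite mulrDr !cembD mulrDr IH IH'.
by rewrite cmonoM !cemb_mono cmonoM cextM cext_act valM.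
Qed.

Lemma cemb1 : cemb 1 = cmono r (cext c 1) 1%g.
Proof. by rewrite cprod1E cemb_mono val1. Qed.

Lemma cemb_coef f (l : L) : cemb f (val l) = cext c (f l).
Proof.
elim/cprod_ind: f => [|f g IH IH'|b x].
- by rewrite cemb0 !cprod0 raddf0.
- by rewrite cembD !cprodD IH IH' raddfD.
rewrite cemb_mono !cmono_coef (inj_eq val_inj).
by case: ifP => _ //; rewrite raddf0.
Qed.

Lemma cemb1_mulE w x : (cemb 1 * w) x = cext c 1 * w x.
Proof. by rewrite cemb1 cmono_mulE invg1 mul1g ract1. Qed.

Section Corner.
Variable M : lmodType (cprod r).

(** The corner e M for e = [cemb 1]: the image of an idempotent is its set of fixed points. *)
Definition corner_pred : {pred M} := fun m => cemb 1 *: m == m.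

Lemma corner_zmod_closed : zmod_closed corner_pred.
Proof.
split=> [|m n]; rewrite !unfold_in ?scaler0//.
by move=> /eqP hm /eqP hn; rewrite scalerBr hm hn.
Qed.
HB.instance Definition _ :=
  GRing.isZmodClosed.Build M corner_pred corner_zmod_closed.

Record corner := Corner { corner_val : M; _ : corner_val \in corner_pred }.
HB.instance Definition _ := [isSub for corner_val].
HB.instance Definition _ := [Choice of corner by <:].
HB.instance Definition _ := [SubChoice_isSubZmodule of corner by <:].

Lemma cornerP (m : corner) : cemb 1 *: corner_val m = corner_val m.
Proof. by apply/eqP; have := valP m; rewrite unfold_in. Qed.

Lemma corner_scale_subproof f (m : M) : cemb f *: m \in corner_pred.
Proof. by rewrite unfold_in scalerA -cembM mul1r. Qed.

Definition corner_scale f (m : corner) : corner :=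
  Corner (corner_scale_subproof f (corner_val m)).

Let corner_scaleA f g m :
  corner_scale f (corner_scale g m) = corner_scale (f * g) m.
Proof. by apply: val_inj; rewrite /= scalerA cembM. Qed.

Let corner_scale1 : left_id 1 corner_scale.
Proof. by move=> m; apply: val_inj; rewrite /= cornerP. Qed.

Let corner_scaleDr : right_distributive corner_scale +%R.
Proof. by move=> f m n; apply: val_inj; rewrite /= scalerDr. Qed.

Let corner_scaleDl m : {morph corner_scale^~ m : f g / f + g}.
Proof. by move=> f g; apply: val_inj; rewrite /= cembD scalerDl. Qed.

HB.instance Definition _ := GRing.Zmodule_isLmodule.Build (cprod s) corner
  corner_scaleA corner_scale1 corner_scaleDr corner_scaleDl.

Definition corner_proj (m : M) : corner := Corner (corner_scale_subproof 1 m).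

End Corner.

Section CornerMap.
Variables (M N : lmodType (cprod r)) (f : {linear M -> N}).

Lemma corner_map_subproof (m : corner M) : f (corner_val m) \in @corner_pred N.
Proof. by rewrite unfold_in -linearZ /= cornerP. Qed.

Definition corner_map (m : corner M) : corner N := Corner (corner_map_subproof m).

Lemma corner_map_linear : linear corner_map.
Proof.
by move=> a m n; apply: val_inj; rewrite /= linearD linearZ.
Qed.
HB.instance Definition _ := GRing.isLinear.Build _ _ _ _ corner_map
  corner_map_linear.
End CornerMap.

Section Slice.
Variable h : G.

Lemma slice_subproof (w : cprod r) :
  (fun l : L => cres c (w (val l * h^-1)%g)) \in @Defs.finite_support L B.
Proof.
rewrite unfold_in; apply/asboolP.
apply: (@sub_finite_set _ _ ((fun l : L => val l * h^-1)%g @^-1`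
    [set x | w x != 0])).
  by move=> l /=; apply: contra => /eqP ->; rewrite rmorph0.
apply: finite_preimage (cprod_neg0_finite w).
by move=> l m _ _ /mulIg/val_inj.
Qed.

(** The part of w on the right coset L h^-1, restricted to Y. It is the coordinate of e w at e (1,
    h^-1), see [slice_decomp]. *)
Definition slice (w : cprod r) : cprod s := Cprod s (slice_subproof w).

Lemma sliceE w l : slice w l = cres c (w (val l * h^-1)%g).
Proof. by []. Qed.

Lemma slice_add : {morph slice : w v / w + v}.
Proof. by move=> w v; apply: cprodP => l; rewrite cprodD !sliceE cprodD rmorphD. Qed.

(** Left multiplication by elements supported on L preserves each right coset L h^-1. *)
Lemma slice_cemb f w : slice (cemb f * w) = f * slice w.
Proof.
elim/cprod_ind: f => [|f g IH IH'|b x].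
- by rewrite cemb0 !mul0r; apply: cprodP => l; rewrite sliceE !cprod0 rmorph0.
- by rewrite cembD !mulrDl slice_add IH IH'.
apply: cprodP => l; rewrite cemb_mono cmono_mulE sliceE cmono_mulE.
by rewrite rmorphM cextK cres_act sliceE valM valVg mulgA.
Qed.

(** The origin of the sets h^-1 A n Y: for a = chi_A, the factor on the right is the restriction to
    Y of the indicator of h^-1 A. *)
Lemma slice_mulr w a :
  slice (w * cmono r a 1%g) =
    slice w * cmono s (cres c (r h^-1%g a)) 1%g.
Proof.
apply: cprodP => l.
by rewrite mul_cmonoE sliceE mul_cmonoE !invg1 !mulg1 rmorphM ractM cres_act.
Qed.
End Slice.

Lemma slice_cembV h k f : h \in coset_reps L -> k \in coset_reps L ->
  finite_index L ->
  slice k (cemb f * cmono r 1 h^-1%g) = if k == h then f else 0.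
Proof.
move=> hr kr hfin; apply: cprodP => l.
rewrite sliceE mul_cmonoE rmorph1 mulr1 invgK.
have [->|kh] := eqVneq k h.
  by rewrite -mulgA mulVg mulg1 cemb_coef cextK.
rewrite cprod0; elim/cprod_ind: f => [|f g IH IH'|b x].
- by rewrite cemb0 cprod0 rmorph0.
- by rewrite cembD cprodD rmorphD IH IH' addr0.
rewrite cemb_mono cmono_coef; case: eqP => [E|_]; last by rewrite rmorph0.
case/eqP: kh;
  apply: (fun e =>
    (@coset_decomp_inj _ _ _ hfin k h l^-1%g x^-1%g kr hr e).1).
by rewrite !valVg -E !invgM invgK mulgA mulgV mul1g.
Qed.

(** The right cosets L h^-1 cover G, and a coefficient of an element of e R vanishes off Y, so that
    its restriction to Y determines it. *)
Lemma slice_inj w v : finite_index L -> cemb 1 * w = w -> cemb 1 * v = v ->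
  (forall h, h \in coset_reps L -> slice h w = slice h v) -> w = v.
Proof.
move=> hfin hw hv E; apply: cprodP => x; rewrite -hw -hv !cemb1_mulE.
(* Writing x^-1 = h l gives x = l^-1 h^-1, so x is seen by the slice of h at l^-1. *)
have := congr1 (fun f : cprod s => f (coset_part L x^-1)^-1%g)
  (E _ (coset_rep_mem hfin x^-1%g)).
rewrite !sliceE valVg -invgM -coset_decomp invgK => /(congr1 (cext c)).
by rewrite !cext_res ![_ * cext c 1]mulrC.
Qed.

Lemma cemb1_absorb f w : cemb 1 * (cemb f * w) = cemb f * w.
Proof. by rewrite mulrA -cembM mul1r. Qed.

(** The elements e (1, h^-1) form a basis of e R over the smaller crossed product, with coordinate
    maps [slice h]; by [slice_inj] it suffices to compare slices. *)
Lemma slice_decomp w : finite_index L -> cemb 1 * w = w ->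
  w = \sum_(h <- coset_reps L) cemb (slice h w) * cmono r 1 h^-1%g.
Proof.
move=> hfin hw; apply: slice_inj => //.
  by rewrite mulr_sumr; apply: eq_bigr => h _; exact: cemb1_absorb.
move=> k kr.
have slice0 : slice k 0 = 0.
  by apply: (addrI (slice k 0)); rewrite -slice_add !addr0.
rewrite (big_morph (slice k) (@slice_add k) slice0) big_seq.
under eq_bigr => h hr do rewrite slice_cembV//.
rewrite -big_seq (bigD1_seq k)//= ?coset_reps_uniq// eqxx big1 ?addr0// => h.
by rewrite eq_sym => /negPf ->.
Qed.

End Compression.
Arguments corner_map {G S L A B r s} c {M N} f m.

(** * Comparison of resolutions *)

Section FreeModules.
Variables (R : nzRingType) (M : lmodType R) (B : choiceType).
Variables (b : B -> M) (co : M -> {fsfun B -> R with 0}).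
Hypothesis coE : forall m, m = \sum_(i <- finsupp (co m)) co m i *: b i.
Hypothesis co_lin : forall a m n i, co (a *: m + n) i = a * co m i + co n i.

Lemma coord_add m n i : co (m + n) i = co m i + co n i.
Proof. by rewrite -{1}[m]scale1r co_lin mul1r. Qed.

Lemma coord0 i : co 0 i = 0.
Proof. by apply: (addrI (co 0 i)); rewrite -coord_add !addr0. Qed.

Lemma coord_scale a m i : co (a *: m) i = a * co m i.
Proof. by rewrite -[a *: m]addr0 co_lin coord0 addr0. Qed.

Variables (P : zmodType) (T : B -> R -> P).
Hypothesis T_add : forall i, {morph T i : x y / x + y}.

(** An additive map [T i] of the i-th coefficient takes the place of an image of [b i], since in
    [free_corner_lifting] the target is a module over the smaller ring only. *)
Definition free_ext m : P := \sum_(i <- finsupp (co m)) T i (co m i).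

Let T0 i : T i 0 = 0.
Proof. by apply: (addrI (T i 0)); rewrite -T_add !addr0. Qed.

Lemma free_ext_widen m (s : seq B) : uniq s ->
  (forall i, i \notin s -> co m i = 0) ->
  free_ext m = \sum_(i <- s) T i (co m i).
Proof.
move=> us s0; apply: eq_sum_support => //.
  by move=> i; rewrite mem_finsupp negbK => /eqP ->; exact: T0.
by move=> i /s0 ->; exact: T0.
Qed.

Lemma free_ext_add : {morph free_ext : m n / m + n}.
Proof.
move=> m n; pose s := (finsupp (co m) `|` finsupp (co n))%fset.
have sm i : i \notin s -> co m i = 0.
  by rewrite inE negb_or !mem_finsupp !negbK => /andP[/eqP].
have sn i : i \notin s -> co n i = 0.
  by rewrite inE negb_or !mem_finsupp !negbK => /andP[_ /eqP].
rewrite !(@free_ext_widen _ s) ?fset_uniq//; last first.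
  by move=> i si; rewrite coord_add sm// sn// addr0.
by rewrite -big_split; apply: eq_bigr => i _; rewrite coord_add T_add.
Qed.

(** [sigma] stands for the action of a on P, which may come from another ring. *)
Lemma free_ext_scale a (sigma : P -> P) : nmod_morphism sigma ->
  (forall i x, T i (a * x) = sigma (T i x)) ->
  forall m, free_ext (a *: m) = sigma (free_ext m).
Proof.
move=> [sigma0 sigmaD] Ta m.
rewrite (@free_ext_widen _ (finsupp (co m))) ?fset_uniq//; last first.
  by move=> i; rewrite mem_finsupp negbK coord_scale => /eqP ->; rewrite mulr0.
rewrite /free_ext (big_morph sigma sigmaD sigma0).
by apply: eq_bigr => i _; rewrite coord_scale Ta.
Qed.
End FreeModules.

(** Linearity of the coordinates comes from their uniqueness: a * co m + co n also represents a m +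
    n. *)
Lemma free_coordinates (R : nzRingType) (M : lmodType R) : free_module M ->
  exists (B : choiceType) (b : B -> M) (co : M -> {fsfun B -> R with 0}),
    (forall m, m = \sum_(i <- finsupp (co m)) co m i *: b i) /\
    (forall a m n i, co (a *: m + n) i = a * co m i + co n i).
Proof.
move=> [B [b hb]]; exists B, b.
have /choice[co coP] : forall m, exists c : {fsfun B -> R with 0},
    m = \sum_(i <- finsupp c) c i *: b i /\
    forall c', m = \sum_(i <- finsupp c') c' i *: b i -> c = c'.
  by move=> m; have [c [h1 h2]] := hb m; exists c.
exists co; split=> [m|a m n i]; first by case: (coP m).
pose s := (finsupp (co m) `|` finsupp (co n))%fset.
pose c : {fsfun B -> R with 0} := [fsfun j in s => a * co m j + co n j].
have sE j : j \notin s -> co m j = 0 /\ co n j = 0.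
  by rewrite inE negb_or !mem_finsupp !negbK => /andP[/eqP ? /eqP ?].
have cE j : c j = a * co m j + co n j.
  rewrite fsfunE; case: ifP => // /negbT/sE[-> ->].
  by rewrite mulr0 addr0.
rewrite -cE; congr (fun_of_fsfun _ i); apply: (coP _).2.
have widen (c' : {fsfun B -> R with 0}) : (forall j, j \notin s -> c' j = 0) ->
    \sum_(j <- finsupp c') c' j *: b j = \sum_(j <- s) c' j *: b j.
  move=> h; apply: eq_sum_support => //; rewrite ?fset_uniq//.
    by move=> j; rewrite mem_finsupp negbK => /eqP ->; rewrite scale0r.
  by move=> j /h ->; rewrite scale0r.
rewrite widen; last by move=> j /sE[cm cn]; rewrite cE cm cn mulr0 addr0.
rewrite {1}(coP m).1 {1}(coP n).1 !widen; [|by move=> j /sE[]|by move=> j /sE[]].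
rewrite scaler_sumr -big_split; apply: eq_bigr => j _.
by rewrite cE scalerDl scalerA.
Qed.

(** Projectivity with d onto the image of phi only, the form in which exactness supplies lifts along
    boundary maps. *)
Definition lifting_property (R : nzRingType) (C : lmodType R) :=
  forall (P Q : lmodType R) (d : {linear P -> Q}) (phi : {linear C -> Q}),
    (forall x, exists y, d y = phi x) ->
    exists g : {linear C -> P}, forall x, d (g x) = phi x.

Lemma free_lifting (R : nzRingType) (C : lmodType R) :
  free_module C -> lifting_property C.
Proof.
move=> /free_coordinates[B [b [co [coE coL]]]] P Q d phi h.
have /choice[p pE] i : exists y, d y = phi (b i) := h (b i).
pose T i (x : R) := x *: p i.
have TD i : {morph T i : x y / x + y} by move=> x y; rewrite /T scalerDl.
have gL : linear (free_ext co T).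
  move=> a m n; rewrite (free_ext_add coL TD); congr (_ + _).
  apply: (free_ext_scale coL TD (sigma := fun x => a *: x)).
    by split=> [|x y]; rewrite ?scaler0 ?scalerDr.
  by move=> i x; rewrite /T scalerA.
exists (HB.pack_for {linear C -> P} (free_ext co T)
  (GRing.isLinear.Build _ _ _ _ _ gL)).
move=> x /=; rewrite /free_ext linear_sum [in RHS](coE x) linear_sum.
by apply: eq_bigr => i _; rewrite /T !linearZ pE.
Qed.

(** Here e = 1 and the corner is C with restricted scalars. It is spanned by the (1, h^-1) b_i, with
    coordinates the slices of the coordinates of C, and the lift is defined through these. *)
Lemma free_corner_lifting (G : groupType) (S : pred G) (L : subGroupType S)
    (A B : comNzRingType) (r : ring_action G A) (s : ring_action L B)
    (c : compression r s) (C : lmodType (cprod r)) :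
  finite_index L -> cext c 1 = 1 -> free_module C ->
  lifting_property (corner c C).
Proof.
move=> hfin c1 /free_coordinates[I [b [co [coE coL]]]] P Q d phi h.
have e1 (x : cprod r) : cemb c 1 * x = x by rewrite cemb1 c1 -cprod1E mul1r.
pose u (ih : I * G) : corner c C := corner_proj c (cmono r 1 ih.2^-1%g *: b ih.1).
have /choice[p pE] ih : exists y, d y = phi (u ih) := h (u ih).
pose T i (x : cprod r) := \sum_(h <- coset_reps L) slice c h x *: p (i, h).
have TD i : {morph T i : x y / x + y}.
  move=> x y; rewrite /T -big_split; apply: eq_bigr => k _.
  by rewrite slice_add scalerDl.
pose g (m : corner c C) := free_ext co T (corner_val m).
have gL : linear g.
  move=> a m n; rewrite /g (free_ext_add coL TD); congr (_ + _).
  apply: (free_ext_scale coL TD (sigma := fun x => a *: x)).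
    by split=> [|x y]; rewrite ?scaler0 ?scalerDr.
  move=> i x; rewrite /T scaler_sumr; apply: eq_bigr => k _.
  by rewrite slice_cemb scalerA.
exists (HB.pack_for {linear corner c C -> P} g
  (GRing.isLinear.Build _ _ _ _ _ gL)).
move=> x /=; rewrite /g /free_ext linear_sum.
have xE : x = \sum_(i <- finsupp (co (corner_val x)))
    \sum_(h <- coset_reps L)
       slice c h (co (corner_val x) i) *: u (i, h).
  apply: val_inj; rewrite raddf_sum [LHS](coE (corner_val x)).
  apply: eq_bigr => i _; rewrite raddf_sum.
  rewrite {1}(slice_decomp hfin (e1 (co (val x) i))) scaler_suml.
  apply: eq_bigr => k _ /=.
  by rewrite !scalerA -cembM mulr1.
rewrite [in RHS]xE !linear_sum; apply: eq_bigr => i _; rewrite !linear_sum.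
by apply: eq_bigr => k _; rewrite !linearZ pE.
Qed.

Section ChainLift.
Variables (R : nzRingType) (M : lmodType R) (C : nat -> lmodType R).
Variables (dC : forall k, {linear C k.+1 -> C k}) (aC : {linear C 0%N -> M}).
Hypothesis aC_dC : forall x, aC (dC 0%N x) = 0.
Hypothesis dC_dC : forall k x, dC k (dC k.+1 x) = 0.
Hypothesis C_lift : forall k, lifting_property (C k).
Variable E : resolution M.

(** The recursion carries two components and their commuting square, which puts the next map into
    the kernel of a boundary. *)
Let stage k := {p : {linear C k -> E k} * {linear C k.+1 -> E k.+1} |
  forall x, res_bd E k (p.2 x) = p.1 (dC k x)}.

Lemma chain_lift0 : exists p : {linear C 0 -> E 0} * {linear C 1 -> E 1},
  (forall x, res_aug E (p.1 x) = aC x) /\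
  (forall x, res_bd E 0 (p.2 x) = p.1 (dC 0%N x)).
Proof.
have [f0 f0E] : exists g : {linear C 0 -> E 0}, forall x, res_aug E (g x) = aC x.
  by apply: C_lift => x; exact: res_aug_surj.
have [f1 f1E] : exists g : {linear C 1 -> E 1}, forall x,
    res_bd E 0 (g x) = (f0 \o dC 0%N) x.
  by apply: C_lift => x; apply/res_exact0; rewrite /= f0E.
by exists (f0, f1).
Qed.

Lemma chain_liftS k (st : stage k) : exists g : {linear C k.+2 -> E k.+2},
  forall x, res_bd E k.+1 (g x) = (sval st).2 (dC k.+1 x).
Proof.
have [g gE] : exists g : {linear C k.+2 -> E k.+2}, forall x,
    res_bd E k.+1 (g x) = ((sval st).2 \o dC k.+1) x.
  by apply: C_lift => x; apply/res_exact; rewrite /= (svalP st) dC_dC linear0.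
by exists g.
Qed.

Lemma chain_lift : exists f : forall k, {linear C k -> E k},
  (forall x, res_aug E (f 0%N x) = aC x) /\
  (forall k x, res_bd E k (f k.+1 x) = f k (dC k x)).
Proof.
have [p [p0 p1]] := chain_lift0.
pose step k (st : stage k) : stage k.+1 :=
  let g := cid (chain_liftS st) in exist _ ((sval st).2, sval g) (svalP g).
pose st := fix st k : stage k := if k is k'.+1 then step k' (st k')
  else exist _ p p1.
(* The first component of [st k.+1] is by computation the second one of [st k]. *)
exists (fun k => (sval (st k)).1); split=> [x|k x]; first exact: p0.
exact: (svalP (st k)).
Qed.
End ChainLift.

Section CornerAugmentation.
Variables (G : groupType) (S : pred G) (L : subGroupType S).
Variables (A B : comNzRingType) (r : ring_action G A) (s : ring_action L B).
Variable c : compression r s.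

Lemma cres_scale f (m : base_module r) :
  cres c (cemb c f *: m : base_module r) =
  (f *: (cres c m : base_module s) : base_module s).
Proof.
elim/cprod_ind: f => [|f g IH IH'|b l].
- by rewrite cemb0 !scale0r rmorph0.
- by rewrite cembD !scalerDl rmorphD IH IH'.
rewrite cemb_mono [X in cres c X]base_scale_mono rmorphM cextK cres_act.
by rewrite [RHS]base_scale_mono.
Qed.

Variables (M : lmodType (cprod r)) (eta : {linear M -> base_module r}).

Definition corner_aug (m : corner c M) : base_module s :=
  cres c (eta (corner_val m)).

Lemma corner_aug_linear : linear corner_aug.
Proof.
move=> f m n; rewrite /corner_aug /= linearD rmorphD.
by rewrite linearZ cres_scale.
Qed.
HB.instance Definition _ := GRing.isLinear.Build _ _ _ _ corner_aug
  corner_aug_linear.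

Lemma corner_aug_surj : (forall u, exists x, eta x = u) ->
  forall v, exists x, corner_aug x = v.
Proof.
move=> eta_surj v; have [m mE] := eta_surj (cext c v).
exists (corner_proj c m); rewrite /corner_aug /= linearZ mE.
by rewrite cres_scale scale1r cextK.
Qed.

End CornerAugmentation.

Lemma res_bdK (R : nzRingType) (M : lmodType R) (C : resolution M) k x :
  res_bd C k (res_bd C k.+1 x) = 0.
Proof. by apply/res_exact; exists x. Qed.

Lemma res_augK (R : nzRingType) (M : lmodType R) (C : resolution M) x :
  res_aug C (res_bd C 0 x) = 0.
Proof. by apply/res_exact0; exists x. Qed.

Section RestrictResolution.
Variables (Z : coeff) (G : groupType) (S : pred G) (L : subGroupType S).

(** With A = B = Z and e = 1 the corner is restriction of scalars from ZG to ZL, so restricted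
    resolutions are an instance of corners. *)
Definition trivial_compression :
    compression (trivial_action Z G) (trivial_action Z L) :=
  @Compression G S L Z Z (trivial_action Z G) (trivial_action Z L) idfun idfun
    (fun=> erefl) (fun _ _ => erefl) (fun _ _ => erefl) (fun _ _ => erefl).

Let c := trivial_compression.
Variable C : resolution (trivial_module Z G).

Lemma restrict_exact0 (x : corner c (C 0%N)) :
  corner_aug (res_aug C) x = 0 <->
  exists y, corner_map c (res_bd C 0%N) y = x.
Proof.
split=> [x0|[y <-]].
  have [y yE] := (@res_exact0 _ _ C (corner_val x)).1 x0.
  exists (corner_proj c y); apply: val_inj.
  by rewrite /= linearZ yE; exact: cornerP.
exact: (res_augK (corner_val y)).
Qed.

Lemma restrict_exact k (x : corner c (C k.+1)) :
  corner_map c (res_bd C k) x = 0 <->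
  exists y, corner_map c (res_bd C k.+1) y = x.
Proof.
split=> [x0|[y <-]]; last first.
  by apply: val_inj; exact: (res_bdK (corner_val y)).
have [y yE] := (@res_exact _ _ C _ (corner_val x)).1 (congr1 val x0).
exists (corner_proj c y); apply: val_inj.
by rewrite /= linearZ yE; exact: cornerP.
Qed.

Definition restrict_resolution : resolution (trivial_module Z L) :=
  @Resolution _ (trivial_module Z L) (fun k => corner c (C k))
    (fun k => corner_map c (res_bd C k)) (corner_aug (res_aug C))
    (corner_aug_surj c (res_aug_surj C)) restrict_exact0 restrict_exact.

End RestrictResolution.

Section Comparison.
Variables (Z : coeff) (G : groupType) (S : pred G) (L : subGroupType S).
Variables (CG : free_resolution Z G) (CL : free_resolution Z L).
Local Notation Res := (restrict_resolution L CG).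

Lemma comparison_to_restriction : exists f : forall k, {linear CL k -> Res k},
  (forall x, res_aug Res (f 0%N x) = res_aug CL x) /\
  (forall k x, res_bd Res k (f k.+1 x) = f k (res_bd CL k x)).
Proof.
apply: chain_lift => [x|k x|k]; [exact: res_augK|exact: res_bdK|].
exact/free_lifting/free_resP.
Qed.

Lemma comparison_from_restriction : finite_index L ->
  exists f : forall k, {linear Res k -> CL k},
  (forall x, res_aug CL (f 0%N x) = res_aug Res x) /\
  (forall k x, res_bd CL k (f k.+1 x) = f k (res_bd Res k x)).
Proof.
move=> hfin.
apply: chain_lift => [x|k x|k]; [exact: res_augK|exact: res_bdK|].
by apply: free_corner_lifting => //; exact: free_resP.
Qed.
End Comparison.

(** * Norms and boundedness *)

Section LinftyNorm.
Variables (R : realType) (d : measure_display) (X : measurableType d).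
Variables (mu : probability X R) (Z : coeff).
Implicit Types (f g : Defs.bounded_fun mu Z) (u v : Linfty mu Z).

Lemma bounded_fun_preimage f (B : set Z) : measurable (f @^-1` B).
Proof. by have := valP f; rewrite unfold_in => /asboolP[]. Qed.

Lemma bounded_fun_bound f :
  exists2 M : R, 0 <= M & {ae mu, forall x, coeff_norm R (f x) <= M}.
Proof.
have := valP f; rewrite unfold_in => /asboolP[_ [M hM]].
exists (Num.max M 0); first by rewrite le_max lexx orbT.
by apply: filterS hM => x fM; rewrite le_max fM.
Qed.

Lemma measurable_coeff_norm f :
  measurable_fun setT (fun x => coeff_norm R (f x)).
Proof.
move=> _ B _; rewrite setTI.
exact: (bounded_fun_preimage f (fun z => B (coeff_norm R z))).
Qed.

Lemma measurable_coeff_normE f :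
  measurable_fun setT (EFin \o (fun x => coeff_norm R (f x))).
Proof. exact/measurable_EFinP/measurable_coeff_norm. Qed.

Lemma integral_coeff_norm_lty f :
  (\int[mu]_x (coeff_norm R (f x))%:E < +oo)%E.
Proof.
have [M M0 hM] := bounded_fun_bound f.
apply: (@le_lt_trans _ _ (\int[mu]_x (cst M%:E x))%E).
  apply: ae_ge0_le_integral => //.
  - by move=> x _; rewrite lee_fin coeff_norm_ge0.
  - exact: measurable_coeff_normE.
  - by apply: filterS hM => x ? _; rewrite lee_fin.
by rewrite integral_cst// [X in (_ * X)%E]probability_setT mule1 ltry.
Qed.

Lemma integral_coeff_norm_fin f :
  (\int[mu]_x (coeff_norm R (f x))%:E)%E \is a fin_num.
Proof.
rewrite ge0_fin_numE ?integral_coeff_norm_lty//.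
by apply: integral_ge0 => x _; rewrite lee_fin coeff_norm_ge0.
Qed.

(** [Linfty_norm1] integrates the chosen [Linfty_repr], which agrees with f almost everywhere. The
    equation is in the extended reals, where the integration lemmas live. *)
Lemma Linfty_norm1_class f :
  (Linfty_norm1 (Linfty_class f))%:E = (\int[mu]_x (coeff_norm R (f x))%:E)%E.
Proof.
rewrite /Linfty_norm1 /Rintegral fineK ?integral_coeff_norm_fin//.
apply: ae_eq_integral => //; try exact: measurable_coeff_normE.
by apply: filterS (Linfty_class_repr f) => x -> _.
Qed.

Lemma Linfty_norm1_ge0 u : 0 <= Linfty_norm1 u.
Proof.
by rewrite -(Linfty_reprK u) -lee_fin Linfty_norm1_class;
  apply: integral_ge0 => x _; rewrite lee_fin coeff_norm_ge0.
Qed.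

Lemma Linfty_norm10 : Linfty_norm1 (0 : Linfty mu Z) = 0.
Proof.
apply: EFin_inj; rewrite -Linfty_class0 Linfty_norm1_class.
rewrite (eq_integral (cst 0)%E); first exact: integral0.
by move=> x _; rewrite (_ : (0 : Defs.bounded_fun mu Z) x = 0)// coeff_norm0.
Qed.

Lemma Linfty_norm1D u v :
  Linfty_norm1 (u + v) <= Linfty_norm1 u + Linfty_norm1 v.
Proof.
rewrite -(Linfty_reprK u) -(Linfty_reprK v) -Linfty_classD -lee_fin EFinD.
set f := Linfty_repr u; set g := Linfty_repr v.
rewrite !Linfty_norm1_class -ge0_integralD//=;
  try (by move=> x _; rewrite lee_fin coeff_norm_ge0);
  try exact: measurable_coeff_normE.
apply: ge0_le_integral => //;
  try (by move=> x _; rewrite lee_fin ?addr_ge0 ?coeff_norm_ge0);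
  try exact: measurable_coeff_normE.
- exact: (measurable_coeff_normE (f + g)).
- by apply: emeasurable_funD; exact: measurable_coeff_normE.
move=> x _; rewrite -EFinD lee_fin.
change (coeff_norm R (f x + g x) <= coeff_norm R (f x) + coeff_norm R (g x)).
(* The bound for differences is applied twice, to f - (- g) and to 0 - g. *)
rewrite -[g x]opprK (le_trans (coeff_normB _ _ _))// opprK lerD2l.
rewrite -[- g x]sub0r (le_trans (coeff_normB _ _ _))//.
by rewrite coeff_norm0 add0r.
Qed.

Lemma Linfty_norm1M v : exists2 K : R, 0 <= K &
  forall u, Linfty_norm1 (u * v) <= K * Linfty_norm1 u.
Proof.
have [K K0 hK] := bounded_fun_bound (Linfty_repr v).
exists K => // u.
rewrite -(Linfty_reprK u) -[X in _ * X]Linfty_reprK -Linfty_classM -lee_fin.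
set f := Linfty_repr u; set g := Linfty_repr v.
rewrite EFinM !Linfty_norm1_class -ge0_integralZl//=;
  try (by move=> x _; rewrite lee_fin coeff_norm_ge0);
  try exact: measurable_coeff_normE.
apply: ae_ge0_le_integral => //;
  try (by move=> x _; rewrite lee_fin ?mulr_ge0 ?coeff_norm_ge0);
  try exact: measurable_coeff_normE.
- exact: (measurable_coeff_normE (f * g)).
- by apply: measurable_funeM; exact: measurable_coeff_normE.
apply: filterS hK => x gK _; rewrite -EFinM lee_fin.
change (coeff_norm R (f x * g x) <= K * coeff_norm R (f x)).
rewrite mulrC (le_trans (coeff_normM _ _ _))//.
by rewrite ler_wpM2r ?coeff_norm_ge0.
Qed.

End LinftyNorm.

(** Change of variables: on D the measure mu is k times the image of nu, and f vanishes off D. It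
    serves translations, with D = X and k = 1, and the copy of Y, with k = 1 / [G : L]. *)
Lemma Linfty_norm1_transport (R : realType) (Z : coeff)
    (d d' : measure_display) (X : measurableType d) (Y : measurableType d')
    (mu : probability X R) (nu : probability Y R) (phi : Y -> X)
    (k : {nonneg R}) (D : set X) (f : Defs.bounded_fun mu Z)
    (g : Defs.bounded_fun nu Z) :
  measurable_fun setT phi -> measurable D -> phi @^-1` D = setT ->
  (forall A, measurable A -> A `<=` D ->
    mu A = (k%:num%:E * nu (phi @^-1` A))%E) ->
  (forall x, ~ D x -> f x = 0) -> (forall y, f (phi y) = g y) ->
  Linfty_norm1 (Linfty_class f) = k%:num * Linfty_norm1 (Linfty_class g).
Proof.
move=> mphi mD phiD muD f0 fg.
pose F x := (coeff_norm R (f x))%:E.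
have F0 x : (0 <= F x)%E by rewrite lee_fin coeff_norm_ge0.
have mF E : measurable E -> measurable_fun E F.
  by move=> mE; apply: measurable_funS (measurable_coeff_normE f).
pose p := (pushforward nu phi : {measure set X -> \bar R}).
apply: EFin_inj; rewrite EFinM !Linfty_norm1_class.
transitivity (\int[mu]_(x in D) F x)%E.
  rewrite [RHS]integral_mkcond; apply: eq_integral => x _.
  by rewrite patchE; case: ifPn => // /negP xD; rewrite f0 ?coeff_norm0// => /mem_set.
transitivity (\int[mscale k (p mphi)]_(x in D) F x)%E.
  by apply: eq_measure_integral => A mA AD; rewrite [LHS]muD.
rewrite ge0_integral_mscale//; last exact: mF.
congr (_ * _)%E; rewrite ge0_integral_pushforward//; last exact: mF.
by rewrite phiD; apply: eq_integral => y _; rewrite /F /= fg.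
Qed.

Section TranslateNorm.
Variables (R : realType) (G : groupType) (d : measure_display).
Variables (X : measurableType d) (mu : probability X R).
Variables (alpha : pmp_action G mu) (Z : coeff).

Lemma Linfty_norm1_translate (g : G) (u : Linfty mu Z) :
  Linfty_norm1 (Linfty_action alpha Z g u) = Linfty_norm1 u.
Proof.
rewrite -(Linfty_reprK u) [Linfty_action _ _ _ _]Linfty_translate_class.
rewrite [RHS](@Linfty_norm1_transport _ _ _ _ _ _ _ mu (alpha g^-1%g)
  1%:nng setT _ (translate alpha g (Linfty_repr u))) ?mul1r//.
- exact: pmp_measurable.
- by move=> A mA _; rewrite mul1e pmp_preserving.
- by move=> x /(_ I).
Qed.
End TranslateNorm.

Lemma ler_subadditive_sum (R : numDomainType) (V : zmodType) (N : V -> R) (I : Type)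
    (t : seq I) (F : I -> V) :
  N 0 = 0 -> (forall u v, N (u + v) <= N u + N v) ->
  N (\sum_(i <- t) F i) <= \sum_(i <- t) N (F i).
Proof.
move=> N0 ND; elim/big_ind2: _ => [|x a y b hx hy|//]; first by rewrite N0.
by rewrite (le_trans (ND _ _))// lerD.
Qed.

Section Crossed.
Variables (R : realType) (G : groupType) (d : measure_display).
Variables (X : measurableType d) (mu : probability X R).
Variables (alpha : pmp_action G mu) (Z : coeff).
Local Notation r := (Linfty_action alpha Z).
Local Notation chi := (chi mu Z).
Local Notation norm := (@Linfty_norm1 R d X mu Z).
Local Notation cnorm := (@crossed_norm1 R G d X mu alpha Z).
Implicit Types (z w : crossed alpha Z) (A B : set X).

Lemma chiE A (mA : measurable A) :
  chi A = Linfty_class (BoundedFun (indic_bounded_measurable mu Z mA)).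
Proof.
congr Linfty_class; apply: val_inj.
by rewrite /= insubdK// indic_bounded_measurable.
Qed.

Lemma chi_act (g : G) A : measurable A ->
  r g (chi A) = chi (alpha g^-1%g @^-1` A).
Proof.
move=> mA; have mgA : measurable (alpha g^-1%g @^-1` A).
  by rewrite -[X in measurable X]setTI; exact: pmp_measurable.
rewrite !chiE [LHS]Linfty_translate_class; congr Linfty_class.
by apply: val_inj; apply/funext => x /=; rewrite !indicE; congr (_%:R).
Qed.

(** As (chi_A, 1) is idempotent, the left ideal <A> is the set of fixed points of right
    multiplication by it, a condition on each coefficient separately. *)
Lemma principalP A z : measurable A ->
  principal A z <-> forall x, z x * r x (chi A) = z x.
Proof.
move=> mA; split=> [[z' _ <-] x|h].
  by rewrite mul_cmonoE invg1 mulg1 -mulrA -rmorphM chiM.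
exists z => //; apply: cprodP => x.
by rewrite [LHS]mul_cmonoE invg1 mulg1 h.
Qed.

Lemma principal_chi1 A z : measurable A -> principal A z <-> z * chi1 alpha Z A = z.
Proof.
move=> mA; rewrite principalP//; split=> [h|h x].
  by apply: cprodP => x; rewrite [LHS]mul_cmonoE invg1 mulg1.
by rewrite -{2}h [RHS]mul_cmonoE invg1 mulg1.
Qed.

Lemma crossed_norm1E z (s : seq G) : uniq s -> (forall x, x \notin s -> z x = 0) ->
  cnorm z = \sum_(x <- s) norm (z x).
Proof.
move=> us s0; apply: eq_sum_support; rewrite ?fset_uniq// => x.
  by move=> /csupp_notin ->; rewrite Linfty_norm10.
by move=> /s0 ->; rewrite Linfty_norm10.
Qed.

Lemma crossed_norm1_ge0 z : 0 <= cnorm z.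
Proof. by apply: sumr_ge0 => x _; exact: Linfty_norm1_ge0. Qed.

Lemma crossed_norm10 : cnorm 0 = 0.
Proof.
by rewrite (@crossed_norm1E _ [::])// big_nil.
Qed.

Lemma crossed_norm1D z w : cnorm (z + w) <= cnorm z + cnorm w.
Proof.
pose s := (csupp z `|` csupp w)%fset.
have sz x : x \notin s -> z x = 0 by case/csuppU_notin.
have sw x : x \notin s -> w x = 0 by case/csuppU_notin.
rewrite !(@crossed_norm1E _ s) ?fset_uniq//; last first.
  by move=> x xs; rewrite cprodD sz// sw// addr0.
by rewrite -big_split; apply: ler_sum => x _; exact: Linfty_norm1D.
Qed.

Lemma crossed_norm1_mulr w : exists2 K : R, 0 <= K &
  forall z, cnorm (z * w) <= K * cnorm z.
Proof.
elim/cprod_ind: w => [|w v [K K0 hK] [K' K'0 hK']|b y].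
- by exists 0 => // z; rewrite mulr0 crossed_norm10 mul0r.
- exists (K + K'); first exact: addr_ge0.
  move=> z; rewrite mulrDr mulrDl.
  by rewrite (le_trans (crossed_norm1D _ _))// lerD.
have [K K0 hK] := Linfty_norm1M b.
exists K => // z.
rewrite (@crossed_norm1E (z * _) [seq (x * y)%g | x <- csupp z]).
- rewrite big_map mulr_sumr; apply: ler_sum => x _.
  rewrite mul_cmonoE -mulgA mulgV mulg1.
  (* Translation by x^-1 keeps the norm and turns the factor x.b into b, so that one bound K of b
     serves all x. *)
  rewrite -(Linfty_norm1_translate alpha x^-1%g) rmorphM ractVK.
  by rewrite (le_trans (hK _))// Linfty_norm1_translate.
- by rewrite map_inj_uniq ?fset_uniq//; exact: mulIg.
move=> x xn; rewrite mul_cmonoE.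
suff -> : z (x * y^-1)%g = 0 by rewrite mul0r.
apply: csupp_notin; apply: contra xn => xs.
by apply/mapP; exists (x * y^-1)%g; rewrite // -mulgA mulVg mulg1.
Qed.

(** Let e_i be the element of M corresponding to chi_(A_i). In coordinates f is right multiplication
    by the matrix of the f(e_i), whose entries are bounded by [crossed_norm1_mulr]; the sum of these
    bounds is a crude constant. *)
Lemma marked_map_bounded (M N : marked_module alpha Z) (f : {linear M -> N}) :
  exists2 c : R, 0 <= c & forall m, mm_norm1 (f m) <= c * mm_norm1 m.
Proof.
have /choice[e eE] i : exists e : M,
    mm_iso M e = [ffun j => if j == i then chi1 alpha Z (mm_set i) else 0].
  apply/mm_img => j; rewrite ffunE; case: eqP => [->|_].
    by exists 1 => //; rewrite mul1r.
  by exists 0 => //; rewrite mul0r.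
have mE (m : M) : m = \sum_i (mm_iso M m i : crossed alpha Z) *: e i.
  apply: (@mm_inj _ _ _ _ _ _ _ M); rewrite linear_sum.
  apply/ffunP => j; rewrite sum_ffunE (bigD1 j)//= big1 => [|i ij].
    rewrite addr0 linearZ eE !ffunE eqxx.
    have /(_ j)/(principal_chi1 _ (mm_measurable j))/esym :=
      (mm_img (mm_iso M m)).1 (ex_intro _ m erefl).
    exact.
  by rewrite linearZ eE !ffunE eq_sym (negPf ij); exact: mulr0.
have /choice[K hK] (ij : mm_idx M * mm_idx N) : exists K : R, 0 <= K /\
    forall z : crossed alpha Z,
      cnorm (z * (mm_iso N (f (e ij.1)) ij.2 : crossed alpha Z)) <= K * cnorm z.
  by have [K K0 h] := crossed_norm1_mulr (mm_iso N (f (e ij.1)) ij.2); exists K.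
exists (\sum_j \sum_i K (i, j)).
  by apply: sumr_ge0 => j _; apply: sumr_ge0 => i _; case: (hK (i, j)).
move=> m; rewrite mulr_suml; apply: ler_sum => j _.
rewrite {1}(mE m) !linear_sum sum_ffunE mulr_suml.
apply: le_trans (ler_subadditive_sum _ _ crossed_norm10 crossed_norm1D) _.
apply: ler_sum => i _; rewrite !linearZ ffunE.
apply: le_trans ((hK (i, j)).2 _) _.
apply: ler_wpM2l; first by case: (hK (i, j)).
rewrite /mm_norm1 (bigD1 i)//= lerDl; apply: sumr_ge0 => k _.
exact: crossed_norm1_ge0.
Qed.

End Crossed.

(** * Comparison of ranks, operator norms and logarithmic norms *)

Lemma le_inf_scaled (R : realType) (a : R) (A B : set R) : 0 < a ->
  A !=set0 -> has_lbound B -> (forall x, A x -> exists2 y, B y & y <= a * x) ->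
  inf B <= a * inf A.
Proof.
move=> a0 A0 Bl AB; rewrite -ler_pdivrMl//; apply: lb_le_inf => // x Ax.
have [y By yx] := AB x Ax.
by rewrite ler_pdivrMl//; apply: le_trans yx; exact: ge_inf.
Qed.

Lemma log_plus_ge0 (R : realType) (t : R) : 0 <= log_plus t.
Proof. by rewrite /log_plus le_max lexx orbT. Qed.

Lemma le_log_plus (R : realType) (x y : R) : x <= y -> log_plus x <= log_plus y.
Proof.
move=> xy; have [x0|x0] := ltP 0 x; last first.
  (* At x <= 0 the logarithm has the default value 0. *)
  by rewrite {1}/log_plus ln0// maxxx log_plus_ge0.
rewrite /log_plus ge_max; apply/andP; split; rewrite le_max ?lexx ?orbT//.
by rewrite ler_ln ?posrE ?xy// (lt_le_trans x0).
Qed.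

Section MarkedModules.
Variables (R : realType) (G : groupType) (d : measure_display).
Variables (X : measurableType d) (mu : probability X R).
Variables (alpha : pmp_action G mu) (Z : coeff).
Implicit Types M N : marked_module alpha Z.

Lemma mm_dim_ge0 M : 0 <= mm_dim M.
Proof. by apply: sumr_ge0 => i _; rewrite fine_ge0. Qed.

Definition full_summand M : marked_summand M :=
  MarkedSummand (@mm_measurable _ _ _ _ _ _ _ M) (fun i => @subset_refl _ (mm_set i)).

Lemma in_full_summand M (m : M) : m \in in_summand (full_summand M).
Proof.
rewrite unfold_in; apply/asboolP => i.
by move: i; apply/(mm_img (mm_iso M m)); exists m.
Qed.

Lemma rk_lbound M N (f : {linear M -> N}) :
  has_lbound [set mm_dim (summand_module N') |
    N' in [set N' : marked_summand N | forall m, f m \in in_summand N']].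
Proof. by exists 0 => _ [N' _ <-]; exact: mm_dim_ge0. Qed.

Lemma rk_nonempty M N (f : {linear M -> N}) :
  [set mm_dim (summand_module N') |
    N' in [set N' : marked_summand N | forall m, f m \in in_summand N']] !=set0.
Proof.
exists (mm_dim (summand_module (full_summand N))); exists (full_summand N) => //.
by move=> m; exact: in_full_summand.
Qed.

Lemma rk_ge0 M N (f : {linear M -> N}) : 0 <= rk f.
Proof.
by apply: lb_le_inf (rk_nonempty f) _ => _ [N' _ <-]; exact: mm_dim_ge0.
Qed.

Lemma lognorm'_ge0 M N (f : {linear M -> N}) : 0 <= lognorm' f.
Proof. by rewrite /lognorm' le_min !mulr_ge0 ?mm_dim_ge0 ?rk_ge0 ?log_plus_ge0. Qed.

Lemma lognorm_lbound M N (f : {linear M -> N}) :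
  has_lbound [set s | exists (p : nat) (M_ : 'I_p -> marked_summand M),
    marked_decomposition M_ /\ s = \sum_k lognorm' (restrict_summand (M_ k) f)].
Proof.
by exists 0 => _ [p [M_ [_ ->]]]; apply: sumr_ge0 => k _; exact: lognorm'_ge0.
Qed.

Lemma lognorm_nonempty M N (f : {linear M -> N}) :
  [set s | exists (p : nat) (M_ : 'I_p -> marked_summand M),
    marked_decomposition M_ /\
    s = \sum_k lognorm' (restrict_summand (M_ k) f)] !=set0.
Proof.
exists (\sum_(k < 1) lognorm' (restrict_summand (full_summand M) f)).
exists 1%N, (fun=> full_summand M); split=> // i; split.
  by apply/seteqP; split=> [x []//|x xi]; exists ord0.
by apply/trivIsetP => j k _ _; rewrite (ord1 j) (ord1 k) eqxx.
Qed.

End MarkedModules.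

Section Monotonicity.
Variables (R : realType) (G G' : groupType) (d d' : measure_display).
Variables (X : measurableType d) (mu : probability X R).
Variables (X' : measurableType d') (mu' : probability X' R).
Variables (alpha : pmp_action G mu) (alpha' : pmp_action G' mu') (Z : coeff).
Variables (M N : marked_module alpha Z) (M' N' : marked_module alpha' Z).
Variables (f : {linear M -> N}) (f' : {linear M' -> N'}) (a : R) (a0 : 0 < a).

Lemma opnorm_le :
  (forall c, 0 <= c -> (forall m, mm_norm1 (f m) <= c * mm_norm1 m) ->
    forall m', mm_norm1 (f' m') <= c * mm_norm1 m') ->
  opnorm f' <= opnorm f.
Proof.
move=> h; rewrite -[opnorm f]mul1r; apply: le_inf_scaled => //.
- by have [c c0 hc] := marked_map_bounded f; exists c.
- by exists 0 => c [].
by move=> c [c0 /(h c c0) hc]; exists c; rewrite ?mul1r.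
Qed.

Lemma rk_le :
  (forall N1 : marked_summand N, (forall m, f m \in in_summand N1) ->
    exists N1' : marked_summand N', (forall m', f' m' \in in_summand N1') /\
      mm_dim (summand_module N1') <= a * mm_dim (summand_module N1)) ->
  rk f' <= a * rk f.
Proof.
move=> h; apply: le_inf_scaled => //; [exact: rk_nonempty|exact: rk_lbound|].
move=> _ [N1 /h[N1' [fN1' le]] <-].
by exists (mm_dim (summand_module N1')) => //; exists N1'.
Qed.

(** Both entries of the minimum acquire the same factor a, which can be taken out. *)
Lemma lognorm'_le : mm_dim M' <= a * mm_dim M -> opnorm f' <= opnorm f ->
  rk f' <= a * rk f -> lognorm' f' <= a * lognorm' f.
Proof.
move=> hdim hop hrk; rewrite /lognorm' minr_pMr; last exact: ltW.
rewrite !mulrA le_min !ge_min.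
apply/andP; split; apply/orP; [left|right].
  by apply: ler_pM; rewrite ?mm_dim_ge0 ?log_plus_ge0 ?le_log_plus.
by apply: ler_pM; rewrite ?rk_ge0 ?log_plus_ge0 ?le_log_plus.
Qed.

Lemma lognorm_le :
  (forall p (M_ : 'I_p -> marked_summand M), marked_decomposition M_ ->
    exists M_' : 'I_p -> marked_summand M', marked_decomposition M_' /\
      forall k, lognorm' (restrict_summand (M_' k) f') <=
        a * lognorm' (restrict_summand (M_ k) f)) ->
  lognorm f' <= a * lognorm f.
Proof.
move=> h; apply: le_inf_scaled => //;
  [exact: lognorm_nonempty|exact: lognorm_lbound|].
move=> _ [p [M_ [/h[M_' [dM le]] ->]]].
exists (\sum_k lognorm' (restrict_summand (M_' k) f')); first by exists p, M_'.
by rewrite mulr_sumr; apply: ler_sum.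
Qed.

End Monotonicity.

(** * Corners of marked modules *)

(* [sc_map] is the identity of X, with scale 1, for a restricted action, and the
   inclusion of a copy of Y, with scale 1 / [G : L], for an induced one. Both
   satisfy [sc_vol] with the same constant. *)
Record space_compression (R : realType) (G : groupType) (S : pred G)
    (L : subGroupType S) (d d' : measure_display)
    (X : measurableType d) (mu : probability X R)
    (Y : measurableType d') (nu : probability Y R)
    (alpha : pmp_action G mu) (beta : pmp_action L nu) (Z : coeff) :=
  SpaceCompression {
  sc_comp :> compression (Linfty_action alpha Z) (Linfty_action beta Z);
  sc_map : Y -> X;
  sc_measurable : forall A, measurable A -> measurable (sc_map @^-1` A);
  sc_chi : forall A, measurable A ->
    cres sc_comp (chi mu Z A) = chi nu Z (sc_map @^-1` A);
  sc_const : forall z : Z, cres sc_comp (Linfty_const mu z) = Linfty_const nu z;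
  sc_scale : R;
  sc_scale_gt0 : 0 < sc_scale;
  sc_norm : forall v, Linfty_norm1 (cext sc_comp v) = sc_scale * Linfty_norm1 v;
  sc_vol : forall A, measurable A ->
    \sum_(h <- coset_reps L) fine (nu (sc_map @^-1` (alpha h @^-1` A))) =
    (subgroup_index L)%:R * fine (mu A)
}.

Section MarkedCorner.
Variables (R : realType) (G : groupType) (S : pred G) (L : subGroupType S).
Variables (d d' : measure_display).
Variables (X : measurableType d) (mu : probability X R).
Variables (Y : measurableType d') (nu : probability Y R).
Variables (alpha : pmp_action G mu) (beta : pmp_action L nu) (Z : coeff).
Variable c : space_compression alpha beta Z.
Hypothesis hfin : finite_index L.

Local Notation reps := (coset_reps L).
Local Notation rep k := (nth 1%g (coset_reps L) k).

Lemma rep_mem (k : 'I_(size reps)) : rep k \in reps.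
Proof. exact: mem_nth. Qed.

Lemma rep_eq (j k : 'I_(size reps)) : (rep j == rep k) = (j == k).
Proof. by rewrite nth_uniq// coset_reps_uniq. Qed.

Lemma sum_reps (V : nmodType) (F : G -> V) :
  \sum_(k < size reps) F (rep k) = \sum_(h <- reps) F h.
Proof. by rewrite (big_nth 1%g) big_mkord. Qed.

(** The set h^-1 A n Y, as a subset of Y. *)
Definition corner_set (h : G) (A : set X) : set Y :=
  sc_map c @^-1` (alpha h @^-1` A).

Lemma corner_set_measurable h A : measurable A -> measurable (corner_set h A).
Proof.
move=> mA; apply: sc_measurable; rewrite -[X in measurable X]setTI.
exact: pmp_measurable.
Qed.

Lemma slice_chi1 h (w : crossed alpha Z) A : measurable A ->
  slice c h (w * chi1 alpha Z A) = slice c h w * chi1 beta Z (corner_set h A).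
Proof.
move=> mA; apply: (etrans (slice_mulr c h w (chi mu Z A))).
have mhA : measurable (alpha h @^-1` A).
  by rewrite -[X in measurable X]setTI; exact: pmp_measurable.
have -> : cres c (Linfty_action alpha Z h^-1%g (chi mu Z A)) =
    chi nu Z (corner_set h A) by rewrite chi_act// invgK sc_chi.
by [].
Qed.

(** The splitting of e <A> into the <h^-1 A n Y>, in coordinates: the equation w chi_A = w can be
    tested on slices, which separate the elements of e R. *)
Lemma corner_principal (w : crossed alpha Z) A : measurable A ->
  cemb c 1 * w = w ->
  principal A w <-> forall k : 'I_(size reps),
    principal (corner_set (rep k) A) (slice c (rep k) w).
Proof.
move=> mA hw; split=> [/(principal_chi1 _ mA) wA k|h].
  apply/principal_chi1; first exact: corner_set_measurable.
  by rewrite -slice_chi1// wA.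
apply/principal_chi1 => //; apply: (@slice_inj _ _ _ _ _ _ _ c) => //.
  by rewrite mulrA [cemb c 1 * w]hw.
move=> h' /(nthP 1%g)[k ks <-]; rewrite slice_chi1//.
apply/principal_chi1; first exact: corner_set_measurable.
exact: (h (Ordinal ks)).
Qed.

Section CornerModule.
Variable M : marked_module alpha Z.

Definition corner_idx : finType := (mm_idx M * 'I_(size reps))%type.

Definition corner_iso (m : corner c M) : {ffun corner_idx -> (crossed beta Z)^o} :=
  [ffun ik : corner_idx => slice c (rep ik.2) (mm_iso M (corner_val m) ik.1)].

Lemma corner_iso_linear : linear corner_iso.
Proof.
move=> a m n; apply/ffunP => ik; rewrite !ffunE /= linearD linearZ !ffunE.
by rewrite slice_add [X in X + _]slice_cemb.
Qed.
HB.instance Definition _ := GRing.isLinear.Build _ _ _ _ corner_iso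
  corner_iso_linear.

Lemma corner_isoP (m : corner c M) i :
  cemb c 1 * (mm_iso M (corner_val m) i : crossed alpha Z) =
  mm_iso M (corner_val m) i.
Proof. by have := congr1 (fun x => mm_iso M x i) (cornerP m); rewrite linearZ ffunE. Qed.

Lemma corner_iso_inj : injective corner_iso.
Proof.
move=> m n mn; apply: val_inj; apply: (@mm_inj _ _ _ _ _ _ _ M).
apply/ffunP => i; apply: (@slice_inj _ _ _ _ _ _ _ c) => //;
  try exact: corner_isoP.
move=> h /(nthP 1%g)[k ks <-].
by have /ffunP/(_ (i, Ordinal ks)) := mn; rewrite !ffunE.
Qed.

Lemma corner_iso_principal (B : mm_idx M -> set X) (m : corner c M) :
  (forall i, measurable (B i)) ->
  (forall i, principal (B i) (mm_iso M (corner_val m) i)) <->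
  (forall ik : corner_idx,
    principal (corner_set (rep ik.2) (B ik.1)) (corner_iso m ik)).
Proof.
move=> mB; split=> h.
  move=> [i k]; rewrite ffunE /=; move: k.
  by apply/(corner_principal (mB i)); [exact: corner_isoP|exact: h].
move=> i; apply/corner_principal => //; first exact: corner_isoP.
by move=> k; have := h (i, k); rewrite ffunE.
Qed.

(** Arbitrary slices are assembled by the formula of [slice_decomp]. *)
Lemma corner_iso_lift (z : {ffun corner_idx -> (crossed beta Z)^o}) :
  exists w : {ffun mm_idx M -> (crossed alpha Z)^o}, forall i,
    cemb c 1 * (w i : crossed alpha Z) = w i /\
    forall k : 'I_(size reps), slice c (rep k) (w i) = z (i, k).
Proof.
exists [ffun i => \sum_k cemb c (z (i, k) : crossed beta Z) *
  cmono (Linfty_action alpha Z) 1 (rep k)^-1%g] => i; rewrite ffunE; split.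
  by rewrite mulr_sumr; apply: eq_bigr => k _; exact: cemb1_absorb.
move=> k.
have slice0 : slice c (rep k) 0 = 0.
  by apply: (addrI (slice c (rep k) 0)); rewrite -slice_add !addr0.
rewrite (big_morph (slice c (rep k)) (@slice_add _ _ _ _ _ _ _ c (rep k)) slice0).
rewrite (bigD1 k)//= slice_cembV ?rep_mem// eqxx big1 ?addr0// => j jk.
by rewrite slice_cembV ?rep_mem// rep_eq eq_sym (negPf jk).
Qed.

Lemma corner_img (z : {ffun corner_idx -> (crossed beta Z)^o}) :
  (exists m, corner_iso m = z) <->
  (forall ik : corner_idx, principal (corner_set (rep ik.2) (mm_set ik.1)) (z ik)).
Proof.
split=> [[m <-]|h].
  apply/corner_iso_principal; first exact: mm_measurable.
  by apply/mm_img; exists (corner_val m).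
have [w wP] := corner_iso_lift z.
have [|m mw] := (mm_img w).2.
  move=> i; apply/corner_principal; first exact: mm_measurable.
    exact: (wP i).1.
  by move=> k; rewrite (wP i).2; exact: h (i, k).
have mP : m \in @corner_pred _ _ _ _ _ _ _ c M.
  rewrite unfold_in; apply/eqP/(@mm_inj _ _ _ _ _ _ _ M); apply/ffunP => i.
  by rewrite linearZ ffunE mw; exact: (wP i).1.
exists (Corner mP); apply/ffunP => -[i k]; rewrite ffunE /= mw.
exact: (wP i).2.
Qed.

Definition corner_module : marked_module beta Z :=
  @MarkedModule R L d' Y nu beta Z (corner c M) corner_idx
    (fun ik : corner_idx => corner_set (rep ik.2) (mm_set ik.1))
    (fun ik : corner_idx => corner_set_measurable (rep ik.2) (mm_measurable ik.1))
    corner_iso corner_iso_inj corner_img.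

(** The right cosets L h^-1 partition G, and on each of them the coefficients of w are the
    extensions by 0 of those of its slice, with norms rescaled by [sc_norm]. *)
Lemma slice_norm (w : crossed alpha Z) : cemb c 1 * w = w ->
  crossed_norm1 w =
  sc_scale c * \sum_(h <- reps) crossed_norm1 (slice c h w).
Proof.
move=> hw; pose F x := Linfty_norm1 (w x).
have wE (h : G) (l : L) : w (val l * h^-1)%g = cext c (slice c h w l).
  by rewrite sliceE cext_res mulrC -cemb1_mulE hw.
rewrite /crossed_norm1 (@sum_cosetsV _ _ L _ hfin F _
  (fun h => csupp (slice c h w))) ?fset_uniq//.
- rewrite mulr_sumr; apply: eq_bigr => h _; rewrite mulr_sumr.
  by apply: eq_bigr => l _; rewrite /F wE sc_norm.
- by move=> x /csupp_notin xw; rewrite /F xw Linfty_norm10.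
- by move=> h; exact: fset_uniq.
by move=> h l _ /csupp_notin ln; rewrite /F wE ln raddf0 Linfty_norm10.
Qed.

Lemma corner_norm (m : corner_module) :
  mm_norm1 (corner_val m) = sc_scale c * mm_norm1 m.
Proof.
have -> : mm_norm1 m = \sum_i \sum_(k < size reps)
    crossed_norm1 (slice c (rep k) (mm_iso M (corner_val m) i)).
  by rewrite pair_bigA; apply: eq_bigr => ik _; rewrite ffunE.
rewrite mulr_sumr; apply: eq_bigr => i _; rewrite slice_norm; last exact: corner_isoP.
by rewrite -sum_reps.
Qed.

Lemma corner_set_sum (B : mm_idx M -> set X) : (forall i, measurable (B i)) ->
  \sum_(ik : corner_idx) fine (nu (corner_set (rep ik.2) (B ik.1))) =
  (subgroup_index L)%:R * \sum_i fine (mu (B i)).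
Proof.
move=> mB; transitivity (\sum_i \sum_(k < size reps)
    fine (nu (corner_set (rep k) (B i)))); first by rewrite pair_bigA.
rewrite mulr_sumr; apply: eq_bigr => i _.
by rewrite (sum_reps (fun h => fine (nu (corner_set h (B i))))) sc_vol.
Qed.

Lemma corner_dim : mm_dim corner_module = (subgroup_index L)%:R * mm_dim M.
Proof. exact: (corner_set_sum (@mm_measurable _ _ _ _ _ _ _ M)). Qed.

Definition corner_summand (B : marked_summand M) : marked_summand corner_module :=
  @MarkedSummand _ _ _ _ _ _ _ corner_module
    (fun ik : corner_idx => corner_set (rep ik.2) (B ik.1))
    (fun ik : corner_idx => corner_set_measurable (rep ik.2) (ms_measurable B ik.1))
    (fun ik y => @ms_sub _ _ _ _ _ _ _ M B ik.1 (alpha (rep ik.2) (sc_map c y))).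

Lemma corner_summand_dim (B : marked_summand M) :
  mm_dim (summand_module (corner_summand B)) =
  (subgroup_index L)%:R * mm_dim (summand_module B).
Proof. exact: (corner_set_sum (@ms_measurable _ _ _ _ _ _ _ M B)). Qed.

Lemma in_corner_summand (B : marked_summand M) (m : corner_module) :
  (m \in in_summand (corner_summand B)) = (corner_val m \in in_summand B).
Proof.
rewrite !unfold_in; apply/asboolP/asboolP => h.
  by apply/corner_iso_principal => //; exact: ms_measurable.
by apply/(@corner_iso_principal B) => //; exact: ms_measurable.
Qed.

Lemma corner_decomposition p (M_ : 'I_p -> marked_summand M) :
  marked_decomposition M_ ->
  marked_decomposition (fun k => corner_summand (M_ k)).
Proof.
move=> dM [i k] /=; have [MU MI] := dM i; split.
  by rewrite -[mm_set i]MU /corner_set !preimage_bigcup.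
apply/trivIsetP => j j' _ _ jj'; rewrite -subset0 => y [Mj Mj'].
have /trivIsetP/(_ j j' I I jj') MI0 := MI.
have : (M_ j i `&` M_ j' i) (alpha (rep k) (sc_map c y)) by split.
by rewrite MI0.
Qed.

End CornerModule.

Section CornerMarkedMap.
Variables (M N : marked_module alpha Z) (f : {linear M -> N}).

Definition corner_mmap : {linear corner_module M -> corner_module N} :=
  corner_map c f.

Lemma corner_lognorm : lognorm corner_mmap <= (subgroup_index L)%:R * lognorm f.
Proof.
have i0 : 0 < (subgroup_index L)%:R :> R by rewrite ltr0n subgroup_index_gt0.
apply: lognorm_le => // p M_ dM.
exists (fun k => corner_summand (M_ k)); split; first exact: corner_decomposition.
move=> k; apply: lognorm'_le => //.
- by rewrite corner_summand_dim.
- apply: opnorm_le => a a0 h [m mB].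
  have mB' : corner_val m \in in_summand (M_ k) by rewrite -in_corner_summand.
  have := h (SummandMod mB').
  have -> : mm_norm1 (SummandMod mB' : summand_module (M_ k)) =
            mm_norm1 (corner_val m : M) by [].
  have -> : mm_norm1 (SummandMod mB : summand_module (corner_summand (M_ k))) =
            mm_norm1 (m : corner_module M) by [].
  (* The norms of m and of its image carry the same factor [sc_scale]; it cancels, and a stays
     admissible. *)
  rewrite corner_norm mulrCA.
  rewrite -[restrict_summand _ _ _]/(corner_val (corner_mmap m)) corner_norm.
  by rewrite ler_pM2l ?sc_scale_gt0.
apply: rk_le => // N1 fN1; exists (corner_summand N1).
rewrite corner_summand_dim; split=> // -[m mB].
rewrite in_corner_summand.
have mB' : corner_val m \in in_summand (M_ k) by rewrite -in_corner_summand.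
exact: fN1 (SummandMod mB').
Qed.
End CornerMarkedMap.

End MarkedCorner.

(** * Corner complexes and their embeddings *)

Lemma ereal_inf_scale_le (R : realType) (a : R) (A : set (\bar R)) (y : \bar R) :
  0 < a -> (forall x, A x -> (y <= a%:E * x)%E) -> (y <= a%:E * ereal_inf A)%E.
Proof.
move=> a0 h; rewrite -lee_pdivrMl//; apply: le_ereal_inf_tmp => x Ax.
by rewrite lee_pdivrMl//; exact: h.
Qed.

Section CornerComplex.
Variables (R : realType) (G : groupType) (S : pred G) (L : subGroupType S).
Variables (d d' : measure_display).
Variables (X : measurableType d) (mu : probability X R).
Variables (Y : measurableType d') (nu : probability Y R).
Variables (alpha : pmp_action G mu) (beta : pmp_action L nu) (Z : coeff).
Variable c : space_compression alpha beta Z.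
Hypothesis hfin : finite_index L.
Local Notation triv := (trivial_compression Z L).

(** Y is L-invariant, so e commutes with ZL. Hence on e D the action of ZL through R agrees with
    that through L^oo(Y) * L, which makes the transported chain map linear. *)
Lemma cemb_incl (a : group_ring Z L) :
  cemb c 1 * group_ring_incl alpha (cemb triv a) =
  cemb c (group_ring_incl beta a) * cemb c 1.
Proof.
rewrite -cembM mulr1; elim/cprod_ind: a => [|f g IH IH'|z l].
- by rewrite [cemb triv 0]cemb0 !raddf0 mulr0 [RHS]cemb0.
- by rewrite [cemb triv _]cembD !raddfD mulrDr IH IH' [RHS]cembD.
rewrite [cemb triv _]cemb_mono /group_ring_incl !cprod_map_mono.
rewrite cemb_mono cemb1 [LHS]cmonoM mul1g ract1.
congr cmono; apply: etrans (mulrC _ _) _.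
exact: etrans (esym (cext_res c _)) (congr1 (cext c) (sc_const c z)).
Qed.

Section Complex.
Variable D : augmented_complex alpha Z.

Lemma corner_bdK k (x : corner_module c hfin (D k.+2)) :
  corner_mmap c hfin (ac_bd D k) (corner_mmap c hfin (ac_bd D k.+1) x) = 0.
Proof. by apply: val_inj; exact: ac_bdK. Qed.

Lemma corner_aug_bd (x : corner_module c hfin (D 1%N)) :
  corner_aug (ac_aug D) (corner_mmap c hfin (ac_bd D 0%N) x) = 0.
Proof. by rewrite /corner_aug [ac_aug D _]ac_aug_bd rmorph0. Qed.

Definition corner_complex : augmented_complex beta Z :=
  @AugmentedComplex R L d' Y nu beta Z (fun k => corner_module c hfin (D k))
    (fun k => corner_mmap c hfin (ac_bd D k)) corner_bdK (corner_aug (ac_aug D))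
    (corner_aug_surj c (@ac_aug_surj _ _ _ _ _ _ _ D)) corner_aug_bd.

Variables (CG : free_resolution Z G) (CL : free_resolution Z L) (n : nat).

Lemma corner_embeddable : embeddable CG n D -> embeddable CL n corner_complex.
Proof.
move=> [f [f0 fS]]; have [g [g0 gS]] := comparison_to_restriction CG CL.
(* The comparison g leads from CL to the restriction of CG; then f is applied and the result
   multiplied by e, an operation that commutes with the boundaries of D. *)
pose F k (x : CL k) : corner c (D k) := corner_proj c (f k (corner_val (g k x))).
have FL k : linear_for (group_ring_incl beta (Z:=Z) \; *:%R) (F k).
  move=> a x y; apply: val_inj; rewrite /= linearD linearZ /=.
  rewrite linearD scalerDr; congr (_ + _).
  by rewrite linearZ /= !scalerA cemb_incl.
exists (fun k => HB.pack_for
  {linear CL k -> corner_complex k | group_ring_incl beta (Z:=Z) \; *:%R}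
  (F k) (GRing.isLinear.Build _ _ _ _ _ (FL k))).
split=> [x|k kn x].
  change (cres c (ac_aug D (cemb c 1 *: f 0%N (corner_val (g 0%N x)))) =
    Linfty_const nu (res_aug CL x)).
  rewrite linearZ f0 -g0; apply: etrans (cres_scale c 1 _) _.
  by rewrite scale1r; exact: sc_const.
apply: val_inj.
change (ac_bd D k (cemb c 1 *: f k.+1 (corner_val (g k.+1 x))) =
  cemb c 1 *: f k (corner_val (g k (res_bd CL k x)))).
by rewrite linearZ fS// -gS.
Qed.

End Complex.
End CornerComplex.

Lemma medim_compression (R : realType) (G : groupType) (S : pred G)
    (L : subGroupType S) (d d' : measure_display)
    (X : measurableType d) (mu : probability X R)
    (Y : measurableType d') (nu : probability Y R)
    (alpha : pmp_action G mu) (beta : pmp_action L nu) (Z : coeff)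
    (c : space_compression alpha beta Z) (n : nat)
    (CG : free_resolution Z G) (CL : free_resolution Z L) : finite_index L ->
  (medim beta CL n <= (subgroup_index L)%:R%:E * medim alpha CG n)%E.
Proof.
move=> hfin; apply: ereal_inf_scale_le; first by rewrite ltr0n subgroup_index_gt0.
move=> _ [D [hD ->]]; apply: ereal_inf_lbound.
exists (corner_complex c hfin D); split; first exact: corner_embeddable hD.
by rewrite -EFinM; congr EFin; rewrite -(corner_dim c hfin).
Qed.

Lemma mevol_compression (R : realType) (G : groupType) (S : pred G)
    (L : subGroupType S) (d d' : measure_display)
    (X : measurableType d) (mu : probability X R)
    (Y : measurableType d') (nu : probability Y R)
    (alpha : pmp_action G mu) (beta : pmp_action L nu)
    (c : space_compression alpha beta CoeffInt) (n : nat)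
    (CG : free_resolution CoeffInt G) (CL : free_resolution CoeffInt L) :
  finite_index L ->
  (mevol beta CL n <= (subgroup_index L)%:R%:E * mevol alpha CG n)%E.
Proof.
move=> hfin; apply: ereal_inf_scale_le; first by rewrite ltr0n subgroup_index_gt0.
move=> _ [D [hD ->]].
apply: (@le_trans _ _ (lognorm (ac_bd (corner_complex c hfin D) n))%:E).
  apply: ereal_inf_lbound; exists (corner_complex c hfin D).
  by split; first exact: corner_embeddable hD.
by rewrite -EFinM lee_fin; exact: corner_lognorm.
Qed.

(** * Coinduced modules *)

Section CoinducedPredicate.
Variables (G : groupType) (S : pred G) (L : subGroupType S).
Variables (B : comNzRingType) (s : ring_action L B) (M : lmodType (cprod s)).

Definition coind_pred : {pred G -> M} :=
  fun F => `[< forall g (l : L), F (g * val l)%g = cmono s 1 l^-1%g *: F g >].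

Lemma coind_zmod_closed : zmod_closed coind_pred.
Proof.
split=> [|F F']; rewrite !unfold_in.
  by apply/asboolP => g l; rewrite scaler0.
move=> /asboolP hF /asboolP hF'; apply/asboolP => g l.
by rewrite !addrfctE !opprfctE hF hF' scalerBr.
Qed.
HB.instance Definition _ :=
  GRing.isZmodClosed.Build (G -> M) coind_pred coind_zmod_closed.
End CoinducedPredicate.

(* The compression is only there to determine the scalar action below. *)
Record coind (G : groupType) (S : pred G) (L : subGroupType S)
    (A B : comNzRingType) (r : ring_action G A) (s : ring_action L B)
    (c : compression r s) (M : lmodType (cprod s)) :=
  Coind { coind_fun : G -> M; _ : coind_fun \in @coind_pred G S L B s M }.

Section Coinduction.
Variables (G : groupType) (S : pred G) (L : subGroupType S).
Variables (A B : comNzRingType) (r : ring_action G A) (s : ring_action L B).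
Variable c : compression r s.

Lemma cmono_swap (l : L) b :
  cmono s (s l b) 1%g * cmono s 1 l = cmono s 1 l * cmono s b 1%g.
Proof. by rewrite !cmonoM ract1 mulr1 mul1r mul1g mulg1. Qed.

Section CoinducedModule.
Variable M : lmodType (cprod s).
Local Notation coind_pred := (@coind_pred G S L B s M).
Local Notation coind := (coind c M).

HB.instance Definition _ := [isSub of coind for @coind_fun G S L A B r s c M].
HB.instance Definition _ := [Choice of coind by <:].
HB.instance Definition _ := [SubChoice_isSubZmodule of coind by <:].

Lemma coindP (F : coind) g (l : L) :
  coind_fun F (g * val l)%g = cmono s 1 l^-1%g *: coind_fun F g.
Proof. by have := valP F; rewrite unfold_in => /asboolP; exact. Qed.

Lemma coind_eq (F F' : coind) :
  (forall g, coind_fun F g = coind_fun F' g) -> F = F'.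
Proof. by move=> FF'; apply/val_inj/funext. Qed.

Lemma coindD (F F' : coind) g :
  coind_fun (F + F') g = coind_fun F g + coind_fun F' g.
Proof. by []. Qed.

(* On functions on the G-space induced from Y: [cres (r g^-1 u)] is u restricted
   to the copy g Y. *)
Definition coind_scale_fun (z : cprod r) (F : G -> M) (g : G) : M :=
  cprod_sum (fun k a => cmono s (cres c (r g^-1%g a)) 1%g *: F (k^-1 * g)%g) z.

Let term_add (F : G -> M) (g k : G) :
  {morph (fun a => cmono s (cres c (r g^-1%g a)) 1%g *: F (k^-1 * g)%g) :
    a b / a + b}.
Proof. by move=> a b; rewrite !rmorphD cmonoD scalerDl. Qed.

Lemma coind_scale_funD (F : G -> M) (g : G) :
  {morph (fun z => coind_scale_fun z F g) : z w / z + w}.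
Proof. by move=> z w; rewrite /coind_scale_fun cprod_sumD. Qed.

Lemma coind_scale_fun_mono (F : G -> M) (g k : G) a :
  coind_scale_fun (cmono r a k) F g =
  cmono s (cres c (r g^-1%g a)) 1%g *: F (k^-1 * g)%g.
Proof. by rewrite /coind_scale_fun cprod_sum_mono. Qed.

Lemma coind_scale_subproof z (F : coind) :
  coind_scale_fun z (coind_fun F) \in coind_pred.
Proof.
rewrite unfold_in; apply/asboolP => g l; rewrite /coind_scale_fun /cprod_sum.
rewrite scaler_sumr; apply: eq_bigr => k _.
rewrite mulgA coindP invgM -valVg ractM cres_act !scalerA.
by rewrite cmono_swap.
Qed.

Definition coind_scale z (F : coind) : coind :=
  @Coind G S L A B r s c M _ (coind_scale_subproof z F).

Let coind_scaleDl F : {morph coind_scale^~ F : z w / z + w}.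
Proof. by move=> z w; apply: coind_eq => g; rewrite /= coind_scale_funD. Qed.

Let coind_scaleDr : right_distributive coind_scale +%R.
Proof.
move=> z F F'; apply: coind_eq => g.
rewrite coindD /= /coind_scale_fun /cprod_sum -big_split.
by apply: eq_bigr => k _; rewrite scalerDr.
Qed.

Let coind_scale0 F : coind_scale 0 F = 0.
Proof. by apply: (addrI (coind_scale 0 F)); rewrite -coind_scaleDl !addr0. Qed.
Let coind_scale0r z : coind_scale z 0 = 0.
Proof. by apply: (addrI (coind_scale z 0)); rewrite -coind_scaleDr !addr0. Qed.

Let coind_scale1 : left_id 1 coind_scale.
Proof.
move=> F; apply: coind_eq => g.
rewrite /= cprod1E coind_scale_fun_mono !rmorph1 invg1 mul1g.
by rewrite -cprod1E scale1r.
Qed.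

Let coind_scaleA z w F :
  coind_scale z (coind_scale w F) = coind_scale (z * w) F.
Proof.
elim/cprod_ind: z => [|z z' IH IH'|a x].
- by rewrite mul0r !coind_scale0.
- by rewrite mulrDl !coind_scaleDl IH IH'.
elim/cprod_ind: w => [|w w' IH IH'|b y].
- by rewrite mulr0 !coind_scale0 coind_scale0r.
- by rewrite mulrDr !coind_scaleDl coind_scaleDr IH IH'.
apply: coind_eq => g; rewrite cmonoM /= !coind_scale_fun_mono scalerA cmonoM.
rewrite ract1 mulg1 !rmorphM !invgM invgK ractM !mulgA.
by rewrite -(ractM r g^-1%g x b).
Qed.

HB.instance Definition _ := GRing.Zmodule_isLmodule.Build (cprod r) coind
  coind_scaleA coind_scale1 coind_scaleDr coind_scaleDl.

Lemma coind_scale_mono a (k : G) (F : coind) g :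
  coind_fun (cmono r a k *: F) g =
  cmono s (cres c (r g^-1%g a)) 1%g *: coind_fun F (k^-1 * g)%g.
Proof. exact: coind_scale_fun_mono. Qed.

Hypothesis hfin : finite_index L.

Lemma coind_extend_subproof (m : G -> M) :
  (fun g => cmono s 1 (coset_part L g)^-1%g *: m (coset_rep L g)) \in coind_pred.
Proof.
rewrite unfold_in; apply/asboolP => g l.
by rewrite coset_repM coset_partM// invgM scalerA cmonoM rmorph1 mulr1.
Qed.

(** Values on the coset representatives can be prescribed freely; at h l the value l^-1 m(h) is
    forced. *)
Definition coind_extend m : coind :=
  @Coind G S L A B r s c M _ (coind_extend_subproof m).

End CoinducedModule.

Section CoinducedMap.
Variables (M N : lmodType (cprod s)) (f : {linear M -> N}).

Lemma coind_map_subproof (F : coind c M) :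
  (fun g => f (coind_fun F g)) \in @coind_pred G S L B s N.
Proof.
by rewrite unfold_in; apply/asboolP => g l; rewrite coindP linearZ.
Qed.

Definition coind_map (F : coind c M) : coind c N :=
  @Coind G S L A B r s c N _ (coind_map_subproof F).

Lemma coind_map_linear : linear coind_map.
Proof.
move=> z F F'; apply: coind_eq => g; rewrite /= linearD; congr (_ + _).
rewrite /= /coind_scale_fun /cprod_sum linear_sum.
by apply: eq_bigr => k _; rewrite linearZ.
Qed.
HB.instance Definition _ := GRing.isLinear.Build _ _ _ _ coind_map
  coind_map_linear.
End CoinducedMap.

Section CoinducedCoordinate.
Hypothesis hfin : finite_index L.
Variables (M : lmodType (cprod s)) (phi : {linear M -> (cprod s)^o}).
Implicit Types (F : coind c M) (g : G) (l : L).

Definition coord_at F g : cprod s := phi (coind_fun F g).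

Lemma coord_atM F g l : coord_at F (g * val l)%g = cmono s 1 l^-1%g * coord_at F g.
Proof. by rewrite /coord_at coindP linearZ. Qed.

Lemma coord_at1 F g l :
  coord_at F (g * val l)%g 1%g = s l^-1%g (coord_at F g l).
Proof. by rewrite coord_atM cmono_mulE invgK mulg1 mul1r. Qed.

Lemma coind_coord_subproof F :
  (fun x => r x (cext c (coord_at F x 1%g))) \in @Defs.finite_support G A.
Proof.
rewrite unfold_in; apply/asboolP.
apply: (@sub_finite_set _ _ [set` [seq (h * val l)%g | h <- coset_reps L,
  l <- csupp (coord_at F h)]]); last exact: finite_seq.
move=> x /= x0; apply/allpairsPdep; exists (coset_rep L x), (coset_part L x).
split; [exact: coset_rep_mem| |exact: coset_decomp].
rewrite in_csupp; apply: contra x0 => /eqP x0.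
by rewrite {2}(coset_decomp L x) coord_at1 x0 rmorph0 raddf0 rmorph0.
Qed.

(** The coefficient at x lives on the copy x Y and uses only the coefficient of phi (F x) at 1.
    Nothing is lost: by [coord_at1], the one of phi (F (g l)) at 1 is a translate of that of phi (F
    g) at l. *)
Definition coind_coord F : cprod r := Cprod r (coind_coord_subproof F).

Lemma coind_coordE F x : coind_coord F x = r x (cext c (coord_at F x 1%g)).
Proof. by []. Qed.

Lemma coind_coord_linear :
  linear (coind_coord : coind c M -> (cprod r)^o).
Proof.
move=> z F F'; have coordD E E' : coind_coord (E + E') = coind_coord E + coind_coord E'.
  apply: cprodP => x; rewrite cprodD !coind_coordE /coord_at coindD linearD.
  by rewrite cprodD raddfD rmorphD.
rewrite coordD; congr (_ + _); elim/cprod_ind: z => [|z z' IH IH'|a k].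
- rewrite !scale0r; apply: cprodP => x.
  by rewrite coind_coordE /coord_at linear0 cprod0 raddf0 rmorph0.
- by rewrite !scalerDl coordD IH IH'.
apply: cprodP => x; rewrite [RHS]cmono_mulE !coind_coordE /coord_at.
rewrite coind_scale_mono linearZ [X in cext c X]cmono_mulE invg1 mul1g ract1.
by rewrite cext_resM rmorphM ractKV -ractM mulVKg.
Qed.
HB.instance Definition _ := GRing.isLinear.Build _ _ _ _ coind_coord
  coind_coord_linear.

Lemma coind_coord_res F g l :
  cres c (r g^-1%g (coind_coord F (g * val l)%g)) = coord_at F g l.
Proof.
rewrite coind_coordE -ractM mulgA mulVg mul1g cres_act cextK coord_at1.
by rewrite ractKV.
Qed.

(** For e the indicator of a set, right multiplication by it detects membership in a principal left
    ideal on both sides, so that coinduction carries the ideal of a subset of Y to the ideal of its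
    image in X. *)
Lemma coind_coord_idem (e : B) F :
  (forall g, coord_at F g * cmono s e 1%g = coord_at F g) <->
  coind_coord F * cmono r (cext c e) 1%g = coind_coord F.
Proof.
split=> [h|h g]; apply: cprodP => x; rewrite mul_cmonoE invg1 mulg1.
  rewrite coind_coordE -rmorphM -cextM -[in RHS]h mul_cmonoE invg1 mulg1.
  by rewrite ract1.
rewrite -coind_coord_res -{2}h mul_cmonoE invg1 mulg1 !rmorphM.
by rewrite -ractM mulgA mulVg mul1g cres_act cextK.
Qed.

End CoinducedCoordinate.

Section CoordinateLift.
Variable w : cprod r.
Implicit Types (g : G) (l : L).

(** Inverse to [coind_coord]: the part of g^-1 w on L, restricted to Y. *)
Definition coord_lift g : cprod s := slice c 1%g (cmono r 1 g^-1%g * w).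

Lemma coord_liftE g l : coord_lift g l = cres c (r g^-1%g (w (g * val l)%g)).
Proof. by rewrite sliceE invg1 mulg1 cmono_mulE invgK mul1r. Qed.

Lemma coord_liftM g l : coord_lift (g * val l)%g = cmono s 1 l^-1%g * coord_lift g.
Proof.
apply: cprodP => m; rewrite coord_liftE cmono_mulE coord_liftE invgK mul1r.
by rewrite invgM -valVg ractM cres_act valM mulgA.
Qed.

Variable e : B.
Hypothesis we : w * cmono r (cext c e) 1%g = w.

Let wE x : w x * r x (cext c e) = w x.
Proof. by rewrite -{2}we mul_cmonoE invg1 mulg1. Qed.

Lemma coord_lift_idem g : coord_lift g * cmono s e 1%g = coord_lift g.
Proof.
apply: cprodP => l; rewrite mul_cmonoE invg1 mulg1 !coord_liftE.
rewrite -[in RHS]wE !rmorphM.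
by rewrite -ractM mulgA mulVg mul1g cres_act cextK.
Qed.

(** By [we] the coefficient of w at x vanishes off x Y, so restricting its translate by x^-1 to Y
    loses nothing. *)
Lemma coord_liftK x : r x (cext c (coord_lift x 1%g)) = w x.
Proof.
rewrite coord_liftE val1 mulg1 cext_res rmorphM ractKV -[w x]wE -mulrA.
by rewrite -rmorphM -cextM mulr1.
Qed.
End CoordinateLift.

Section CoinducedAugmentation.
Hypothesis hfin : finite_index L.
Hypothesis cext_orth : forall g b, (forall l : L, g <> val l) ->
  cres c (r g (cext c b)) = 0.
Hypothesis cext_part : \sum_(h <- coset_reps L) r h (cext c 1) = 1.

(** By [cext_part] the copies h Y cover X, so restrictions to the copies determine a function on
    X. *)
Lemma cres_separate a a' :
  (forall g, cres c (r g^-1%g a) = cres c (r g^-1%g a')) -> a = a'.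
Proof.
move=> h; rewrite -[a]mulr1 -[a']mulr1 -cext_part !mulr_sumr.
apply: eq_bigr => g _; rewrite -{1}(ractKV r g a) -{1}(ractKV r g a').
by rewrite -!rmorphM -!cext_res h.
Qed.

Variables (M : lmodType (cprod s)) (eta : {linear M -> base_module s}).

(** The functions eta (F h), placed on the copies h Y and glued. By [coind_aug_res] the result is
    independent of the representatives. *)
Definition coind_aug (F : coind c M) : base_module r :=
  \sum_(h <- coset_reps L) r h (cext c (eta (coind_fun F h))).

Lemma eta_coindM (F : coind c M) g (l : L) :
  eta (coind_fun F (g * val l)%g) = s l^-1%g (eta (coind_fun F g)).
Proof. by rewrite coindP linearZ [LHS]base_scale_mono mul1r. Qed.

Lemma coind_aug_res (F : coind c M) g :
  cres c (r g^-1%g (coind_aug F)) = eta (coind_fun F g).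
Proof.
(* Since g^-1 h Y meets Y only for h L = g L, a single term of the sum survives. *)
rewrite /coind_aug !rmorph_sum (bigD1_seq (coset_rep L g))/=;
  [|exact: coset_rep_mem|exact: coset_reps_uniq].
rewrite -ractM big_seq_cond big1 => [|h /andP[hr hg]]; last first.
  rewrite -ractM cext_orth// => l E; case/eqP: hg.
  apply: (fun e => (@coset_decomp_inj _ _ _ hfin h _ 1%g (coset_part L g * l)%g
    hr (coset_rep_mem hfin g) e).1).
  by rewrite val1 mulg1 valM mulgA -coset_decomp -E mulVKg.
rewrite addr0 {1 4}(coset_decomp L g) eta_coindM invgM -mulgA mulVg mulg1.
by rewrite -valVg cres_act cextK.
Qed.

Lemma coind_aug_linear : linear coind_aug.
Proof.
move=> z F F'; have augD E E' : coind_aug (E + E') = coind_aug E + coind_aug E'.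
  rewrite /coind_aug -big_split; apply: eq_bigr => h _.
  by rewrite coindD linearD raddfD rmorphD.
rewrite augD; congr (_ + _); elim/cprod_ind: z => [|z z' IH IH'|a k].
- rewrite !scale0r /coind_aug big1// => h _.
  by rewrite linear0 raddf0 rmorph0.
- by rewrite !scalerDl augD IH IH'.
apply: cres_separate => g; rewrite coind_aug_res coind_scale_mono linearZ.
rewrite [LHS]base_scale_mono ract1 [cmono r a k *: _]base_scale_mono !rmorphM.
by rewrite -ractM -[(g^-1 * k)%g]invgK invgM invgK coind_aug_res.
Qed.

Lemma coind_aug_surj : (forall b, exists x, eta x = b) ->
  forall a, exists F, coind_aug F = a.
Proof.
move=> eta_surj a.
have /choice[m mE] g : exists x, eta x = cres c (r g^-1%g a) by exact: eta_surj.
exists (coind_extend hfin m); apply: cres_separate => g.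
rewrite coind_aug_res /= linearZ [LHS]base_scale_mono mE mul1r.
by rewrite -cres_act -ractM valVg -invgM -coset_decomp.
Qed.

End CoinducedAugmentation.
End Coinduction.
Arguments coind_map {G S L A B r s} c {M N} f F.

(** What the copy of Y has beyond a general compression: by [ic_orth] its translates by elements
    outside L are disjoint from it, and by [ic_part] its translates by the representatives cover X.
    Both are stated for functions modulo null sets. *)
Record induced_compression (R : realType) (G : groupType) (S : pred G)
    (L : subGroupType S) (d d' : measure_display)
    (X : measurableType d) (mu : probability X R)
    (Y : measurableType d') (nu : probability Y R)
    (alpha : pmp_action G mu) (beta : pmp_action L nu) (Z : coeff) :=
  InducedCompression {
  ic_comp :> space_compression alpha beta Z;
  ic_inj : injective (sc_map ic_comp);
  ic_measurable : forall B, measurable B -> measurable (sc_map ic_comp @` B);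
  ic_chi : forall B, measurable B ->
    cext ic_comp (chi nu Z B) = chi mu Z (sc_map ic_comp @` B);
  ic_vol : forall B, measurable B ->
    fine (mu (sc_map ic_comp @` B)) = (subgroup_index L)%:R^-1 * fine (nu B);
  ic_orth : forall g b, (forall l : L, g <> val l) ->
    cres ic_comp (Linfty_action alpha Z g (cext ic_comp b)) = 0;
  ic_part : \sum_(h <- coset_reps L)
    Linfty_action alpha Z h (cext ic_comp 1) = 1
}.

(** * Coinduced marked modules *)

Section MarkedCoinduction.
Variables (R : realType) (G : groupType) (S : pred G) (L : subGroupType S).
Variables (d d' : measure_display).
Variables (X : measurableType d) (mu : probability X R).
Variables (Y : measurableType d') (nu : probability Y R).
Variables (alpha : pmp_action G mu) (beta : pmp_action L nu) (Z : coeff).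
Variable c : induced_compression alpha beta Z.
Hypothesis hfin : finite_index L.

Local Notation reps := (coset_reps L).
Local Notation iota := (sc_map c).

Section CoindModule.
Variable M : marked_module beta Z.

Definition mm_coord (i : mm_idx M) (m : M) : (crossed beta Z)^o := mm_iso M m i.

Lemma mm_coord_linear i : linear (mm_coord i).
Proof. by move=> a m n; rewrite /mm_coord linearP !ffunE. Qed.
HB.instance Definition _ i := GRing.isLinear.Build _ _ _ _ (mm_coord i)
  (mm_coord_linear i).

Definition coind_iso (F : coind c M) : {ffun mm_idx M -> (crossed alpha Z)^o} :=
  [ffun i => coind_coord hfin (mm_coord i) F].

Lemma coind_iso_linear : linear coind_iso.
Proof. by move=> a m n; apply/ffunP => i; rewrite !ffunE linearP. Qed.
HB.instance Definition _ := GRing.isLinear.Build _ _ _ _ coind_iso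
  coind_iso_linear.

Lemma coind_iso_inj : injective coind_iso.
Proof.
move=> F F' FF'; apply: coind_eq => g.
apply: (@mm_inj _ _ _ _ _ _ _ M); apply/ffunP => i; apply: cprodP => l.
rewrite -[LHS](coind_coord_res hfin (mm_coord i)).
rewrite -[RHS](coind_coord_res hfin (mm_coord i)).
by have /ffunP/(_ i) := FF'; rewrite !ffunE => ->.
Qed.

Lemma coind_iso_principal (B : mm_idx M -> set Y) (F : coind c M) :
  (forall i, measurable (B i)) ->
  (forall i, principal (iota @` B i) (coind_iso F i)) <->
  (forall g i, principal (B i) (mm_iso M (coind_fun F g) i)).
Proof.
move=> mB; split=> [h g i|h i].
  apply/principal_chi1 => //; apply: (coind_coord_idem hfin (mm_coord i) _ F).2.
  have /(principal_chi1 _ (ic_measurable c (mB i))) := h i.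
  by rewrite ffunE ic_chi.
apply/principal_chi1; first exact: ic_measurable.
rewrite ffunE /chi1 -ic_chi//.
apply/(coind_coord_idem hfin (mm_coord i)) => g.
exact: ((principal_chi1 _ (mB i)).1 (h g i)).
Qed.

Lemma coind_img (z : {ffun mm_idx M -> (crossed alpha Z)^o}) :
  (exists F, coind_iso F = z) <->
  (forall i, principal (iota @` mm_set i) (z i)).
Proof.
split=> [[F <-]|h].
  apply/coind_iso_principal; first exact: mm_measurable.
  by move=> g; apply/mm_img; exists (coind_fun F g).
have zE i : (z i : crossed alpha Z) *
    cmono (Linfty_action alpha Z) (cext c (chi nu Z (mm_set i))) 1%g = z i.
  rewrite ic_chi; last exact: mm_measurable.
  by apply/principal_chi1; [exact/ic_measurable/mm_measurable|exact: h].
have /choice[F FE] g : exists m : M,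
    mm_iso M m = [ffun i => coord_lift c (z i) g].
  apply/mm_img => i; rewrite ffunE; apply/principal_chi1.
    exact: mm_measurable.
  exact: coord_lift_idem (zE i) g.
have FP : F \in @coind_pred G S L _ (Linfty_action beta Z) M.
  rewrite unfold_in; apply/asboolP => g l.
  apply: (@mm_inj _ _ _ _ _ _ _ M); apply/ffunP => i.
  by rewrite linearZ !FE !ffunE; exact: coord_liftM.
exists (Coind c FP); apply/ffunP => i; rewrite ffunE; apply: cprodP => x.
rewrite coind_coordE /coord_at /= /mm_coord FE ffunE.
exact: coord_liftK (zE i) x.
Qed.

Definition coind_module : marked_module alpha Z :=
  @MarkedModule R G d X mu alpha Z (coind c M) (mm_idx M)
    (fun i => iota @` mm_set i)
    (fun i => ic_measurable c (mm_measurable i))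
    coind_iso coind_iso_inj coind_img.

(** Up to translations, which preserve the norm, the coefficient at h l is the extension by 0 of the
    coefficient of F h at l; the extension contributes the factor [sc_scale]. *)
Lemma coind_norm (F : coind_module) :
  mm_norm1 F = sc_scale c * \sum_(h <- reps) mm_norm1 (coind_fun F h : M).
Proof.
rewrite /mm_norm1 exchange_big mulr_sumr; apply: eq_bigr => i _ /=.
rewrite ffunE; set w := coind_coord _ _ _.
have wE (h : G) (l : L) : Linfty_norm1 (w (h * val l)%g) =
    sc_scale c * Linfty_norm1 (coord_at (mm_coord i) F h l).
  rewrite coind_coordE Linfty_norm1_translate sc_norm coord_at1.
  by rewrite Linfty_norm1_translate.
rewrite /crossed_norm1 (@sum_cosets _ _ L _ hfin (fun x => Linfty_norm1 (w x)) _
  (fun h => csupp (coord_at (mm_coord i) F h))) ?fset_uniq//.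
- rewrite mulr_sumr; apply: eq_bigr => h _; rewrite mulr_sumr.
  by apply: eq_bigr => l _; rewrite wE.
- by move=> x /csupp_notin xw; rewrite xw Linfty_norm10.
- by move=> h; exact: fset_uniq.
by move=> h l _ /csupp_notin ln; rewrite wE ln Linfty_norm10 mulr0.
Qed.

Lemma coind_set_sum (B : mm_idx M -> set Y) : (forall i, measurable (B i)) ->
  \sum_i fine (mu (iota @` B i)) =
  (subgroup_index L)%:R^-1 * \sum_i fine (nu (B i)).
Proof.
by move=> mB; rewrite mulr_sumr; apply: eq_bigr => i _; rewrite ic_vol.
Qed.

Lemma coind_dim : mm_dim coind_module = (subgroup_index L)%:R^-1 * mm_dim M.
Proof. exact: (coind_set_sum (@mm_measurable _ _ _ _ _ _ _ M)). Qed.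

Definition coind_summand (B : marked_summand M) : marked_summand coind_module :=
  @MarkedSummand _ _ _ _ _ _ _ coind_module (fun i => iota @` B i)
    (fun i => ic_measurable c (ms_measurable B i))
    (fun i => @image_subset _ _ iota _ _ (@ms_sub _ _ _ _ _ _ _ M B i)).

Lemma coind_summand_dim (B : marked_summand M) :
  mm_dim (summand_module (coind_summand B)) =
  (subgroup_index L)%:R^-1 * mm_dim (summand_module B).
Proof. exact: (coind_set_sum (@ms_measurable _ _ _ _ _ _ _ M B)). Qed.

Lemma in_coind_summand (B : marked_summand M) (F : coind_module) :
  F \in in_summand (coind_summand B) <->
  forall g, coind_fun F g \in in_summand B.
Proof.
have H := @coind_iso_principal B F (@ms_measurable _ _ _ _ _ _ _ M B).
rewrite unfold_in; split=> [/asboolP h g|h].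
  by rewrite unfold_in; apply/asboolP; exact: H.1 h g.
by apply/asboolP/H => g; have := h g; rewrite unfold_in => /asboolP.
Qed.

Lemma coind_decomposition p (M_ : 'I_p -> marked_summand M) :
  marked_decomposition M_ ->
  marked_decomposition (fun k => coind_summand (M_ k)).
Proof.
move=> dM i /=; have [MU MI] := dM i; split.
  by rewrite -image_bigcup MU.
apply/trivIsetP => j j' _ _ jj'; rewrite -subset0 => x [[y Mj <-] [y' Mj']].
move=> /ic_inj E; rewrite E in Mj'.
have /trivIsetP/(_ j j' I I jj') MI0 := MI.
have : (M_ j i `&` M_ j' i) y by split.
by rewrite MI0.
Qed.

End CoindModule.

Section CoindMarkedMap.
Variables (M N : marked_module beta Z) (f : {linear M -> N}).

Definition coind_mmap : {linear coind_module M -> coind_module N} :=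
  coind_map c f.

Lemma coind_lognorm :
  lognorm coind_mmap <= (subgroup_index L)%:R^-1 * lognorm f.
Proof.
have i0 : 0 < (subgroup_index L)%:R^-1 :> R.
  by rewrite invr_gt0 ltr0n subgroup_index_gt0.
apply: lognorm_le => // p M_ dM.
exists (fun k => coind_summand (M_ k)); split; first exact: coind_decomposition.
move=> k; apply: lognorm'_le => //.
- by rewrite coind_summand_dim.
- apply: opnorm_le => a a0 h [F FB].
  have FB' := (in_coind_summand (M_ k) F).1 FB.
  have -> : mm_norm1 (SummandMod FB : summand_module (coind_summand (M_ k))) =
            mm_norm1 (F : coind_module M) by [].
  rewrite -[restrict_summand _ _ _]/(coind_mmap F) !coind_norm mulrCA.
  (* After the common factor is cancelled, the bound for f is applied to each value of F at a
     representative. *)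
  rewrite ler_pM2l ?sc_scale_gt0// mulr_sumr; apply: ler_sum => g _.
  exact: h (SummandMod (FB' g)).
apply: rk_le => // N1 fN1; exists (coind_summand N1).
rewrite coind_summand_dim; split=> // -[F FB].
have FB' := (in_coind_summand (M_ k) F).1 FB.
apply/in_coind_summand => g.
exact: fN1 (SummandMod (FB' g)).
Qed.
End CoindMarkedMap.
End MarkedCoinduction.

(** * Coinduced complexes and their embeddings *)

Lemma corner_proj_cemb (G : groupType) (S : pred G) (L : subGroupType S)
    (A B : comNzRingType) (r : ring_action G A) (s : ring_action L B)
    (c : compression r s) (M : lmodType (cprod r)) a (m : M) :
  corner_proj c (cemb c a *: m) = a *: corner_proj c m.
Proof. by apply: val_inj; rewrite /= !scalerA -!cembM mulr1 mul1r. Qed.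

Lemma corner_projD (G : groupType) (S : pred G) (L : subGroupType S)
    (A B : comNzRingType) (r : ring_action G A) (s : ring_action L B)
    (c : compression r s) (M : lmodType (cprod r)) (m n : M) :
  corner_proj c (m + n) = corner_proj c m + corner_proj c n.
Proof. by apply: val_inj; rewrite /= scalerDr. Qed.

Section CoindComplex.
Variables (R : realType) (G : groupType) (S : pred G) (L : subGroupType S).
Variables (d d' : measure_display).
Variables (X : measurableType d) (mu : probability X R).
Variables (Y : measurableType d') (nu : probability Y R).
Variables (alpha : pmp_action G mu) (beta : pmp_action L nu) (Z : coeff).
Variable c : induced_compression alpha beta Z.
Hypothesis hfin : finite_index L.
Local Notation triv := (trivial_compression Z L).
Local Notation tG := (trivial_action Z G).
Local Notation tL := (trivial_action Z L).

Lemma incl_mono (H : groupType) (e : measure_display) (W : measurableType e)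
    (P : probability W R) (gamma : pmp_action H P) z x :
  group_ring_incl gamma (cmono (trivial_action Z H) z x) =
  cmono (Linfty_action gamma Z) (Linfty_const P z) x.
Proof. exact: cprod_map_mono. Qed.

Lemma act_const (H : groupType) (e : measure_display) (W : measurableType e)
    (P : probability W R) (gamma : pmp_action H P) h (z : Z) :
  Linfty_action gamma Z h (Linfty_const P z) = Linfty_const P z.
Proof. exact: esym (Linfty_const_equiv gamma h z). Qed.

Section Complex.
Variable D : augmented_complex beta Z.

Lemma coind_bdK k (F : coind_module c hfin (D k.+2)) :
  coind_mmap c hfin (ac_bd D k) (coind_mmap c hfin (ac_bd D k.+1) F) = 0.
Proof. by apply: coind_eq => g; exact: ac_bdK. Qed.

Definition coind_caug :
    {linear coind_module c hfin (D 0%N) -> Linfty_module alpha Z} :=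
  HB.pack_for
    {linear coind_module c hfin (D 0%N) -> Linfty_module alpha Z}
    (coind_aug (c := c) (ac_aug D))
    (GRing.isLinear.Build _ _ _ _ _
      (coind_aug_linear hfin (@ic_orth _ _ _ _ _ _ _ _ _ _ _ _ _ c)
        (ic_part c) (ac_aug D))).

Lemma coind_aug_bd (F : coind_module c hfin (D 1%N)) :
  coind_caug (coind_mmap c hfin (ac_bd D 0%N) F) = 0.
Proof.
change (coind_aug (ac_aug D) (coind_map c (ac_bd D 0%N) F) = 0).
by rewrite /coind_aug big1// => h _; rewrite /= ac_aug_bd raddf0 rmorph0.
Qed.

Lemma coind_caug_surj (u : Linfty_module alpha Z) : exists F, coind_caug F = u.
Proof.
exact: (coind_aug_surj hfin (@ic_orth _ _ _ _ _ _ _ _ _ _ _ _ _ c)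
  (ic_part c) (@ac_aug_surj _ _ _ _ _ _ _ D) u).
Qed.

Definition coind_complex : augmented_complex alpha Z :=
  @AugmentedComplex R G d X mu alpha Z (fun k => coind_module c hfin (D k))
    (fun k => coind_mmap c hfin (ac_bd D k)) coind_bdK coind_caug
    coind_caug_surj coind_aug_bd.

Variables (CG : free_resolution Z G) (CL : free_resolution Z L) (n : nat).

Section ChainMap.
Variable f : forall k, {linear CL k -> D k | group_ring_incl beta (Z:=Z) \; *:%R}.
Variable g : forall k, {linear restrict_resolution L CG k -> CL k}.

Let move k (x : G) (m : CG k) : CG k := (cmono tG 1 x : group_ring Z G) *: m.

Lemma coind_chain_subproof k (m : CG k) :
  (fun x => f k (g k (corner_proj triv (move x^-1%g m)))) \in
    @coind_pred G S L _ (Linfty_action beta Z) (D k).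
Proof.
rewrite unfold_in; apply/asboolP => x l.
have -> : move (x * val l)^-1%g m =
    cemb triv (cmono tL 1 l^-1%g) *: move x^-1%g m.
  rewrite cemb_mono /move scalerA [X in _ = X *: _]cmonoM rmorph1 mulr1.
  by rewrite invgM -valVg.
rewrite corner_proj_cemb linearZ linearZ /=.
by rewrite incl_mono rmorph1.
Qed.

(** As e = 1 for the trivial compression, [corner_proj] merely regards an element of CG as one of
    the restricted resolution, where the comparison g applies. *)
Definition coind_chain k (m : CG k) : coind c (D k) :=
  Coind c (coind_chain_subproof m).

Lemma coind_chain_linear k :
  linear_for (group_ring_incl alpha (Z:=Z) \; *:%R) (@coind_chain k).
Proof.
have chainD (m m' : CG k) : coind_chain (m + m') = coind_chain m + coind_chain m'.
  apply: coind_eq => x.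
  by rewrite coindD /= /move scalerDr corner_projD !linearD.
move=> a m m'; rewrite chainD; congr (_ + _).
elim/cprod_ind: a => [|a a' IH IH'|z k'].
- by rewrite scale0r /= raddf0 scale0r; apply: coind_eq => x;
    rewrite /= /move scaler0 (_ : corner_proj _ 0 = 0) ?linear0//;
    apply: val_inj; rewrite /= scaler0.
- by rewrite scalerDl chainD IH IH' /= raddfD scalerDl.
apply: coind_eq => x; rewrite /= incl_mono coind_scale_fun_mono act_const.
rewrite [cres c _](sc_const c z).
have -> : move x^-1%g ((cmono tG z k' : group_ring Z G) *: m) =
    cemb triv (cmono tL z 1%g) *: move (k'^-1 * x)^-1%g m.
  rewrite cemb_mono /move !scalerA [X in X *: _ = _]cmonoM.
  rewrite [X in _ = X *: _]cmonoM val1 mul1g invgM invgK.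
  by rewrite !(mul1r, mulr1).
by rewrite corner_proj_cemb linearZ linearZ /= incl_mono.
Qed.

End ChainMap.

Lemma coind_embeddable : embeddable CL n D -> embeddable CG n coind_complex.
Proof.
move=> [f [f0 fS]]; have [g [g0 gS]] := comparison_from_restriction CG CL hfin.
exists (fun k => HB.pack_for
  {linear CG k -> coind_complex k | group_ring_incl alpha (Z:=Z) \; *:%R}
  (coind_chain f g (k := k))
  (GRing.isLinear.Build _ _ _ _ _ (coind_chain_linear f g (k := k)))).
split=> [m|k kn m].
  change (coind_aug (c := c) (ac_aug D) (coind_chain f g m) =
    Linfty_const mu (res_aug CG m)).
  (* Two functions on X are compared on every copy x Y, where both are the same constant. *)
  apply: (cres_separate (ic_part c)) => x.
  rewrite (coind_aug_res hfin (@ic_orth _ _ _ _ _ _ _ _ _ _ _ _ _ c)).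
  rewrite act_const [RHS](sc_const c) /= f0 g0; congr Linfty_const.
  (* The augmentation of CG is invariant under G, which acts trivially on Z. *)
  have E : res_aug CG (cemb triv 1 *: ((cmono tG 1 x^-1%g : group_ring Z G) *: m)) =
      res_aug CG m.
    rewrite cemb1 scalerA [X in X *: _]cmonoM linearZ [LHS]base_scale_mono.
    by rewrite !mul1r.
  exact: E.
apply: coind_eq => x.
change (ac_bd D k (coind_fun (coind_chain f g m) x) =
  coind_fun (coind_chain f g (res_bd CG k m)) x).
rewrite /= fS// gS; congr (f k (g k _)); apply: val_inj.
change (res_bd CG k (cemb triv 1 *: ((cmono tG 1 x^-1%g : group_ring Z G) *: m)) =
  cemb triv 1 *: ((cmono tG 1 x^-1%g : group_ring Z G) *: res_bd CG k m)).
by rewrite !linearZ.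
Qed.

End Complex.
End CoindComplex.

Lemma medim_induced (R : realType) (G : groupType) (S : pred G)
    (L : subGroupType S) (d d' : measure_display)
    (X : measurableType d) (mu : probability X R)
    (Y : measurableType d') (nu : probability Y R)
    (alpha : pmp_action G mu) (beta : pmp_action L nu) (Z : coeff)
    (c : induced_compression alpha beta Z) (n : nat)
    (CG : free_resolution Z G) (CL : free_resolution Z L) : finite_index L ->
  (medim alpha CG n <= (subgroup_index L)%:R^-1%:E * medim beta CL n)%E.
Proof.
move=> hfin; apply: ereal_inf_scale_le.
  by rewrite invr_gt0 ltr0n subgroup_index_gt0.
move=> _ [D [hD ->]]; apply: ereal_inf_lbound.
exists (coind_complex c hfin D); split; first exact: coind_embeddable hD.
by rewrite -EFinM; congr EFin; rewrite -(coind_dim c hfin).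
Qed.

Lemma mevol_induced (R : realType) (G : groupType) (S : pred G)
    (L : subGroupType S) (d d' : measure_display)
    (X : measurableType d) (mu : probability X R)
    (Y : measurableType d') (nu : probability Y R)
    (alpha : pmp_action G mu) (beta : pmp_action L nu)
    (c : induced_compression alpha beta CoeffInt) (n : nat)
    (CG : free_resolution CoeffInt G) (CL : free_resolution CoeffInt L) :
  finite_index L ->
  (mevol alpha CG n <= (subgroup_index L)%:R^-1%:E * mevol beta CL n)%E.
Proof.
move=> hfin; apply: ereal_inf_scale_le.
  by rewrite invr_gt0 ltr0n subgroup_index_gt0.
move=> _ [D [hD ->]].
apply: (@le_trans _ _ (lognorm (ac_bd (coind_complex c hfin D) n))%:E).
  apply: ereal_inf_lbound; exists (coind_complex c hfin D).
  by split; first exact: coind_embeddable hD.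
by rewrite -EFinM lee_fin; exact: coind_lognorm.
Qed.

(** * Restricted and induced actions *)

Section RestrictCompression.
Variables (R : realType) (G : groupType) (S : pred G) (L : subGroupType S).
Variables (d : measure_display) (X : measurableType d) (mu : probability X R).
Variables (alpha : pmp_action G mu) (Z : coeff).

Lemma Linfty_restrict_act (l : L) (u : Linfty mu Z) :
  Linfty_action alpha Z (val l) u = Linfty_action (restrict_action L alpha) Z l u.
Proof.
rewrite -(Linfty_reprK u) [LHS]Linfty_translate_class.
rewrite [RHS]Linfty_translate_class; congr Linfty_class; apply: val_inj.
by apply/funext => x /=; rewrite valVg.
Qed.

Definition restrict_compression :
    compression (Linfty_action alpha Z)
      (Linfty_action (restrict_action L alpha) Z) :=
  @Compression G S L (Linfty mu Z) (Linfty mu Z) (Linfty_action alpha Z)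
    (Linfty_action (restrict_action L alpha) Z) idfun idfun
    (fun=> erefl) (fun _ _ => erefl) Linfty_restrict_act
    (fun l b => esym (Linfty_restrict_act l b)).

Lemma restrict_vol (A : set X) : measurable A ->
  \sum_(h <- coset_reps L) fine (mu (id @^-1` (alpha h @^-1` A))) =
  (subgroup_index L)%:R * fine (mu A).
Proof.
move=> mA; rewrite (eq_bigr (fun=> fine (mu A))).
  by rewrite big_const_seq count_predT iter_addr addr0 size_coset_reps mulr_natl.
by move=> h _; rewrite pmp_preserving.
Qed.

Definition restrict_space_compression :
    space_compression alpha (restrict_action L alpha) Z :=
  @SpaceCompression R G S L d d X mu X mu alpha (restrict_action L alpha) Z
    restrict_compression id (fun A mA => mA) (fun A mA => erefl) (fun=> erefl)
    1 ltr01 (fun v => esym (mul1r _)) restrict_vol.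

End RestrictCompression.

(** * The copy of Y in the induced space *)

Section Induced.
Variables (R : realType) (G : groupType) (S : pred G) (L : subGroupType S).
Variables (d : measure_display) (Y : measurableType d) (nu : probability Y R).
Variables (beta : pmp_action L nu) (hfin : finite_index L) (Z : coeff).

Local Notation X := (ind_space beta).
Local Notation mu := (ind_probability beta hfin).
Local Notation alpha := (ind_action beta hfin).
Local Notation cls := (ind_class beta).
Local Notation iota := (ind_class beta 1%g).
Local Notation idx := (subgroup_index L).

Lemma ind_class_val (l : L) y : cls (val l) y = iota (beta l y).
Proof. by rewrite -[val l]mul1g ind_class_act. Qed.

Lemma ind_class_range g y z : cls g y = iota z -> exists l : L, g = val l.
Proof. by move=> /ind_classP/asboolP[l /= [-> _]]; exists l; rewrite mul1g. Qed.

Lemma ind_class_inj g : injective (cls g).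
Proof.
move=> y z /ind_classP/asboolP[l /= [gl ->]].
have -> : l = 1%g by apply: val_inj; apply: (mulgI g); rewrite -gl val1 mulg1.
by rewrite pmp_act1.
Qed.

Lemma ind_class_reps (q : X) : exists h y, h \in coset_reps L /\ q = cls h y.
Proof.
rewrite -(ind_class_repr q) (coset_decomp L (repr q).1).
exists (coset_rep L (repr q).1), (beta (coset_part L (repr q).1) (repr q).2).
by split; [exact: coset_rep_mem|rewrite ind_class_act].
Qed.

(** All terms of the nonnegative sum defining mu A vanish, and the measure of the preimage depends
    only on the coset of g. *)
Lemma ind_class_preimage_null (A : set X) g : measurable A ->
  mu A = 0%E -> nu (cls g @^-1` A) = 0%E.
Proof.
move=> mA /eqP; rewrite [mu A]/(@ind_measure _ _ _ L _ _ _ beta A).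
rewrite /ind_measure mule_eq0.
have i0 : (idx%:R^-1 : R) != 0.
  by rewrite invr_eq0 pnatr_eq0 -lt0n subgroup_index_gt0.
rewrite eqe (negPf i0) /= => s0.
rewrite (coset_decomp L g) ind_class_measure//.
move: s0; rewrite (bigD1_seq (coset_rep L g))/= ?coset_rep_mem ?coset_reps_uniq//.
by rewrite padde_eq0 ?measure_ge0 ?sume_ge0// => /andP[/eqP].
Qed.

Lemma ind_ae_class (P : X -> Prop) g :
  {ae mu, forall q, P q} -> {ae nu, forall y, P (cls g y)}.
Proof.
move=> [A [mA A0 sA]]; exists (cls g @^-1` A); split.
- exact: mA.
- exact: ind_class_preimage_null.
- by move=> y /= Py; apply: sA.
Qed.

Lemma ind_measure_null (A : set X) :
  (forall h, h \in coset_reps L -> nu (cls h @^-1` A) = 0%E) -> mu A = 0%E.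
Proof.
move=> A0; rewrite [LHS]/(@ind_measure _ _ _ L _ _ _ beta A) /ind_measure.
by rewrite big_seq big1 ?mule0.
Qed.

Lemma ind_ae (P : X -> Prop) :
  (forall h, {ae nu, forall y, P (cls h y)}) -> {ae mu, forall q, P q}.
Proof.
move=> Pae; have /choice[N NP] h : exists N : set Y,
    [/\ measurable N, nu N = 0%E & (~` [set y | P (cls h y)]) `<=` N].
  by have [N [? ? ?]] := Pae h; exists N.
(* With h restricted to representatives the pair (h, y) is determined by its class, so that A has
   preimage N h in the copy of h. The preimages for other g are translates of these by L. *)
pose A : set X := [set q | exists h y, [/\ h \in coset_reps L, q = cls h y & N h y]].
have AE h : h \in coset_reps L -> cls h @^-1` A = N h.
  move=> hr; apply/seteqP; split=> y /=; last by exists h, y.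
  move=> [k [z [kr /ind_classP/asboolP[l /= [hkl ->]] Nz]]].
  have := @coset_decomp_inj _ _ _ hfin h k 1%g l hr kr.
  rewrite val1 mulg1 => /(_ hkl)[hk l1].
  by move: Nz; rewrite -l1 hk pmp_act1.
have mA : measurable A.
  move=> g; rewrite (coset_decomp L g).
  have -> : cls (coset_rep L g * val (coset_part L g))%g @^-1` A =
      beta (coset_part L g) @^-1` (cls (coset_rep L g) @^-1` A).
    by apply/seteqP; split=> y; rewrite /= ind_class_act.
  rewrite AE; last exact: coset_rep_mem.
  rewrite -[X in measurable X]setTI; apply: pmp_measurable => //.
  by case: (NP (coset_rep L g)).
exists A; split=> //.
  by apply: ind_measure_null => h hr; rewrite AE//; case: (NP h).
move=> q /= nPq; have [h [y [hr qE]]] := ind_class_reps q.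
exists h, y; split=> //; case: (NP h) => _ _; apply.
by rewrite /= -qE.
Qed.

Section Pull.
Variable f : Defs.bounded_fun mu Z.

Lemma ind_pull_subproof : (fun y => f (iota y)) \in bounded_measurable nu Z.
Proof.
rewrite unfold_in; apply/asboolP; split.
  by move=> B; exact: (bounded_fun_preimage f B).
have [M _ fM] := bounded_fun_bound f; exists M.
exact: (ind_ae_class 1%g fM).
Qed.

Definition ind_pull : Defs.bounded_fun nu Z := BoundedFun ind_pull_subproof.
End Pull.

Definition ind_section (q : X) : Y := xget point [set y | iota y = q].

Lemma ind_sectionK : cancel iota ind_section.
Proof.
move=> y; apply: (@ind_class_inj 1%g).
by apply: (@xgetPex _ point [set z | iota z = iota y]); exists y.
Qed.

Definition ind_extfun (b : Y -> Z) (q : X) : Z :=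
  if `[< range iota q >] then b (ind_section q) else 0.

Lemma ind_extfun_iota b y : ind_extfun b (iota y) = b y.
Proof. by rewrite /ind_extfun asboolT ?ind_sectionK//; exists y. Qed.

Lemma ind_extfun_val b (l : L) y : ind_extfun b (cls (val l) y) = b (beta l y).
Proof. by rewrite ind_class_val ind_extfun_iota. Qed.

Lemma ind_extfun_out b g y : (forall l : L, g <> val l) ->
  ind_extfun b (cls g y) = 0.
Proof.
move=> gL; rewrite /ind_extfun asboolF// => -[z _ /esym/ind_class_range[l]].
exact: gL.
Qed.

(** A class [g, y] lies in the copy of Y exactly when g lies in L. This reduces the identities for
    extensions by 0 to two cases. *)
Lemma ind_extfun_eq b (F : X -> Z) :
  (forall (l : L) y, F (cls (val l) y) = b (beta l y)) ->
  (forall g y, (forall l : L, g <> val l) -> F (cls g y) = 0) ->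
  ind_extfun b = F.
Proof.
move=> F1 F2; apply/funext => q; have [h [y [_ ->]]] := ind_class_reps q.
have [[l ->]|hl] := pselect (exists l : L, h = val l).
  by rewrite ind_extfun_val F1.
have hl' (l : L) : h <> val l by move=> E; apply: hl; exists l.
by rewrite ind_extfun_out// F2.
Qed.

Section Ext.
Variable b : Defs.bounded_fun nu Z.

Lemma ind_ext_subproof : ind_extfun b \in bounded_measurable mu Z.
Proof.
rewrite unfold_in; apply/asboolP; split.
  move=> B; suff : ind_measurable (ind_extfun b @^-1` B) by [].
  move=> g; have [[l ->]|gl] := pselect (exists l : L, g = val l).
    rewrite (_ : _ @^-1` _ = beta l @^-1` (b @^-1` B)); last first.
      by apply/seteqP; split=> y /=; rewrite ind_extfun_val.
    rewrite -[X in measurable X]setTI; apply: pmp_measurable => //.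
    exact: (bounded_fun_preimage b B).
  have gl' (l : L) : g <> val l by move=> E; apply: gl; exists l.
  have [B0|B0] := pselect (B 0).
    rewrite (_ : _ @^-1` _ = setT)//; apply/seteqP; split=> y //= _.
    by rewrite ind_extfun_out.
  rewrite (_ : _ @^-1` _ = set0)//; apply/seteqP; split=> y //=.
  by rewrite ind_extfun_out.
have [M M0 bM] := bounded_fun_bound b; exists M; apply: ind_ae => h.
have [[l ->]|hl] := pselect (exists l : L, h = val l).
  have := pmp_ae beta l bM; apply: filterS => y.
  by rewrite ind_extfun_val.
apply: aeW => y; rewrite ind_extfun_out ?coeff_norm0// => l E.
by apply: hl; exists l.
Qed.

Definition ind_ext : Defs.bounded_fun mu Z := BoundedFun ind_ext_subproof.
End Ext.

Definition ind_res (u : Linfty mu Z) : Linfty nu Z :=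
  Linfty_class (ind_pull (Linfty_repr u)).

Definition ind_extend (v : Linfty nu Z) : Linfty mu Z :=
  Linfty_class (ind_ext (Linfty_repr v)).

Lemma ind_res_class f : ind_res (Linfty_class f) = Linfty_class (ind_pull f).
Proof.
apply/Linfty_classP.
exact: (@ind_ae_class (fun q => Linfty_repr (Linfty_class f) q = f q) 1%g
  (Linfty_class_repr f)).
Qed.

Lemma ind_extend_class b : ind_extend (Linfty_class b) = Linfty_class (ind_ext b).
Proof.
apply/Linfty_classP; apply: ind_ae => h.
have [[l ->]|hl] := pselect (exists l : L, h = val l).
  have := pmp_ae beta l (Linfty_class_repr b); apply: filterS => y.
  by rewrite /= !ind_extfun_val.
by apply: aeW => y; rewrite /= !ind_extfun_out// => l E; apply: hl; exists l.
Qed.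

Lemma ind_res_nmod_morphism : nmod_morphism ind_res.
Proof.
split=> [|u v].
  rewrite -Linfty_class0 ind_res_class -Linfty_class0; congr Linfty_class.
  exact/val_inj.
rewrite -(Linfty_reprK u) -(Linfty_reprK v) -Linfty_classD.
by rewrite !ind_res_class -Linfty_classD; congr Linfty_class; apply/val_inj.
Qed.

Lemma ind_res_monoid_morphism : monoid_morphism ind_res.
Proof.
split=> [|u v].
  rewrite -Linfty_class1 ind_res_class -Linfty_class1; congr Linfty_class.
  exact/val_inj.
rewrite -(Linfty_reprK u) -(Linfty_reprK v) -Linfty_classM.
by rewrite !ind_res_class -Linfty_classM; congr Linfty_class; apply/val_inj.
Qed.
HB.instance Definition _ := GRing.isNmodMorphism.Build _ _ ind_res
  ind_res_nmod_morphism.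
HB.instance Definition _ := GRing.isMonoidMorphism.Build _ _ ind_res
  ind_res_monoid_morphism.

Lemma ind_extend_nmod_morphism : nmod_morphism ind_extend.
Proof.
split=> [|u v].
  rewrite -Linfty_class0 ind_extend_class -Linfty_class0; congr Linfty_class.
  by apply/val_inj; apply: ind_extfun_eq.
rewrite -(Linfty_reprK u) -(Linfty_reprK v) -Linfty_classD.
rewrite !ind_extend_class -Linfty_classD; congr Linfty_class.
apply/val_inj; apply: ind_extfun_eq => [l y|g y gL].
  by rewrite /= addrfctE !ind_extfun_val.
by rewrite /= addrfctE !ind_extfun_out// addr0.
Qed.
HB.instance Definition _ := GRing.isNmodMorphism.Build _ _ ind_extend
  ind_extend_nmod_morphism.

Lemma ind_extendK v : ind_res (ind_extend v) = v.
Proof.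
rewrite -(Linfty_reprK v) ind_extend_class ind_res_class; congr Linfty_class.
by apply/val_inj/funext => y; rewrite /= ind_extfun_iota.
Qed.

Lemma ind_extend_resM u v : ind_extend (ind_res u * v) = u * ind_extend v.
Proof.
rewrite -(Linfty_reprK u) -(Linfty_reprK v) ind_res_class -Linfty_classM.
rewrite !ind_extend_class -Linfty_classM; congr Linfty_class.
apply/val_inj; apply: ind_extfun_eq => [l y|g y gL] /=.
  by rewrite ind_class_val mulrfctE ind_extfun_iota.
by rewrite mulrfctE ind_extfun_out// mulr0.
Qed.

Lemma ind_res_act (l : L) u :
  ind_res (Linfty_action alpha Z (val l) u) = Linfty_action beta Z l (ind_res u).
Proof.
rewrite -(Linfty_reprK u) [Linfty_action alpha _ _ _]Linfty_translate_class.
rewrite !ind_res_class [RHS]Linfty_translate_class; congr Linfty_class.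
apply/val_inj/funext => y /=.
by rewrite ind_act_class mulg1 -valVg ind_class_val.
Qed.

Lemma ind_extend_act (l : L) v :
  ind_extend (Linfty_action beta Z l v) = Linfty_action alpha Z (val l) (ind_extend v).
Proof.
rewrite -(Linfty_reprK v) [Linfty_action beta _ _ _]Linfty_translate_class.
rewrite !ind_extend_class [RHS]Linfty_translate_class; congr Linfty_class.
apply/val_inj; apply: ind_extfun_eq => [m y|g y gL] /=.
  by rewrite ind_act_class -valVg -valM ind_extfun_val pmp_actM.
rewrite ind_act_class ind_extfun_out// => m E; apply: (gL (l * m)%g).
by rewrite valM -E mulVKg.
Qed.

Definition ind_compression :
    compression (Linfty_action alpha Z) (Linfty_action beta Z) :=
  @Compression G S L (Linfty mu Z) (Linfty nu Z) (Linfty_action alpha Z)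
    (Linfty_action beta Z) ind_res ind_extend ind_extendK ind_extend_resM
    ind_res_act ind_extend_act.
End Induced.

Section InducedCompression.
Variables (R : realType) (G : groupType) (S : pred G) (L : subGroupType S).
Variables (d : measure_display) (Y : measurableType d) (nu : probability Y R).
Variables (beta : pmp_action L nu) (hfin : finite_index L) (Z : coeff).

Local Notation X := (ind_space beta).
Local Notation mu := (ind_probability beta hfin).
Local Notation alpha := (ind_action beta hfin).
Local Notation cls := (ind_class beta).
Local Notation iota := (ind_class beta 1%g).
Local Notation idx := (subgroup_index L).
Local Notation ind_compression := (ind_compression beta hfin Z).

Lemma ind_measurable_preimage g (A : set X) :
  measurable A -> measurable (cls g @^-1` A).
Proof. by move=> mA; exact: mA. Qed.

Lemma ind_image_val (B : set Y) (l : L) :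
  cls (val l) @^-1` (iota @` B) = beta l @^-1` B.
Proof.
apply/seteqP; split=> y; rewrite /= ind_class_val.
  by move=> [z Bz /(ind_class_inj (g := 1%g)) <-].
by move=> By; exists (beta l y).
Qed.

Lemma ind_image_out (A : set X) g : A `<=` range iota ->
  (forall l : L, g <> val l) -> cls g @^-1` A = set0.
Proof.
move=> AY gL; rewrite -subset0 => y /AY[z _ /esym/ind_class_range[l]].
exact: gL.
Qed.

Lemma ind_image_measurable (B : set Y) : measurable B -> measurable (iota @` B).
Proof.
move=> mB; suff : @ind_measurable _ _ _ L _ _ _ beta (iota @` B) by [].
move=> g; have [[l ->]|gl] := pselect (exists l : L, g = val l).
  by rewrite ind_image_val -[X in measurable X]setTI; exact: pmp_measurable.
rewrite ind_image_out//; first by apply: image_subset.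
by move=> l E; apply: gl; exists l.
Qed.

Lemma ind_measure_copy (A : set X) : measurable A -> A `<=` range iota ->
  mu A = ((idx%:R^-1)%:E * nu (iota @^-1` A))%E.
Proof.
move=> mA AY; rewrite [mu A]/(@ind_measure _ _ _ L _ _ _ beta A) /ind_measure.
(* Only the representative of L itself contributes. It may differ from 1, but by [ind_class_measure]
   it gives the same measure. *)
congr (_ * _)%E; rewrite (bigD1_seq (coset_rep L 1%g))/=;
  [|exact: coset_rep_mem|exact: coset_reps_uniq].
rewrite big_seq_cond big1 => [|h /andP[hr h1]].
  by rewrite adde0 [in RHS](coset_decomp L 1%g) ind_class_measure.
rewrite ind_image_out// => l hl; case/eqP: h1.
by rewrite -(coset_reps_id hfin hr) hl -[val l]mul1g coset_repM.
Qed.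

Lemma ind_res_chi (A : set X) : measurable A ->
  cres ind_compression (chi mu Z A) = chi nu Z (iota @^-1` A).
Proof.
move=> mA; rewrite (@chiE _ _ _ mu Z A mA).
rewrite (@chiE _ _ _ nu Z _ (ind_measurable_preimage 1%g mA)).
rewrite [LHS]ind_res_class; congr Linfty_class.
by apply/val_inj/funext => y.
Qed.

Lemma ind_res_const z :
  cres ind_compression (Linfty_const mu z) = Linfty_const nu z.
Proof.
rewrite [LHS]ind_res_class; congr Linfty_class; exact/val_inj.
Qed.

Lemma ind_scale_gt0 : 0 < idx%:R^-1 :> R.
Proof. by rewrite invr_gt0 ltr0n subgroup_index_gt0. Qed.

Lemma ind_extend_norm v :
  Linfty_norm1 (cext ind_compression v) = idx%:R^-1 * Linfty_norm1 v.
Proof.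
rewrite -(Linfty_reprK v) [cext _ _]ind_extend_class.
apply: (Linfty_norm1_transport (phi := iota) (k := (idx%:R^-1)%:nng)
  (D := range iota)).
- exact: measurable_ind_class.
- exact: ind_image_measurable.
- by apply/seteqP; split=> // y _; exists y.
- by move=> A mA AY; rewrite ind_measure_copy.
- by move=> x xY; rewrite /= /ind_extfun asboolF.
- by move=> y; rewrite /= ind_extfun_iota.
Qed.

(** As h [1, y] = [h, y], the sum is the one that defines the induced measure, whose normalisation
    cancels. *)
Lemma ind_vol (A : set X) : measurable A ->
  \sum_(h <- coset_reps L) fine (nu (iota @^-1` (alpha h @^-1` A))) =
  idx%:R * fine (mu A).
Proof.
move=> mA; rewrite [mu A]/(@ind_measure _ _ _ L _ _ _ beta A) /ind_measure.
have nuE h : nu (cls h @^-1` A) = (fine (nu (cls h @^-1` A)))%:E.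
  by rewrite fineK// fin_num_measure//; exact: ind_measurable_preimage.
under [in RHS]eq_bigr do rewrite nuE.
rewrite sumEFin -EFinM /= mulrA mulfV ?mul1r; last first.
  by rewrite pnatr_eq0 -lt0n subgroup_index_gt0.
by apply: eq_bigr => h _; rewrite ind_act_preimage mulg1.
Qed.

Definition ind_space_compression : space_compression alpha beta Z :=
  @SpaceCompression R G S L d d X mu Y nu alpha beta Z ind_compression iota
    (ind_measurable_preimage 1%g) ind_res_chi ind_res_const idx%:R^-1
    ind_scale_gt0 ind_extend_norm ind_vol.

Lemma ind_extend_chi (B : set Y) : measurable B ->
  cext ind_compression (chi nu Z B) = chi mu Z (iota @` B).
Proof.
move=> mB; rewrite (@chiE _ _ _ nu Z B mB).
rewrite (@chiE _ _ _ mu Z _ (ind_image_measurable mB)).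
rewrite [LHS]ind_extend_class; congr Linfty_class.
apply/val_inj; apply: (ind_extfun_eq hfin) => [l y|g y gL] /=; rewrite !indicE.
  congr (_%:R); congr nat_of_bool; apply/idP/idP => /set_mem h; apply/mem_set.
    by have : (cls (val l) @^-1` (iota @` B)) y by []; rewrite ind_image_val.
  by have : (beta l @^-1` B) y by []; rewrite -ind_image_val.
rewrite memNset// => h.
have : (cls g @^-1` (iota @` B)) y by [].
by rewrite ind_image_out//; exact: image_subset.
Qed.

Lemma ind_image_vol (B : set Y) : measurable B ->
  fine (mu (iota @` B)) = idx%:R^-1 * fine (nu B).
Proof.
move=> mB; rewrite ind_measure_copy; [|exact: ind_image_measurable|exact: image_subset].
have -> : iota @^-1` (iota @` B) = B.
  apply/seteqP; split=> y; last by exists y.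
  by move=> [z Bz /(ind_class_inj (g := 1%g)) <-].
by rewrite fineM// fin_num_measure.
Qed.

Lemma ind_orth g b : (forall l : L, g <> val l) ->
  cres ind_compression (Linfty_action alpha Z g (cext ind_compression b)) = 0.
Proof.
move=> gL; rewrite -(Linfty_reprK b) [cext _ _]ind_extend_class.
rewrite [Linfty_action _ _ _ _]Linfty_translate_class [LHS]ind_res_class.
rewrite -Linfty_class0; congr Linfty_class; apply/val_inj/funext => y /=.
rewrite ind_act_class mulg1 ind_extfun_out// => l E.
by apply: (gL l^-1%g); rewrite valVg -E invgK.
Qed.

Lemma ind_part : \sum_(h <- coset_reps L)
  Linfty_action alpha Z h (cext ind_compression 1) = 1.
Proof.
pose e : Defs.bounded_fun mu Z := ind_ext beta hfin 1.
have eE : cext ind_compression 1 = Linfty_class e.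
  by rewrite -Linfty_class1 [LHS]ind_extend_class.
rewrite eE (eq_bigr (fun h => Linfty_class (translate alpha h e))); last first.
  by move=> h _; exact: Linfty_translate_class.
rewrite -(big_morph _ (@Linfty_classD _ _ _ mu Z) (Linfty_class0 mu Z)).
rewrite -Linfty_class1; congr Linfty_class; apply/val_inj/funext => q.
(* The identity holds at every point: at [g, y] with g a representative, the term for h = g is 1,
   while for h != g the element h^-1 g lies outside L and the term is 0. *)
have [g [y [gr ->]]] := ind_class_reps hfin q.
rewrite raddf_sum fct_sumE (bigD1_seq g)//= ?coset_reps_uniq//.
rewrite ind_act_class mulVg -[1%g](val1 L) ind_extfun_val big_seq_cond big1.
  by rewrite addr0.
move=> h /andP[hr hg] /=; rewrite ind_act_class ind_extfun_out// => l E.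
case/eqP: hg; apply: (@coset_decomp_inj _ _ _ hfin h g l 1%g hr gr _).1.
by rewrite -E val1 mulg1 mulVKg.
Qed.

Definition ind_induced_compression : induced_compression alpha beta Z :=
  @InducedCompression R G S L d d X mu Y nu alpha beta Z ind_space_compression
    (@ind_class_inj _ _ _ _ _ _ _ beta 1%g) ind_image_measurable ind_extend_chi
    ind_image_vol ind_orth ind_part.

End InducedCompression.

Unset Implicit Arguments.
Local Open Scope ereal_scope.

Theorem proposition14p1 (R : realType) (n : nat) (G : groupType) (S : pred G)
    (L : subGroupType S) (hFP : type_FP G n.+1) (hfin : finite_index L)
    (Z : coeff)
    (CG : free_resolution Z G) (CL : free_resolution Z L)
    (CGint : free_resolution CoeffInt G) (CLint : free_resolution CoeffInt L) :
  (forall (d : measure_display) (X : measurableType d) (mu : probability X R)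
      (alpha : pmp_action G mu), standard_action alpha ->
    medim (restrict_action L alpha) CL n <=
      (subgroup_index L)%:R%:E * medim alpha CG n /\
    mevol (restrict_action L alpha) CLint n <=
      (subgroup_index L)%:R%:E * mevol alpha CGint n) /\
  (forall (d : measure_display) (Y : measurableType d) (nu : probability Y R)
      (beta : pmp_action L nu), standard_action beta ->
    medim (ind_action beta hfin) CG n =
      ((subgroup_index L)%:R^-1)%:E * medim beta CL n /\
    mevol (ind_action beta hfin) CGint n =
      ((subgroup_index L)%:R^-1)%:E * mevol beta CLint n).
Proof.
split=> [d X mu alpha _|d Y nu beta _]; split.
- exact: medim_compression (restrict_space_compression L alpha Z) _ _ _ hfin.
- exact: mevol_compression (restrict_space_compression L alpha CoeffInt) _ _ _ hfin.
- apply/eqP; rewrite eq_le; apply/andP; split.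
    exact: medim_induced (ind_induced_compression beta hfin Z) _ _ _ hfin.
  (* With [G : L] moved to the other side, the remaining inequality is the compression to the copy
     of Y. *)
  rewrite lee_pdivrMl ?ltr0n ?subgroup_index_gt0//.
  exact: medim_compression (ind_space_compression beta hfin Z) _ _ _ hfin.
apply/eqP; rewrite eq_le; apply/andP; split.
  exact: mevol_induced (ind_induced_compression beta hfin CoeffInt) _ _ _ hfin.
rewrite lee_pdivrMl ?ltr0n ?subgroup_index_gt0//.
exact: mevol_compression (ind_space_compression beta hfin CoeffInt) _ _ _ hfin.
Qed.
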